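(* Let $(X,\mathcal{B},\mu)$ be a standard Borel probability space without atoms, let $f_1,\dots,f_n\in L^{\infty}(X)$, and let $g_i:A_i\to B_i$, $i=1,\dots,n$, be measure preserving Borel partial isomorphisms of $X$ (bijections between measurable subsets $A_i,B_i$ of $X$) that are among the generators of an (SP1) equivalence relation $\mathcal{R}$ on $X$. Suppose that $$\mu(A_1\cup A_2\cup\dots\cup A_n)=1$$ and $$\mu(B_i\cap B_j)=0\quad\text{if } i\neq j.$$ Then the Fuglede-Kadison determinant of the operator $T=\sum_{i=1}^n M_{f_i}L_{g_i}\in\mathcal{M}(\mathcal{R})$ is given by $$\log\Delta(T)=\sum_{i=1}^n\int_{B_i}\log|f_i(x)|\,d\mu(x).$$
   Context: Let $(X,\mathcal{B},\mu)$ be a standard Borel probability space without atoms. Generated relation: let $\Lambda=\{g_i:A_i\to B_i \mid i\in I\}$ be an at most countable family of measure preserving Borel bijections between measurable subsets of $X$. A word $\omega=g_{i_1}^{\varepsilon_1}\cdots g_{i_k}^{\varepsilon_k}$, $\varepsilon_t=\pm1$, denotes the composition of partial maps (rightmost applied first) on its maximal domain. $\mathcal{R}_{\Lambda}\subset X\times X$ is the equivalence relation with $(x,y)\in\mathcal{R}_\Lambda$ (written $x\sim y$) iff $x=y$ or there is a word $\omega$ whose domain contains $x$ with $\omega x=y$. ''The $g_i$ are among the generators of $\mathcal{R}$'' means $\mathcal{R}=\mathcal{R}_\Lambda$ for some such family $\Lambda$ having $g_1,\dots,g_n$ among its members. (SP1): an equivalence relation $\mathcal{R}$ on $X$ is (SP1)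 if (S) almost every orbit $\{y: y\sim x\}$ is at most countable and $\mathcal{R}$ is a Borel subset of $X\times X$; and (P) every automorphism of $(X,\mu)$ whose graph is contained in $\mathcal{R}$ preserves $\mu$. Feldman-Moore algebra: for $\mathcal{R}=\mathcal{R}_\Lambda$, $L^2(\mathcal{R})$ is the Hilbert space of (classes of) measurable $\Psi:\mathcal{R}\to\mathbb{C}$ with finite norm for the inner product $\langle\Psi,\Phi\rangle=\int_X\sum_{z\sim x}\Psi(x,z)\overline{\Phi(x,z)}\,d\mu(x)$. For a word $\omega$ (in particular for $\omega=g\in\Lambda$) and $f\in L^\infty(X)$ define operators on $L^2(\mathcal{R})$ by $$(L_\omega\Psi)(x,y)=\chi_{D_\omega}(x)\Psi(\omega^{-1}x,y),\qquad (M_f\Psi)(x,y)=f(x)\Psi(x,y),$$ where $D_\omega$ is the domain of $\omega^{-1}$ (the first expression is read as $0$ when $x\notin D_\omega$). $\mathcal{M}(\mathcal{R})$ is the von Neumann algebra given by the weak closure of the linear span of all products of the operators $L_g$, $L_{g^{-1}}$ ($g\in\Lambda$) and $M_f$ ($f\in L^\infty(X)$). Its trace is $\tau(T)=\langle T\delta_0,\delta_0\rangle$, where $\delta_0$ is the characteristic function of the diagonal of $\mathcal{R}$; it is a faithful normal tracial state. Fuglede-Kadison determinant: for $T\in\mathcal{M}(\mathcal{R})$ let $|T|=\sqrt{T^*T}$, let $E$ be the spectral measure of $|T|$ and $\mu_{|T|}=\tau\circ E$. Then $\Delta(T)=\exp\left(\int_0^\infty\log t\,d\mu_{|T|}(t)\right)$,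 with $\log 0=-\infty$ and $\exp(-\infty)=0$, so $\log\Delta(T)\in[-\infty,\infty)$ (both sides of the asserted formula may equal $-\infty$). *)

(* Defs.v *)
From HB Require Import structures.
From mathcomp Require Import all_boot all_order all_algebra.
From mathcomp Require Import all_classical all_reals all_analysis.
From mathcomp Require Import complex.

Set Implicit Arguments.
Unset Strict Implicit.
Unset Printing Implicit Defensive.
Import Order.TTheory GRing.Theory Num.Theory.
Import numFieldNormedType.Exports.

Local Open Scope classical_set_scope.
Local Open Scope ring_scope.

(* The sigma-algebra is the Borel sigma-algebra of a complete separable
   metric; in [Y], a Hausdorff pseudometric is a metric. *)
Definition standard_borel (R : realType) d (X : measurableType d) : Prop :=
  exists (Y : completePseudoMetricType R) (phi : X -> Y),
    [/\ hausdorff_space Y,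
        exists2 D : set Y, countable D & dense D,
        bijective phi
      & forall A : set X,
          measurable A <-> <<s [set U : set Y | open U] >> (phi @` A)].

Definition atomless (R : realType) d (X : measurableType d)
    (mu : probability X R) : Prop :=
  forall A, measurable A -> (0 < mu A)%E ->
    exists B, [/\ measurable B, B `<=` A, (0 < mu B)%E & (mu B < mu A)%E].

(* [pfun] and [ppartinv] are only meaningful on [pdom] and [pcod]. *)
Record partial_iso (R : realType) d (X : measurableType d)
    (mu : probability X R) := PartialIso {
  pdom : set X;
  pcod : set X;
  pfun : X -> X;
  ppartinv : X -> X;
  pdom_measurable : measurable pdom;
  pcod_measurable : measurable pcod;
  pfun_cod : forall x, pdom x -> pcod (pfun x);
  ppartinv_dom : forall y, pcod y -> pdom (ppartinv y);
  pfunK : forall x, pdom x -> ppartinv (pfun x) = x;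
  ppartinvK : forall y, pcod y -> pfun (ppartinv y) = y;
  pfun_measurable : measurable_fun pdom pfun;
  ppartinv_measurable : measurable_fun pcod ppartinv;
  pfun_preserves : forall A, measurable A -> A `<=` pdom ->
    mu (pfun @` A) = mu A }.

Lemma ppartinv_preserves (R : realType) d (X : measurableType d)
    (mu : probability X R) (g : partial_iso mu) (A : set X) :
  measurable A -> A `<=` pcod g -> mu (ppartinv g @` A) = mu A.
Proof.
move=> mA Ag.
have imE : ppartinv g @` A = pdom g `&` pfun g @^-1` A.
  apply/seteqP; split => [_ [y Ay <-]|x [gx Ax]] /=.
    split; first exact: ppartinv_dom (Ag _ Ay).
    by rewrite ppartinvK//; exact: Ag.
  by exists (pfun g x) => //; exact: pfunK.
have mim : measurable (ppartinv g @` A).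
  by rewrite imE; apply: pfun_measurable => //; exact: pdom_measurable.
rewrite -(pfun_preserves (p := g) mim); last by rewrite imE => x [].
congr (mu _); apply/seteqP; split => [_ [_ [y Ay <-] <-]|y Ay].
  by rewrite ppartinvK//; exact: Ag.
exists (ppartinv g y); first by exists y.
by rewrite ppartinvK//; exact: Ag.
Qed.

Definition piso_inv (R : realType) d (X : measurableType d)
    (mu : probability X R) (g : partial_iso mu) : partial_iso mu :=
  PartialIso (pcod_measurable g) (pdom_measurable g)
    (@ppartinv_dom _ _ _ _ g) (@pfun_cod _ _ _ _ g)
    (@ppartinvK _ _ _ _ g) (@pfunK _ _ _ _ g)
    (ppartinv_measurable (p := g)) (pfun_measurable (p := g))
    (@ppartinv_preserves _ _ _ _ g).

Section GeneratedRelation.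
Variables (R : realType) (d : measure_display) (X : measurableType d).
Variables (mu : probability X R) (I : countType) (Lam : I -> partial_iso mu).

(* The letter [(i, true)] is g_i and [(i, false)] is its inverse. *)
Definition letter (a : I * bool) : partial_iso mu :=
  if a.2 then Lam a.1 else piso_inv (Lam a.1).

(* [word_maps w x y]: x lies in the maximal domain of w and w x = y; the
   rightmost letter acts first. *)
Fixpoint word_maps (w : seq (I * bool)) (x y : X) : Prop :=
  if w is a :: w' then
    exists2 z, word_maps w' x z & pdom (letter a) z /\ pfun (letter a) z = y
  else x = y.

Definition generated_rel : set (X * X) :=
  [set p | p.1 = p.2 \/ exists w, word_maps w p.1 p.2].

End GeneratedRelation.

Definition orbit_of (T : Type) (rel : set (T * T)) (x : T) : set T :=
  [set z | rel (x, z)].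

(* Nonsingular Borel automorphisms; preserving mu is not part of it. *)
Definition automorphism (R : realType) d (X : measurableType d)
    (mu : probability X R) (phi : X -> X) : Prop :=
  [/\ measurable_fun setT phi,
      exists psi, [/\ cancel phi psi, cancel psi phi & measurable_fun setT psi]
    & forall A, measurable A -> (mu (phi @^-1` A) = 0 <-> mu A = 0)%E].

Definition SP1 (R : realType) d (X : measurableType d)
    (mu : probability X R) (rel : set (X * X)) : Prop :=
  [/\ [/\ forall x, rel (x, x),
          forall x y, rel (x, y) -> rel (y, x)
        & forall x y z, rel (x, y) -> rel (y, z) -> rel (x, z)],
      \forall x \ae mu, countable (orbit_of rel x),
      measurable rel
    & forall phi, automorphism mu phi -> (forall x, rel (x, phi x)) ->
        forall A, measurable A -> mu (phi @^-1` A) = mu A].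

Definition Linfty (R : realType) d (X : measurableType d)
    (mu : probability X R) (f : X -> R[i]) : Prop :=
  [/\ measurable_fun setT (fun x => complex.Re (f x)),
      measurable_fun setT (fun x => complex.Im (f x))
    & exists M : R, \forall x \ae mu, Normc.normc (f x) <= M].

(* An element of L^2(rel) is given by a representative X * X -> R[i], whose
   values outside [rel] are irrelevant; [eqL2] is equality of classes. *)
Section FeldmanMoore.
Variables (R : realType) (d : measure_display) (X : measurableType d).
Variables (mu : probability X R) (rel : set (X * X)).

Local Notation C := R[i].
Local Notation vec := (X * X -> R[i]).
Local Notation op := ((X * X -> R[i]) -> X * X -> R[i]).

Implicit Types (Psi Phi : vec) (T S : op).

(* Unordered sums, meaningful for absolutely summable families. *)
Definition rsum (D : set X) (u : X -> R) : R :=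
  fine (\esum_(z in D) (Num.max (u z) 0)%:E) -
  fine (\esum_(z in D) (Num.max (- u z) 0)%:E).

Definition csum (D : set X) (u : X -> C) : C :=
  Complex (rsum D (fun z => complex.Re (u z)))
          (rsum D (fun z => complex.Im (u z))).

Definition cintegral (u : X -> C) : C :=
  Complex (\int[mu]_x complex.Re (u x)) (\int[mu]_x complex.Im (u x)).

Definition inner Psi Phi : C :=
  cintegral (fun x =>
    csum (orbit_of rel x) (fun z => Psi (x, z) * (Phi (x, z))^*%C)).

Definition normL2_sqr Psi : \bar R :=
  (\int[mu]_x \esum_(z in orbit_of rel x)
     ((Normc.normc (Psi (x, z))) ^+ 2)%:E)%E.

Definition normL2 Psi : R := Num.sqrt (fine (normL2_sqr Psi)).

Definition memL2 Psi : Prop :=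
  [/\ measurable_fun rel (fun p => complex.Re (Psi p)),
      measurable_fun rel (fun p => complex.Im (Psi p))
    & (normL2_sqr Psi < +oo)%E].

Definition eqL2 Psi Phi : Prop :=
  \forall x \ae mu, forall z, rel (x, z) -> Psi (x, z) = Phi (x, z).

Definition bounded_op T : Prop :=
  [/\ forall Psi, memL2 Psi -> memL2 (T Psi),
      forall Psi Phi, memL2 Psi -> memL2 Phi ->
        eqL2 Psi Phi -> eqL2 (T Psi) (T Phi),
      forall (a : C) Psi Phi, memL2 Psi -> memL2 Phi ->
        eqL2 (T (fun p => a * Psi p + Phi p)) (fun p => a * T Psi p + T Phi p)
    & exists M : R, forall Psi, memL2 Psi -> normL2 (T Psi) <= M * normL2 Psi].

Definition eq_op_L2 S T : Prop :=
  forall Psi, memL2 Psi -> eqL2 (S Psi) (T Psi).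

Definition is_adjoint T S : Prop :=
  bounded_op S /\ forall Psi Phi, memL2 Psi -> memL2 Phi ->
    inner (T Psi) Phi = inner Psi (S Phi).

(* In R[i], 0 <= z means that z is real and nonnegative. *)
Definition positive_op S : Prop :=
  forall Psi, memL2 Psi -> 0 <= inner (S Psi) Psi.

Definition is_sqrt T S : Prop :=
  [/\ bounded_op S, positive_op S & eq_op_L2 (S \o S) T].

(* The following operators are unique up to [eq_op_L2] when they exist, and
   exist for bounded T (resp. bounded positive T); [id] is a default value. *)
Definition adjoint T : op := xget (id : op) [set S | is_adjoint T S].

Definition sqrt_op T : op := xget (id : op) [set S | is_sqrt T S].

Definition abs_op T : op := sqrt_op (adjoint T \o T).

Definition projection_valued_measure (E : set R -> op) : Prop :=
  [/\ forall B, measurable B -> bounded_op (E B) /\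
        (forall Psi Phi, memL2 Psi -> memL2 Phi ->
           inner (E B Psi) Phi = inner Psi (E B Phi)),
      forall A B, measurable A -> measurable B ->
        eq_op_L2 (E (A `&` B)) (E A \o E B),
      eq_op_L2 (E setT) id
    & forall F : nat -> set R, (forall k, measurable (F k)) ->
        trivIset setT F -> forall Psi, memL2 Psi ->
        normL2 (fun p =>
          \sum_(k < N) E (F k) Psi p - E (\bigcup_k F k) Psi p)
          @[N --> \oo] --> (0 : R)].

(* <E(B) Psi, Psi> is real and nonnegative, hence the real part. *)
Definition scalar_measure (E : set R -> op) Psi (B : set R) : \bar R :=
  (complex.Re (inner (E B Psi) Psi))%:E.

(* S is the integral of t dE(t), stated on quadratic forms, which determine a
   bounded operator of a complex Hilbert space. *)
Definition is_spectral_measure S (E : set R -> op) : Prop :=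
  projection_valued_measure E /\
  forall Psi, memL2 Psi ->
    (scalar_measure E Psi).-integrable setT (fun t : R => t%:E) /\
    inner (S Psi) Psi =
      Complex (fine (\int[scalar_measure E Psi]_t t%:E)) 0.

Definition spectral_measure S : set R -> op :=
  xget ((fun _ => id) : set R -> op) [set E | is_spectral_measure S E].

Definition Lop (g : partial_iso mu) : op := fun Psi p =>
  if p.1 \in pcod g then Psi (ppartinv g p.1, p.2) else 0.

Definition Mop (f : X -> C) : op := fun Psi p => f p.1 * Psi p.

Section Algebra.
Variables (I : countType) (Lam : I -> partial_iso mu).

Definition FM_generator : set op :=
  [set S | [\/ exists i, S = Lop (Lam i),
               exists i, S = Lop (piso_inv (Lam i))
             | exists2 f, Linfty mu f & S = Mop f]].

Definition FM_span : set op :=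
  [set S | exists m (c : 'I_m -> C) (w : 'I_m -> seq op),
     (forall j L, L \in w j -> FM_generator L) /\
     S = fun Psi p => \sum_(j < m) c j * (foldr comp id (w j)) Psi p].

(* Closure in the weak operator topology. *)
Definition FM_algebra : set op :=
  [set T | bounded_op T /\
     forall m (Psi Phi : 'I_m -> vec) (e : R), 0 < e ->
       (forall j, memL2 (Psi j) /\ memL2 (Phi j)) ->
       exists2 S, FM_span S & forall j,
         Normc.normc (inner (T (Psi j)) (Phi j) - inner (S (Psi j)) (Phi j)) < e].

End Algebra.

Definition delta0 : vec := fun p => (p.1 == p.2)%:R.

Definition trace T : C := inner (T delta0) delta0.

(* tau o E for E the spectral measure of |T|; it is real, hence the real
   part. *)
Definition abs_distribution T (B : set R) : \bar R :=
  (complex.Re (trace (spectral_measure (abs_op T) B)))%:E.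

(* [lne 0 = -oo] and [expeR -oo = 0]. *)
Definition FK_det T : \bar R :=
  expeR (\int[abs_distribution T]_(t in `[0%R, +oo[%classic) lne t%:E)%E.

End FeldmanMoore.

(* Main.v *)
(* Modulo null sets both the domains A_i and the codomains B_i partition X, so
   that T is a weighted composition operator and T^* T is multiplication by h^2,
   where h = |f_i o g_i| on A_i. The positive square root of a multiplication
   operator by a nonnegative function being unique, |T| is multiplication by h.
   Likewise a spectral measure of this operator is unique: if E is the
   projection of (-oo, a], then (h - a)(1 - 2 E) is a positive square root of
   (h - a)^2, hence is multiplication by |h - a|, which determines E. Therefore
   the spectral distribution of |T| is the law of h under mu, and log Delta(T)
   is the integral of log h; the changes of variables g_i turn it into the
   stated sum. *)
Require Import Defs.
From HB Require Import structures.
From mathcomp Require Import all_boot all_order all_algebra.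
From mathcomp Require Import all_classical all_reals all_analysis.
From mathcomp Require Import measurable_realfun complex.
From mathcomp Require Import ring lra.

Set Implicit Arguments.
Unset Strict Implicit.
Unset Printing Implicit Defensive.
Import Order.TTheory GRing.Theory Num.Theory.
Import numFieldNormedType.Exports.

Local Open Scope classical_set_scope.
Local Open Scope ring_scope.

(** * Positive forms and square roots *)

(** The adjoint, the square root and the spectral measure are arbitrary choices among the objects
    with the defining property, so each needs an existence proof and enough uniqueness to fix its
    quadratic form. The obstacle is that an unknown root P visibly commutes with h^2 but not with h;
    the usual remedy approximates h by polynomials in h^2. Here only polynomials in the known
    operator h occur, and P is seen through its form alone. To avoid quotients, the abstract part
    works with a nonnegative symmetric real form on a bare type, [lc a u v] standing for a u + v,
    and equality is equality of all pairings. The real part of the inner product suffices, as the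
    imaginary part is the real pairing with i times the second vector. Comparing projections says
    nothing on the level set h = a, where h - a vanishes; there the strict positivity of t - a on
    the spectrum of the complement of E decides. That the A_i are disjoint modulo null sets is a
    count: their measures add up to those of the disjoint B_i, hence to at most 1, while they cover
    almost all of X. *)

Section real_form.
Context (R : realType) (V : Type) (lc : R -> V -> V -> V) (r : V -> V -> R).
Hypothesis r_lc : forall a u v w, r (lc a u v) w = a * r u w + r v w.
Hypothesis r_sym : forall u v, r u v = r v u.
Hypothesis r_ge0 : forall u, 0 <= r u u.
Implicit Types (u v w : V) (T P Q A E : V -> V).

Definition symmetric_op T := forall u v, r (T u) v = r u (T v).

Lemma r_lcr a u v w : r w (lc a u v) = a * r w u + r w v.
Proof. by rewrite r_sym r_lc !(r_sym w). Qed.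

Lemma form_cauchy_schwarz u v : r u v ^+ 2 <= r u u * r v v.
Proof.
have h t : 0 <= t ^+ 2 * r u u + 2 * t * r u v + r v v.
  have := r_ge0 (lc t u v); rewrite r_lc !r_lcr (r_sym v u); lra.
have [r0|r0] := eqVneq (r u u) 0; last first.
  have rp : 0 < r u u by rewrite lt_neqAle eq_sym r0 r_ge0.
  have := h (- (r u v / r u u)); move: (r u u) (r u v) (r v v) r0 rp => a b c a0 ap.
  rewrite (_ : _ + c = c - b ^+ 2 / a); last by field.
  by rewrite subr_ge0 ler_pdivrMr// mulrC.
suff -> : r u v = 0 by rewrite expr0n mulr_ge0.
apply/eqP/negPn/negP => b0.
(* The quadratic in t degenerates to an affine function, and this t gives it the value -1. *)
have := h (- (r v v + 1) / (2 * r u v)).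
rewrite r0 mulr0 add0r (_ : _ * r u v = - (r v v + 1)); last by field.
by lra.
Qed.

Lemma form_null u v : r u u = 0 -> r u v = 0.
Proof.
move=> u0; have := form_cauchy_schwarz u v; rewrite u0 mul0r => h.
by apply/eqP; rewrite -sqrf_eq0 eq_le h sqr_ge0.
Qed.

End real_form.

Section real_form_operators.
Context (R : realType) (V : Type) (lc : R -> V -> V -> V) (r : V -> V -> R).
Hypothesis r_lc : forall a u v w, r (lc a u v) w = a * r u w + r v w.
Hypothesis r_sym : forall u v, r u v = r v u.
Hypothesis r_ge0 : forall u, 0 <= r u u.
Implicit Types (u v w : V) (P Q A E : V -> V).
Local Notation symmetric_op := (symmetric_op r).

(** Operators are not assumed linear: symmetry transfers the linearity of the form to them. *)
Lemma symmetric_op_lc P a u v w : symmetric_op P ->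
  r (P (lc a u v)) w = a * r (P u) w + r (P v) w.
Proof. by move=> Ps; rewrite Ps r_lc -!Ps. Qed.

(** Cauchy-Schwarz for the form <P u, v>, which is itself symmetric and nonnegative. *)
Lemma positive_op_null P u v : symmetric_op P -> (forall w, 0 <= r (P w) w) ->
  r (P u) u = 0 -> r (P u) v = 0.
Proof.
move=> Ps Pp Pu0; apply: (form_null (lc := lc) (r := fun u v => r (P u) v)) => //.
  by move=> *; exact: symmetric_op_lc.
by move=> u' v'; rewrite Ps r_sym.
Qed.

(* With X = P - Q one has X Q = - P X, so X^2 commutes with Q and
   X^2 Q = - X P X <= 0. Writing Q = c (K_0^2 + K_1^2 + ...), where each K_j is
   a polynomial in Q, also shows X^2 Q >= 0. Hence P X = 0 and then X = 0. *)
Lemma positive_sqrt_unique P Q (K : nat -> V -> V) c :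
  symmetric_op P -> (forall u, 0 <= r (P u) u) ->
  symmetric_op Q -> 0 < c ->
  (forall u w, r (P u) (P w) = r (Q u) (Q w)) ->
  (forall j, symmetric_op (K j)) ->
  (forall u w, r (Q u) w = c * r (K 0%N u) w) ->
  (forall j u w, r (K j.+1 u) w = r (K j u) w - r (K j u) (K j w)) ->
  (forall j u, r (K j u) (K j u) <= j.+1%:R^-1 ^+ 2 * r u u) ->
  forall u w, r (P u) w = r (Q u) w.
Proof.
move=> Ps Pp Qs c0 PQ Ks QK KS Kle.
pose X u := lc (-1) (Q u) (P u).
have XE u w : r (X u) w = r (P u) w - r (Q u) w by rewrite r_lc mulN1r addrC.
have Xs : symmetric_op X.
  by move=> u w; rewrite XE Ps Qs r_sym [r u (Q w)]r_sym -XE r_sym.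
have XQ u z : r (X (Q u)) z = - r (P (X u)) z.
  by rewrite XE Ps (Qs (Q u)) -PQ (Ps (X u)) XE opprB.
have bQ u : r (X (Q u)) (X u) <= 0.
  by rewrite XQ oppr_le0.
have bQs u v : r (X (Q u)) (X v) = r (X u) (X (Q v)).
  by rewrite XQ (r_sym (X u)) XQ Ps r_sym.
(* X^2 commutes with Q, hence with K_0 = Q / c, and the recursion K_{j+1} = K_j - K_j^2 propagates
   this to every K_j. *)
have bK j u v : r (X (K j u)) (X v) = r (X u) (X (K j v)).
  elim: j u v => [|j IH] u v.
    have cn0 : c != 0 by rewrite gt_eqF.
    apply: (mulfI cn0).
    have e t s : c * r (X (K 0%N t)) (X s) = r (X (Q t)) (X s).
      by rewrite !Xs QK.
    by rewrite e bQs r_sym -e r_sym.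
  have e t s : r (X (K j.+1 t)) (X s) = r (X (K j t)) (X s) - r (X (K j (K j t))) (X s).
    by rewrite !Xs KS -(Ks j (K j t)).
  by rewrite e [RHS]r_sym e (IH u v) (IH (K j u) v) (IH u (K j v)) !(r_sym (X u)).
(* K_j - K_{j+1} = K_j^2 turns the difference of successive forms into a square, so the forms
   decrease with j. *)
have bK2 j u : r (X (K j u)) (X u) =
    r (X (K j.+1 u)) (X u) + r (X (K j u)) (X (K j u)).
  rewrite (Xs (K j.+1 u)) KS (Xs (K j u) (X u)).
  have -> : r (K j u) (K j (X (X u))) = r (X (K j (K j u))) (X u).
    by rewrite -Ks -Xs.
  by rewrite bK subrK.
have b0 N u : r (X (K N u)) (X u) <= r (X (K 0%N u)) (X u).
  elim: N => // N; apply: le_trans.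
  by rewrite [leRHS]bK2 lerDl.
(* K_N has norm at most 1 / (N + 1), so this lower bound tends to 0; with [b0] it makes the form of
   X^2 K_0 nonnegative. The sum of the squared norms dominates the product of the norms and spares a
   square root. *)
have bN N u : - (r u u + r (X (X u)) (X (X u))) * N.+1%:R^-1 <= r (X (K N u)) (X u).
  rewrite (Xs (K N u) (X u)); set w := X (X u); set e := N.+1%:R^-1.
  have e0 : 0 < e by rewrite invr_gt0.
  have := form_cauchy_schwarz r_lc r_sym r_ge0 (K N u) w.
  have := Kle N u; rewrite -/e => Kl /le_trans/(_ (ler_wpM2r (r_ge0 w) Kl)).
  have := r_ge0 u; have := r_ge0 w; move: (r u u) (r w w) (r (K N u) w) => a b x b0' a0' h.
  rewrite leNgt; apply/negP => hx.
  have s0 : 0 <= (a + b) * e by rewrite mulr_ge0 ?addr_ge0// ltW.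
  have h1 : 0 < (- x - (a + b) * e) * (- x + (a + b) * e).
    by rewrite mulr_gt0//; lra.
  have h2 : 0 <= e ^+ 2 * (a ^+ 2 + a * b + b ^+ 2).
    by apply: mulr_ge0; [exact: sqr_ge0|nra].
  nra.
(* The form of P at X u is minus that of X^2 Q, which is nonnegative in the limit; were it positive,
   some N would violate [bN]. *)
have PX u : r (P (X u)) (X u) = 0.
  apply/eqP; rewrite eq_le Pp andbT leNgt; apply/negP => hlt.
  have e : r (X (Q u)) (X u) = c * r (X (K 0%N u)) (X u) by rewrite !Xs QK.
  have hneg : r (X (K 0%N u)) (X u) < 0.
    by rewrite -(pmulr_rlt0 _ c0) -e XQ oppr_lt0.
  pose s := r u u + r (X (X u)) (X (X u)).
  have s0 : 0 <= s by rewrite addr_ge0.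
  have [s00|sn0] := eqVneq s 0.
    by have := le_trans (bN 0%N u) (b0 0%N u); rewrite -/s s00 oppr0 mul0r leNgt hneg.
  have sp : 0 < s by rewrite lt_neqAle eq_sym sn0.
  have ep : 0 < - r (X (K 0%N u)) (X u) / s by rewrite divr_gt0// oppr_gt0.
  have [N] := ltr_add_invr ep; rewrite add0r ltr_pdivlMr// => hN.
  by have := le_trans (bN N u) (b0 N u); rewrite -/s mulNr lerNl mulrC leNgt hN.
move=> u w.
(* Both terms of ||X u||^2 = <P X u, u> - <Q X u, u> vanish: the second form equals - <P X u, u>
   because X Q = - P X. *)
have Xu0 : r (X u) (X u) = 0.
  rewrite -Xs XE (positive_op_null _ Ps Pp (PX u)) Qs Xs sub0r.
  by rewrite (r_sym u) XQ (positive_op_null _ Ps Pp (PX u)) oppr0 oppr0.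
have := form_null r_lc r_sym r_ge0 w Xu0; rewrite XE => /eqP.
by rewrite subr_eq0 => /eqP.
Qed.

(* W = A (1 - 2 E) has the same square as A because E commutes with A. *)
Lemma signed_op_positive A E (W := fun u => A (lc (-2) (E u) u)) :
  symmetric_op A -> symmetric_op E ->
  (forall u w, r (E u) (E w) = r (E u) w) ->
  (forall u w, r (A (E u)) (lc (-1) (E w) w) = 0) ->
  (forall u, r (A (E u)) (E u) <= 0) ->
  (forall u, 0 <= r (A (lc (-1) (E u) u)) (lc (-1) (E u) u)) ->
  [/\ symmetric_op W, forall u, 0 <= r (W u) u &
      forall u w, r (W u) (W w) = r (A u) (A w)].
Proof.
move=> As Es EE AE0 AE AE'.
have AEE u w : r (A (E u)) w = r (A (E u)) (E w).
  by have := AE0 u w; rewrite (r_lcr r_lc r_sym); lra.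
have AC u w : r (E (A u)) w = r (A (E u)) w.
  by rewrite Es As r_sym AEE As r_sym -AEE.
have r_lcr' := r_lcr r_lc r_sym.
have Alc a u v w : r (A (lc a u v)) w = a * r (A u) w + r (A v) w.
  exact: symmetric_op_lc.
have AA u w : r (A (E u)) (A w) = r (A (E u)) (A (E w)).
  by rewrite AEE r_sym AC r_sym.
have Alcr a u v w : r w (A (lc a u v)) = a * r w (A u) + r w (A v).
  by rewrite r_sym Alc !(r_sym w).
split.
- by move=> u w; rewrite /W Alc -AC Es -As r_lcr'.
- move=> u; have := AE' u; have := AE u; rewrite /W !Alc !r_lcr' -!AEE.
  have e : r (A u) (E u) = r (A (E u)) u by rewrite -Es AC.
  by have := AEE u u; rewrite e; lra.
- move=> u w; rewrite /W !Alc !Alcr.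
  have e1 := AA u w; have e2 := AA w u.
  rewrite (r_sym (A (E w)) (A u)) (r_sym (A (E w)) (A (E u))) in e2.
  lra.
Qed.

End real_form_operators.

(** * Enumeration of the orbits *)
(** The complement of the diagonal is a countable union of rectangles U x U^c, where U runs through
    the interiors of balls about the points of a countable dense set. The diagonal is needed to
    detect where two words agree. *)
Lemma standard_borel_diag (R : realType) d (X : measurableType d) :
  standard_borel R X -> measurable [set p : X * X | p.1 = p.2].
Proof.
move=> [Y [phi [hY [D cD dD] bphi mphi]]].
have mopen (U : set Y) : open U -> measurable (phi @^-1` U).
  move=> oU; apply/mphi; rewrite image_preimage.
    exact: sub_sigma_algebra.
  have [psi _ psiK] := bphi.
  by apply/seteqP; split => // y _; exists (psi y).
pose U (y : Y) (n : nat) : set Y := (ball y n.+1%:R^-1 : set Y)^°.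
have mU y n : measurable (phi @^-1` U y n).
  by apply: mopen; exact: open_interior.
have -> : [set p : X * X | p.1 = p.2] =
    ~` \bigcup_(y in D) \bigcup_n
      ((phi @^-1` U y n) `*` ~` (phi @^-1` U y n)).
  rewrite -[LHS]setCK; congr (~` _); apply/seteqP; split; last first.
    by move=> [x x'] /= [y _ [n _ [/= + +]]] xx'; rewrite xx'.
  move=> [x x'] /= xx'.
  have /eqP phixx' : phi x <> phi x'.
    by move=> /(bij_inj bphi).
  have := hY; rewrite ball_hausdorff => /(_ _ _ phixx')[[e1 e2]] /=.
  move=> /eqP e12.
  (* The ball of radius [del] < e1 / 4 about a dense point within [del / 2] of [phi x] separates the
     points: if it contained [phi x'], that point would be within 3 [del] / 2 of [phi x], hence in
     the ball of radius e1. *)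
  have e14 : 0 < e1%:num / 4 by rewrite divr_gt0.
  have [n] := ltr_add_invr e14; rewrite add0r.
  set del := n.+1%:R^-1 => ne.
  have del0 : 0 < del :> R by rewrite invr_gt0.
  have hdel0 : 0 < del / 2 :> R by rewrite divr_gt0.
  have [y [/interior_subset yx yD]] : (ball (phi x) (del / 2) : set Y)^° `&` D !=set0.
    apply: dD; last exact: open_interior.
    by exists (phi x); exact: nbhsx_ballx.
  exists y => //; exists n => //; split => /=.
    apply/nbhs_ballP; exists (del / 2) => //= z.
    by move=> /(ball_triangle (ball_sym yx)); rewrite -splitr.
  move=> /interior_subset yx'.
  suff : (ball (phi x) e1%:num `&` ball (phi x') e2%:num) (phi x').
    by rewrite e12.
  split; last exact: ballxx.
  apply: (@le_ball _ _ _ (del / 2 + del)); first by lra.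
  exact: ball_triangle yx yx'.
apply: measurableC.
have mUn y : measurable (\bigcup_n
    ((phi @^-1` U y n) `*` ~` (phi @^-1` U y n))).
  apply: bigcupT_measurable => n.
  by apply: measurableX => //; exact: measurableC.
move: cD => /pfcard_geP[->|[e]]; first by rewrite bigcup_set0.
by rewrite -(image_eq e) bigcup_image; exact: bigcupT_measurable.
Qed.

Lemma measurable_fun_pair_in d d1 d2 (T : measurableType d)
    (T1 : measurableType d1) (T2 : measurableType d2) (D : set T)
    (f : T -> T1) (g : T -> T2) :
  measurable_fun D f -> measurable_fun D g ->
  measurable_fun D (fun x => (f x, g x)).
Proof.
move=> mf mg mD; move: (mD).
apply: (measurability _ (measurable_prod_measurableType T1 T2)).
move=> _ [_ [A mA [B mB <-]] <-].
rewrite (_ : _ `&` _ = (D `&` f @^-1` A) `&` (D `&` g @^-1` B)).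
  by apply: measurableI; [exact: mf|exact: mg].
by apply/seteqP; split => [x [Dx [Ax Bx]]|x [[Dx Ax] [_ Bx]]].
Qed.

Section words.
Context (R : realType) d (X : measurableType d) (mu : probability X R).
Context (I : countType) (Lam : I -> partial_iso mu).
Implicit Types (w : seq (I * bool)).

(** The partial map of a word as a total function, with junk values off [word_dom], so that its
    measurability can be stated. *)
Fixpoint word_fun w (x : X) : X :=
  if w is a :: w' then pfun (letter Lam a) (word_fun w' x) else x.

Fixpoint word_dom w : set X :=
  if w is a :: w' then
    word_dom w' `&` word_fun w' @^-1` pdom (letter Lam a)
  else setT.

Lemma word_mapsE w x y :
  word_maps Lam w x y <-> word_dom w x /\ word_fun w x = y.
Proof.
elim: w y => [|a w IH] y /=; first by split=> [->|[_ ->]].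
split=> [[z /IH[wx <-] [az <-]]|[[wx ax] <-]]; first by [].
by exists (word_fun w x) => //; exact/IH.
Qed.

Lemma word_measurable w :
  measurable (word_dom w) /\ measurable_fun (word_dom w) (word_fun w).
Proof.
elim: w => [|a w [mD mf]] /=; first by split => //; exact: measurable_id.
have mDa : measurable (word_dom w `&` word_fun w @^-1` pdom (letter Lam a)).
  by apply: mf => //; exact: pdom_measurable.
split => //.
apply: (@measurable_comp _ _ _ _ _ _ (pdom (letter Lam a))).
- exact: pdom_measurable.
- by move=> _ [x [_ ax] <-].
- exact: pfun_measurable.
- exact: measurable_funS mf.
Qed.

Hypothesis diagm : measurable [set p : X * X | p.1 = p.2].

Definition nth_word n : option (seq (I * bool)) := unpickle n.

Definition orbit_fun n x := if nth_word n is Some w then word_fun w x else x.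

(** An index that codes no word contributes no orbit point. *)
Definition pre_orbit_dom n := if nth_word n is Some w then word_dom w else set0.

(* Each orbit point is kept only at the first word that reaches it. *)
Definition orbit_dom n := pre_orbit_dom n `\` \bigcup_(j in `I_n)
  (pre_orbit_dom j `&` pre_orbit_dom n `&` [set x | orbit_fun j x = orbit_fun n x]).

Let pre_orbit_measurable n :
  measurable (pre_orbit_dom n) /\ measurable_fun (pre_orbit_dom n) (orbit_fun n).
Proof.
rewrite /pre_orbit_dom /orbit_fun; case: (nth_word n) => [w|].
  exact: word_measurable.
by split => //; exact: measurable_fun_set0.
Qed.

Lemma orbit_dom_measurable n : measurable (orbit_dom n).
Proof.
have [mD mf] := pre_orbit_measurable n.
apply: measurableD => //; apply: bigcup_measurable => j _.
have [mDj mfj] := pre_orbit_measurable j.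
have mI : measurable (pre_orbit_dom j `&` pre_orbit_dom n) by exact: measurableI.
rewrite (_ : [set _ | _] = (fun x => (orbit_fun j x, orbit_fun n x)) @^-1`
  [set p | p.1 = p.2])//.
have mp : measurable_fun (pre_orbit_dom j `&` pre_orbit_dom n)
    (fun x => (orbit_fun j x, orbit_fun n x)).
  apply: measurable_fun_pair_in; first exact: measurable_funS mfj.
  exact: measurable_funS mf.
exact: mp mI _ diagm.
Qed.

Lemma orbit_fun_measurable n : measurable_fun (orbit_dom n) (orbit_fun n).
Proof.
have [mD mf] := pre_orbit_measurable n.
by apply: measurable_funS mf => // x [].
Qed.

(** The least index reaching y survives in [orbit_dom], whence surjectivity; the removal of later
    repetitions gives injectivity. *)
Lemma orbit_bij x :
  set_bij [set n | orbit_dom n x] (orbit_of (generated_rel Lam) x)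
          (orbit_fun ^~ x).
Proof.
split.
- move=> n [+ _]; rewrite /pre_orbit_dom /orbit_fun /orbit_of.
  case: (nth_word n) => [w|] /= wx; last by case: wx.
  right; exists w => /=.
  exact/word_mapsE.
- move=> m n /set_mem + /set_mem; rewrite /=.
  wlog mn : m n / (m <= n)%N => [hw mx nx e|].
    have [mn|/ltnW nm] := leqP m n; first exact: hw.
    by apply: esym; exact: hw.
  move=> [mx _] [nx nx'] e; apply/eqP/negPn/negP => mn'.
  apply: nx'; have mltn : (m < n)%N by rewrite ltn_neqAle mn'.
  by exists m.
- move=> y; rewrite /orbit_of /= => h.
  have {h}[w /word_mapsE[wx wy]] : exists w, word_maps Lam w x y.
    by case: h => [/= ->|//]; exists [::].
  have hex : exists n, `[< pre_orbit_dom n x /\ orbit_fun n x = y >].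
    exists (pickle w); apply/asboolP.
    by rewrite /pre_orbit_dom /orbit_fun /nth_word pickleK.
  case: (ex_minnP hex) => n /asboolP[nx ny] nmin.
  exists n => //; split => // -[j /= jn [[jx _] jy]].
  have := nmin j; rewrite leqNgt jn => /(_ _)/negP; apply => //.
  by apply/asboolP; split => //; rewrite jy.
Qed.

(** The index set of a sum over an orbit moves with x; the bijection turns it into a series over all
    n of measurable functions of x. *)
Lemma measurable_orbit_esum (u : X * X -> \bar R) :
  measurable_fun (generated_rel Lam) u ->
  (forall p, generated_rel Lam p -> (0 <= u p)%E) ->
  measurable (generated_rel Lam) ->
  measurable_fun setT (fun x =>
    (\esum_(z in orbit_of (generated_rel Lam) x) u (x, z))%E).
Proof.
move=> mu0 u0 mrel.
rewrite (_ : (fun x => _) = fun x => (\sum_(n <oo)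
   ((fun y => u (y, orbit_fun n y)) \_ (orbit_dom n)) x)%E); last first.
  apply/funext => x; rewrite (reindex_esum _ _ _ (fun z => u (x, z)) (orbit_bij x))/=.
  rewrite nneseries_esumT; last first.
    move=> n; rewrite patchE; case: ifPn => // /set_mem nx.
    by apply: u0; case: (orbit_bij x) => /(_ n nx).
  rewrite [LHS]esum_mkcond; apply: eq_esum => n _.
  by rewrite patchE /=; congr (if _ then _ else _); rewrite !inE.
apply: ge0_emeasurable_sum => //.
  move=> n x _ _; rewrite patchE; case: ifPn => // /set_mem nx.
  by apply: u0; case: (orbit_bij x) => /(_ n nx).
move=> n _; apply/(measurable_restrictT _ _).1 => //.
  exact: orbit_dom_measurable.
apply: (@measurable_comp _ _ _ _ _ _ (generated_rel Lam)) => //.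
  move=> _ [x nx <-].
  by case: (orbit_bij x) => /(_ n nx).
apply: measurable_fun_pair_in; first exact: measurable_id.
exact: orbit_fun_measurable.
Qed.

End words.

(** * Scaling and signed sums over orbits *)

Section esum_scale.
Local Open Scope ereal_scope.

(** One inequality, applied to a and then to its inverse, gives both; a = 0 is separate. *)
Lemma esumZl (R : realType) (T : choiceType) (D : set T) (a : R) (u : T -> \bar R) :
  (0 <= a)%R -> (forall z, 0 <= u z) ->
  \esum_(z in D) (a%:E * u z) = a%:E * \esum_(z in D) u z.
Proof.
have le (b : R) (v : T -> \bar R) : (0 <= b)%R -> (forall z, 0 <= v z) ->
    \esum_(z in D) (b%:E * v z) <= b%:E * \esum_(z in D) v z.
  move=> b0 v0; apply: ge_ereal_sup => _ [F [finF FD] <-].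
  rewrite -ge0_mule_fsumr//; apply: lee_pmul => //.
    exact: fsume_ge0.
  by apply: ereal_sup_ubound; exists F.
rewrite le_eqVlt => /predU1P[<-|a0] u0.
  by rewrite mul0e; apply: esum1 => z _; rewrite mul0e.
apply/eqP; rewrite eq_le le ?(ltW a0)//=.
have ai z : a^-1%:E * (a%:E * z) = z.
  by rewrite muleA -EFinM mulVf ?gt_eqF// mul1e.
have := le a^-1%R (fun z => a%:E * u z).
rewrite invr_ge0 ltW// => /(_ isT).
under [X in (_ -> is_true (X <= _)%E) -> _]eq_esum do rewrite ai.
move=> h; rewrite -(@lee_pmul2l _ (a^-1)%:E) ?lte_fin ?invr_gt0//.
by rewrite ai; apply: h => z; rewrite mule_ge0// lee_fin ltW.
Qed.

End esum_scale.

Section rsum_theory.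
Context (R : realType) (X : choiceType).
Implicit Types (D : set X) (u v : X -> R).

Definition abs_summable D u := (\esum_(z in D) `|u z|%:E < +oo)%E.

Lemma abs_summableD D u v : abs_summable D u -> abs_summable D v ->
  abs_summable D (fun z => u z + v z).
Proof.
move=> Du Dv; apply: le_lt_trans (lte_add_pinfty Du Dv).
rewrite -esumD; [|by move=> *; rewrite lee_fin..].
by apply: le_esum => z _; rewrite -EFinD lee_fin ler_normD.
Qed.

Lemma abs_summableZ D (a : R) u :
  abs_summable D u -> abs_summable D (fun z => a * u z).
Proof.
rewrite /abs_summable => Du.
under eq_esum do rewrite normrM EFinM.
rewrite esumZl// lte_mul_pinfty// ge0_fin_numE//.
Qed.

End rsum_theory.

Section rsum.
Context (R : realType) d (X : measurableType d).
Implicit Types (D : set X) (u v : X -> R).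

Let fin_esum D u v : (forall z, 0 <= v z) -> (forall z, v z <= `|u z|) ->
  abs_summable D u -> \esum_(z in D) (v z)%:E \is a fin_num.
Proof.
move=> v0 vu Du; rewrite ge0_fin_numE; last first.
  by apply: esum_ge0 => z _; rewrite lee_fin.
by apply: le_lt_trans Du; apply: le_esum => z _; rewrite lee_fin.
Qed.

Let max0_le_norm (a : R) : Num.max a 0 <= `|a|.
Proof. by rewrite ge_max normr_ge0 ler_norm. Qed.

Let maxN0_le_norm (a : R) : Num.max (- a) 0 <= `|a|.
Proof. by rewrite -normrN. Qed.

Let max0_ge0 (a : R) : 0 <= Num.max a 0. Proof. by rewrite le_max lexx orbT. Qed.

Let fin_pos D u : abs_summable D u ->
  \esum_(z in D) (Num.max (u z) 0)%:E \is a fin_num.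
Proof. exact: fin_esum. Qed.

Let fin_neg D u : abs_summable D u ->
  \esum_(z in D) (Num.max (- u z) 0)%:E \is a fin_num.
Proof. exact: fin_esum. Qed.

Lemma eq_rsum D u v : (forall z, D z -> u z = v z) -> rsum D u = rsum D v.
Proof.
by move=> uv; congr (fine _ - fine _); apply: eq_esum => z Dz; rewrite uv.
Qed.

Lemma rsumN D u : rsum D (fun z => - u z) = - rsum D u.
Proof.
rewrite /rsum opprB; congr (_ - fine _).
by apply: eq_esum => z _; rewrite opprK.
Qed.

Lemma rsumD D u v : abs_summable D u -> abs_summable D v ->
  rsum D (fun z => u z + v z) = rsum D u + rsum D v.
Proof.
move=> Du Dv; have Duv := abs_summableD Du Dv; rewrite /rsum.
(* Additivity of positive and negative parts written without subtraction, so that it holds in the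
   extended reals before finiteness enters. *)
have key : (\esum_(z in D) (Num.max (u z + v z) 0)%:E +
    (\esum_(z in D) (Num.max (- u z) 0)%:E +
     \esum_(z in D) (Num.max (- v z) 0)%:E) =
    \esum_(z in D) (Num.max (- (u z + v z)) 0)%:E +
    (\esum_(z in D) (Num.max (u z) 0)%:E +
     \esum_(z in D) (Num.max (v z) 0)%:E))%E.
  rewrite -!esumD; try by move=> *; rewrite ?adde_ge0// lee_fin.
  apply: eq_esum => z _; rewrite -!EFinD; congr EFin.
  rewrite /Num.max; do !case: ifPn; rewrite -?leNgt; lra.
have := congr1 fine key.
rewrite !fineD ?fin_numD ?(fin_pos Du) ?(fin_pos Dv) ?(fin_neg Du)
  ?(fin_neg Dv) ?(fin_pos Duv) ?(fin_neg Duv)//.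
by move=> k; lra.
Qed.

(** [fine] sends an infinite sum to 0, before as well as after scaling, so the identity holds for
    every family. *)
Lemma rsumZ D (a : R) u : rsum D (fun z => a * u z) = a * rsum D u.
Proof.
wlog a0 : a / 0 <= a => [hw|].
  have [|/ltW a0] := leP 0 a; first exact: hw.
  have := hw (- a); rewrite oppr_ge0 => /(_ a0).
  under [in X in X -> _]eq_rsum do rewrite mulNr.
  by rewrite rsumN mulNr => /oppr_inj.
have h v : \esum_(z in D) (Num.max (a * v z) 0)%:E =
    (a%:E * \esum_(z in D) (Num.max (v z) 0)%:E)%E.
  rewrite -esumZl//; last by move=> z; rewrite lee_fin.
  by apply: eq_esum => z _; rewrite -EFinM maxr_pMr// mulr0.
rewrite /rsum h.
under [X in _ - fine X]eq_esum do rewrite -mulrN.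
rewrite h mulrBr.
have f (x : \bar R) : fine (a%:E * x)%E = a * fine x.
  have [xf|] := boolP (x \is a fin_num); first by rewrite fineM.
  case: x => [x|_|_] //; rewrite /= mulr0.
    rewrite mulry; case: sgrP => //; rewrite ?mul0e ?mul1e//.
    by rewrite ltNge a0.
  rewrite mulrNy; case: sgrP => //; rewrite ?mul0e ?mul1e//.
  by rewrite ltNge a0.
by rewrite !f.
Qed.

Lemma rsum_ge0E D u : (forall z, D z -> 0 <= u z) ->
  rsum D u = fine (\esum_(z in D) (u z)%:E).
Proof.
move=> u0; rewrite /rsum [X in fine X - _](_ : _ = \esum_(z in D) (u z)%:E).
  rewrite [X in _ - fine X]esum1 ?subr0//= => z Dz.
  by rewrite max_r// oppr_le0 u0.
by apply: eq_esum => z Dz; rewrite max_l// u0.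
Qed.

Lemma rsum_eq0 D u : (forall z, D z -> u z = 0) -> rsum D u = 0.
Proof.
move=> u0; rewrite rsum_ge0E; last by move=> z /u0 ->.
by rewrite esum1// => z /u0 ->.
Qed.

Lemma rsum_norm D u : (`|rsum D u|%:E <= \esum_(z in D) `|u z|%:E)%E.
Proof.
have fine_le (x : \bar R) : (0 <= x)%E -> (0 <= fine x)%R /\ ((fine x)%:E <= x)%E.
  by case: x => [x| |]//= _; rewrite lexx ?leey.
rewrite (_ : \esum_(z in D) `|u z|%:E = \esum_(z in D) (Num.max (u z) 0)%:E +
    \esum_(z in D) (Num.max (- u z) 0)%:E)%E; last first.
  rewrite -esumD; [|by move=> *; rewrite lee_fin..].
  apply: eq_esum => z _; rewrite -EFinD; congr EFin.
  by rewrite /Num.max; case: ger0P => ?; do !case: ifPn; rewrite -?leNgt; lra.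
have [|p0 ple] := fine_le (\esum_(z in D) (Num.max (u z) 0)%:E).
  by apply: esum_ge0 => z _; rewrite lee_fin.
have [|q0 qle] := fine_le (\esum_(z in D) (Num.max (- u z) 0)%:E).
  by apply: esum_ge0 => z _; rewrite lee_fin.
apply: le_trans (leeD ple qle); rewrite -EFinD lee_fin /rsum ler_norml.
by lra.
Qed.

End rsum.

(** * The real inner product of L2 *)

(** Isolates what integration on [rel] takes from the enumeration of the orbits, so that the
    analysis of L2 never mentions words. *)
Definition measurable_orbit_sums (R : realType) d (X : measurableType d)
    (rel : set (X * X)) :=
  forall u : X * X -> \bar R, measurable_fun rel u -> (forall p, (0 <= u p)%E) ->
  measurable_fun setT (fun x => \esum_(z in orbit_of rel x) u (x, z))%E.

Lemma normc_sqr (R : rcfType) (z : R[i]) :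
  Normc.normc z ^+ 2 = complex.Re z ^+ 2 + complex.Im z ^+ 2.
Proof. by case: z => a b /=; rewrite sqr_sqrtr// addr_ge0 ?sqr_ge0. Qed.

Section real_inner.
Context (R : realType) d (X : measurableType d) (mu : probability X R).
Context (rel : set (X * X)).
Local Notation C := R[i].
Local Notation vec := (X * X -> R[i]).
Local Notation memL2 := (memL2 mu rel).
Local Notation eqL2 := (eqL2 mu rel).
Implicit Types (Psi Phi : vec) (x : X) (p : X * X).

(** The inner product of C as a Euclidean plane: the real part of z times the conjugate of w. *)
Definition dotR (z w : C) : R := complex.Re z * complex.Re w + complex.Im z * complex.Im w.

Definition fiber_dot Psi Phi x : R :=
  rsum (orbit_of rel x) (fun z => dotR (Psi (x, z)) (Phi (x, z))).

Definition fiber_norm Psi x : \bar R :=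
  (\esum_(z in orbit_of rel x) (Normc.normc (Psi (x, z)) ^+ 2)%:E)%E.

Definition rinner Psi Phi : R := \int[mu]_x fiber_dot Psi Phi x.

Lemma Re_mulJ (z w : C) : complex.Re (z * w^*%C) = dotR z w.
Proof. by case: z w => a b [c e] /=; rewrite /dotR /=; ring. Qed.

Lemma Im_mulJ (z w : C) : complex.Im (z * w^*%C) = dotR z ('i%C * w).
Proof. by case: z w => a b [c e] /=; rewrite /dotR /=; ring. Qed.

(** Lets every estimate be made with real numbers: inserting i into the real form recovers the
    imaginary part. *)
Lemma innerE Psi Phi :
  inner mu rel Psi Phi = Complex (rinner Psi Phi) (rinner Psi (fun p => 'i%C * Phi p)).
Proof.
rewrite /inner /cintegral /csum /=; congr Complex; apply: eq_Rintegral => x _;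
  apply: eq_rsum => z _; by rewrite (Re_mulJ, Im_mulJ).
Qed.

Lemma dotRC (z w : C) : dotR z w = dotR w z.
Proof. by rewrite /dotR mulrC [X in _ + X]mulrC. Qed.

Lemma dotR_diag (z : C) : dotR z z = Normc.normc z ^+ 2.
Proof. by rewrite normc_sqr. Qed.

Lemma dotR_le (z w : C) : `|dotR z w| <= Normc.normc z ^+ 2 + Normc.normc w ^+ 2.
Proof.
rewrite !normc_sqr /dotR; case: z w => a b [c e] /=.
have h (s t : R) : `|s * t| <= s ^+ 2 + t ^+ 2.
  rewrite ler_norml; apply/andP; split.
    have := sqr_ge0 (s + t); have := sqr_ge0 s; have := sqr_ge0 t; nra.
  have := sqr_ge0 (s - t); have := sqr_ge0 s; have := sqr_ge0 t; nra.
by apply: le_trans (ler_normD _ _) _; have := h a c; have := h b e; lra.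
Qed.

Definition measurable_rep Psi :=
  measurable_fun rel (fun p => complex.Re (Psi p)) /\
  measurable_fun rel (fun p => complex.Im (Psi p)).

Lemma memL2_rep Psi : memL2 Psi -> measurable_rep Psi.
Proof. by case. Qed.

Lemma measurable_dotR Psi Phi : measurable_rep Psi -> measurable_rep Phi ->
  measurable_fun rel (fun p => dotR (Psi p) (Phi p)).
Proof.
by move=> [P1 P2] [Q1 Q2]; apply: measurable_funD; apply: measurable_funM.
Qed.

Lemma fiber_norm_ge0 Psi x : (0 <= fiber_norm Psi x)%E.
Proof. by apply: esum_ge0 => z _; rewrite lee_fin sqr_ge0. Qed.

Hypothesis relsum : measurable_orbit_sums R rel.

Lemma measurable_fiber_norm Psi : measurable_rep Psi ->
  measurable_fun setT (fiber_norm Psi).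
Proof.
move=> mPsi; pose u p := (Normc.normc (Psi p) ^+ 2)%:E.
apply: (relsum (u := u)); last by move=> p; rewrite lee_fin sqr_ge0.
apply/measurable_EFinP; under eq_fun do rewrite -dotR_diag.
exact: measurable_dotR.
Qed.

Lemma measurable_fiber_dot Psi Phi : measurable_rep Psi -> measurable_rep Phi ->
  measurable_fun setT (fiber_dot Psi Phi).
Proof.
move=> mPsi mPhi; have m := measurable_dotR mPsi mPhi.
have h (v : X * X -> R) : measurable_fun rel v -> measurable_fun setT (fun x =>
    fine (\esum_(z in orbit_of rel x) (Num.max (v (x, z)) 0)%:E)%E).
  move=> mv; apply: measurableT_comp => //.
  apply: (relsum (u := fun p => (Num.max (v p) 0)%:E)); last first.
    by move=> p; rewrite lee_fin le_max lexx orbT.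
  by apply/measurable_EFinP/measurable_maxr.
apply: measurable_funB; first exact: (h (fun p => dotR (Psi p) (Phi p))).
apply: (h (fun p => - dotR (Psi p) (Phi p))).
exact: measurableT_comp.
Qed.

Lemma esum_dot_le Psi Phi x :
  (\esum_(z in orbit_of rel x) `|dotR (Psi (x, z)) (Phi (x, z))|%:E <=
   fiber_norm Psi x + fiber_norm Phi x)%E.
Proof.
rewrite /fiber_norm -esumD; [|by move=> *; rewrite lee_fin sqr_ge0..].
by apply: le_esum => z _; rewrite -EFinD lee_fin dotR_le.
Qed.

Lemma fiber_dot_le Psi Phi x :
  (`|fiber_dot Psi Phi x|%:E <= fiber_norm Psi x + fiber_norm Phi x)%E.
Proof. exact: le_trans (rsum_norm _ _) (esum_dot_le _ _ _). Qed.

Lemma fiber_norm_fin Psi : memL2 Psi ->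
  \forall x \ae mu, (fiber_norm Psi x < +oo)%E.
Proof.
move=> PsiL; have [_ _ fin] := PsiL.
have : mu.-integrable setT (fiber_norm Psi).
  apply/integrableP; split; first exact: measurable_fiber_norm (memL2_rep PsiL).
  under eq_integral do rewrite gee0_abs ?fiber_norm_ge0//.
  exact: fin.
move=> /(integrable_ae measurableT); apply: filterS => x /(_ I).
by rewrite ge0_fin_numE ?fiber_norm_ge0.
Qed.

Lemma integrable_fiber_dot Psi Phi : memL2 Psi -> memL2 Phi ->
  mu.-integrable setT (EFin \o fiber_dot Psi Phi).
Proof.
move=> PsiL PhiL.
have mP := memL2_rep PsiL; have mQ := memL2_rep PhiL.
have mfP := measurable_fiber_norm mP; have mfQ := measurable_fiber_norm mQ.
apply/integrableP; split.
  by apply/measurable_EFinP; exact: measurable_fiber_dot.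
have [_ _ fP] := PsiL; have [_ _ fQ] := PhiL.
apply: le_lt_trans (lte_add_pinfty fP fQ).
rewrite /normL2_sqr -ge0_integralD//; try by move=> x _; exact: fiber_norm_ge0.
apply: ge0_le_integral => //.
- apply/measurable_EFinP/measurableT_comp => //.
  exact: measurable_fiber_dot.
- exact: emeasurable_funD.
- by move=> x _; exact: fiber_dot_le.
Qed.

Lemma rinnerC Psi Phi : rinner Psi Phi = rinner Phi Psi.
Proof.
by apply: eq_Rintegral => x _; apply: eq_rsum => z _; rewrite dotRC.
Qed.

Lemma fiber_dot_diag Psi x : fiber_dot Psi Psi x = fine (fiber_norm Psi x).
Proof.
rewrite /fiber_dot rsum_ge0E; last by move=> z _; rewrite dotR_diag sqr_ge0.
by congr fine; apply: eq_esum => z _; rewrite dotR_diag.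
Qed.

(** Fibres of infinite norm form a null set, on which [fine] replaces the integrand by 0; the
    integrals agree although the integrands may not. *)
Lemma rinner_diag Psi : memL2 Psi ->
  (rinner Psi Psi)%:E = normL2_sqr mu rel Psi.
Proof.
move=> PsiL; have mP := memL2_rep PsiL; have [_ _ fP] := PsiL.
have e : (\int[mu]_x (fiber_dot Psi Psi x)%:E = normL2_sqr mu rel Psi)%E.
  apply: ge0_ae_eq_integral => //.
  - by apply/measurable_EFinP; exact: measurable_fiber_dot.
  - exact: measurable_fiber_norm.
  - by move=> x _; rewrite lee_fin fiber_dot_diag fine_ge0 ?fiber_norm_ge0.
  - by move=> x _; exact: fiber_norm_ge0.
  apply: filterS (fiber_norm_fin PsiL) => x xfin _ /=.
  by rewrite fiber_dot_diag fineK// ge0_fin_numE ?fiber_norm_ge0.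
rewrite /rinner /Rintegral e fineK// ge0_fin_numE//.
by apply: integral_ge0 => x _; exact: fiber_norm_ge0.
Qed.

Lemma rinner_ge0 Psi : memL2 Psi -> 0 <= rinner Psi Psi.
Proof.
move=> PsiL; rewrite -lee_fin rinner_diag//.
by apply: integral_ge0 => x _; exact: fiber_norm_ge0.
Qed.

Lemma normL2_rinner Psi : memL2 Psi -> normL2 mu rel Psi = Num.sqrt (rinner Psi Psi).
Proof. by move=> PsiL; rewrite /normL2 -rinner_diag. Qed.

Lemma ae_eq_rinner Psi Phi Psi' Phi' : memL2 Psi -> memL2 Phi ->
  memL2 Psi' -> memL2 Phi' ->
  (\forall x \ae mu, fiber_dot Psi Phi x = fiber_dot Psi' Phi' x) ->
  rinner Psi Phi = rinner Psi' Phi'.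
Proof.
move=> PsiL PhiL PsiL' PhiL' h; congr fine.
apply: ae_eq_integral => //.
- by apply/measurable_EFinP; apply: measurable_fiber_dot; exact: memL2_rep.
- by apply/measurable_EFinP; apply: measurable_fiber_dot; exact: memL2_rep.
by apply: filterS h => x -> _.
Qed.

Lemma eqL2_rinner Psi Psi' Phi : memL2 Psi -> memL2 Psi' -> memL2 Phi ->
  eqL2 Psi Psi' -> rinner Psi Phi = rinner Psi' Phi.
Proof.
move=> PsiL PsiL' PhiL h; apply: ae_eq_rinner => //.
by apply: filterS h => x h; apply: eq_rsum => z xz; rewrite h.
Qed.

Lemma memL2_lin (a : C) Psi Phi : memL2 Psi -> memL2 Phi ->
  memL2 (fun p => a * Psi p + Phi p).
Proof.
move=> PsiL PhiL.
have [P1 P2] := memL2_rep PsiL; have [Q1 Q2] := memL2_rep PhiL.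
have mr : measurable_rep (fun p => a * Psi p + Phi p).
  split.
    rewrite (_ : (fun p => _) = fun p => complex.Re a * complex.Re (Psi p) -
       complex.Im a * complex.Im (Psi p) + complex.Re (Phi p)).
      by apply: measurable_funD => //; apply: measurable_funB; apply: measurable_funM.
    by apply/funext => p; case: a (Psi p) (Phi p) => ? ? [? ?] [? ?].
  rewrite (_ : (fun p => _) = fun p => complex.Re a * complex.Im (Psi p) +
       complex.Im a * complex.Re (Psi p) + complex.Im (Phi p)).
    by apply: measurable_funD => //; apply: measurable_funD; apply: measurable_funM.
  by apply/funext => p; case: a (Psi p) (Phi p) => ? ? [? ?] [? ?].
split; [exact: mr.1|exact: mr.2|].
have [_ _ fP] := PsiL; have [_ _ fQ] := PhiL.
(* From |a z + w|^2 <= 2 |a|^2 |z|^2 + 2 |w|^2. *)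
pose k : R := 2 * Normc.normc a ^+ 2.
have k0 : 0 <= k by rewrite mulr_ge0 ?sqr_ge0.
apply: (@le_lt_trans _ _ (\int[mu]_x (k%:E * fiber_norm Psi x + 2%:E * fiber_norm Phi x))%E).
  apply: ge0_le_integral => //.
  - by move=> x _; exact: (fiber_norm_ge0 (fun p => a * Psi p + Phi p)).
  - exact: (measurable_fiber_norm mr).
  - by apply: emeasurable_funD; apply: measurable_funeM;
      apply: measurable_fiber_norm; exact: memL2_rep.
  move=> x _; rewrite -!esumZl//; try by move=> *; rewrite lee_fin sqr_ge0.
  rewrite -esumD; try by move=> *; rewrite mule_ge0// lee_fin ?sqr_ge0.
  apply: le_esum => z _; rewrite -!EFinM -EFinD lee_fin /k !normc_sqr.
  case: a {mr k k0} (Psi _) (Phi _) => [a b] [s t] [u v] /=.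
  have := sqr_ge0 (a * s - b * t - u); have := sqr_ge0 (a * t + b * s - v); nra.
rewrite ge0_integralD//; try by move=> *; rewrite mule_ge0 ?fiber_norm_ge0// lee_fin.
- rewrite !ge0_integralZl//; try by move=> *; rewrite ?fiber_norm_ge0// lee_fin.
  + by apply: lte_add_pinfty; rewrite lte_mul_pinfty// lee_fin.
  + by apply: measurable_fiber_norm; exact: memL2_rep.
  + by apply: measurable_fiber_norm; exact: memL2_rep.
- by apply: measurable_funeM; apply: measurable_fiber_norm; exact: memL2_rep.
- by apply: measurable_funeM; apply: measurable_fiber_norm; exact: memL2_rep.
Qed.

(** [rsum] is additive on absolutely summable families, and for square-integrable vectors almost
    every fibre is one. *)
Lemma rinner_lin (a : R) Psi Phi Theta :
  memL2 Psi -> memL2 Phi -> memL2 Theta ->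
  rinner (fun p => a%:C%C * Psi p + Phi p) Theta =
  a * rinner Psi Theta + rinner Phi Theta.
Proof.
move=> PsiL PhiL ThetaL.
have i1 := integrable_fiber_dot PsiL ThetaL.
have i2 := integrable_fiber_dot PhiL ThetaL.
have i3 : mu.-integrable setT (EFin \o (fun x => a * fiber_dot Psi Theta x)).
  exact: (integrableZl measurableT a i1).
rewrite /rinner -RintegralZl// -RintegralD//.
congr fine; apply: ae_eq_integral => //.
- apply/measurable_EFinP; apply: measurable_fiber_dot; apply: memL2_rep => //.
  exact: memL2_lin.
- apply/measurable_EFinP; apply: measurable_funD.
    by apply: measurable_funM => //; apply: measurable_fiber_dot; exact: memL2_rep.
  by apply: measurable_fiber_dot; exact: memL2_rep.
apply: filterS3 (fiber_norm_fin PsiL) (fiber_norm_fin PhiL) (fiber_norm_fin ThetaL).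
move=> x f1 f2 f3 _ /=.
congr EFin; rewrite /fiber_dot -rsumZ -rsumD.
- by apply: eq_rsum => z _; case: (Psi _) (Phi _) (Theta _) => ? ? [? ?] [? ?] /=;
    rewrite /dotR /=; ring.
- apply: abs_summableZ.
  by apply: le_lt_trans (esum_dot_le _ _ _) _; exact: lte_add_pinfty.
- by apply: le_lt_trans (esum_dot_le _ _ _) _; exact: lte_add_pinfty.
Qed.

End real_inner.

(** * Integrals against set functions and changes of variables *)

Section eq_setfun_integral.
Context (R : realType) d (T : measurableType d).
Local Open Scope ereal_scope.
Import HBNNSimple.

(** Applied to [scalar_measure] and [abs_distribution], which are bare set functions with
    uncontrolled values off the measurable sets. The integral is a supremum over simple functions
    and consults its set function on their level sets; those of nonzero value lie in D. *)
Lemma eq_setfun_integral (m1 m2 : set T -> \bar R) (D : set T) (u : T -> \bar R) :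
  (forall A, measurable A -> A `<=` D -> m1 A = m2 A) ->
  \int[m1]_(x in D) u x = \int[m2]_(x in D) u x.
Proof.
move=> m12; have key (v : T -> \bar R) : (forall x, ~ D x -> v x = 0) ->
    ereal_sup [set sintegral m1 h | h in
      [set h : {nnsfun T >-> R} | forall x, (h x)%:E <= v x]] =
    ereal_sup [set sintegral m2 h | h in
      [set h : {nnsfun T >-> R} | forall x, (h x)%:E <= v x]].
  move=> v0; congr ereal_sup; apply/seteqP.
  have sE (h : {nnsfun T >-> R}) : (forall x, (h x)%:E <= v x) ->
      sintegral m1 h = sintegral m2 h.
    move=> hv; apply: eq_fsbigr => r _.
    have [->|r0] := eqVneq r 0%R; first by rewrite !mul0e.
    congr (_ * _); apply: m12 => // x /= hxr; apply: contrapT => Dx.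
    have := hv x; rewrite v0// lee_fin => hx0.
    by move/eqP: r0; apply; rewrite -hxr; apply/eqP; rewrite eq_le hx0 fun_ge0.
  by split => _ [h hv <-]; exists h => //; rewrite sE.
rewrite /integral; congr (_ - _); apply: key => x Dx;
  by rewrite (funeposE, funenegE) patchE memNset// ?oppe0 maxxx.
Qed.

End eq_setfun_integral.

Section change_of_variables.
Context (R : realType) d (X : measurableType d) (mu : probability X R).
Local Open Scope ereal_scope.

Lemma preimage_ppartinv_preserves (g : partial_iso mu) (C : set X) : measurable C ->
  C `<=` pdom g -> mu (pcod g `&` ppartinv g @^-1` C) = mu C.
Proof.
move=> mC CA; rewrite -(pfun_preserves (p := g) mC CA); congr (mu _).
apply/seteqP; split => [x [Bx Cx]|_ [y Cy <-]] /=.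
  by exists (ppartinv g x) => //; rewrite ppartinvK.
have Ay := CA _ Cy; split; first exact: pfun_cod.
by rewrite /= pfunK.
Qed.

Lemma measurable_fun_mem (D : set X) : measurable D ->
  measurable_fun setT (fun x => x \in D).
Proof.
move=> mD; apply: (measurable_fun_bool true); rewrite setTI.
by rewrite (_ : _ @^-1` _ = D)//; apply/seteqP; split => x /=; [move=> /set_mem|move=> /mem_set].
Qed.

Lemma ge0_integral_ppartinv (g : partial_iso mu) (u : X -> \bar R) :
  measurable_fun setT u -> (forall x, 0 <= u x) ->
  \int[mu]_(x in pcod g) u (ppartinv g x) = \int[mu]_(x in pdom g) u x.
Proof.
move=> mu_ u0.
have mA := pdom_measurable g; have mB := pcod_measurable g.
(* Tagging with membership in the codomain keeps points outside it away from
   the domain. *)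
pose k x := (if x \in pcod g then ppartinv g x else x, x \in pcod g).
pose j (x : X) := (x, true).
have mb := measurable_fun_mem mB.
have mk : measurable_fun setT k.
  apply: measurable_fun_pair => //; apply: measurable_fun_if => //.
    apply: measurable_funS (ppartinv_measurable (p := g)) => //.
    by move=> x [_ /set_mem].
have mj : measurable_fun setT j by apply: measurable_fun_pair.
have mD : measurable (pdom g `*` [set true]) by exact: measurableX.
have mf1 : measurable_fun (pdom g `*` [set true]) (u \o fst).
  by apply: measurable_funS (measurableT_comp mu_ measurable_fst).
rewrite [RHS](_ : _ = \int[pushforward mu j]_(p in pdom g `*` [set true]) (u \o fst) p).
  rewrite -(eq_setfun_integral (m1 := pushforward mu k)).
    rewrite ge0_integral_pushforward//; last by move=> *; exact: u0.
    rewrite (_ : k @^-1` _ = pcod g).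
      by apply: eq_integral => x xB; rewrite /k /= xB.
    apply/seteqP; split => x; rewrite /k /=.
      by move=> [_] /set_mem.
    by move=> xB; rewrite mem_set//; split => //; exact: ppartinv_dom.
  move=> C mC CD; rewrite /pushforward.
  have mC' : measurable (j @^-1` C) by rewrite -[X in measurable X]setTI; exact: mj.
  rewrite -(preimage_ppartinv_preserves (g := g) (C := j @^-1` C))//; last first.
    by move=> x Cx; exact: (CD _ Cx).1.
  congr (mu _); apply/seteqP; split => x; rewrite /k /j /=.
    move=> Cx; have /set_mem xB := (CD _ Cx).2.
    by move: Cx; rewrite mem_set.
  by move=> [xB]; rewrite mem_set.
rewrite ge0_integral_pushforward//; last by move=> *; exact: u0.
congr integral; rewrite //=.
by apply/seteqP; split => x //= [].
Qed.

(** Positive and negative parts are transported separately, so that the value -oo is allowed, as the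
    logarithms of the theorem require. *)
Lemma integral_ppartinv (g : partial_iso mu) (u : X -> \bar R) :
  measurable_fun setT u ->
  \int[mu]_(x in pcod g) u (ppartinv g x) = \int[mu]_(x in pdom g) u x.
Proof.
move=> mu_; rewrite integralE [RHS]integralE; congr (_ - _).
  rewrite -ge0_integral_ppartinv//; last exact: measurable_funepos.
  by apply: eq_integral => x _; rewrite !funeposE.
rewrite -ge0_integral_ppartinv//; last exact: measurable_funeneg.
by apply: eq_integral => x _; rewrite !funenegE.
Qed.

End change_of_variables.

(** * Multiplication operators, translations by partial isomorphisms and the trace vector *)

Section L2_operators.
Context (R : realType) d (X : measurableType d) (mu : probability X R).
Context (rel : set (X * X)).
Hypothesis relsum : measurable_orbit_sums R rel.
Hypothesis mrel : measurable rel.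
Local Notation C := R[i].
Local Notation vec := (X * X -> R[i]).
Local Notation memL2 := (memL2 mu rel).
Local Notation eqL2 := (eqL2 mu rel).
Local Notation rinner := (rinner mu rel).
Local Notation fiber_norm := (fiber_norm rel).
Local Notation fiber_dot := (fiber_dot rel).
Implicit Types (Psi Phi : vec) (f : X -> C) (x : X) (p : X * X).

Lemma rinner_eq0 Psi : memL2 Psi -> rinner Psi Psi = 0 -> eqL2 Psi (fun=> 0).
Proof.
move=> PsiL Psi0; have := rinner_diag relsum PsiL; rewrite Psi0 => h.
have mP := measurable_fiber_norm relsum (memL2_rep PsiL).
have /(ae_eq_integral_abs mu measurableT mP) :
    (\int[mu]_x `|fiber_norm Psi x| = 0)%E.
  by under eq_integral do rewrite gee0_abs ?fiber_norm_ge0//.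
apply: filterS => x /(_ I)/= Psix0 z xz.
apply: Normc.eq0_normc; apply/eqP; rewrite -sqrf_eq0 eq_le sqr_ge0 andbT.
rewrite -lee_fin -[leRHS]Psix0; apply: esum_ge; exists [set z].
  by split => // _ ->.
by rewrite fsbig_set1.
Qed.

(** Pairing with the difference of the two vectors shows that its norm is 0; real pairings are
    enough for that. *)
Lemma eqL2_weak Psi Phi : memL2 Psi -> memL2 Phi ->
  (forall Theta, memL2 Theta -> rinner Psi Theta = rinner Phi Theta) ->
  eqL2 Psi Phi.
Proof.
move=> PsiL PhiL e; pose T p := ((-1)%:C)%C * Phi p + Psi p.
have TL : memL2 T by exact: memL2_lin.
have : rinner T T = 0 by rewrite {1}/T rinner_lin// e//; ring.
move=> /(rinner_eq0 TL); apply: filterS => x h z /h.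
by rewrite /T rmorphN1 mulN1r addrC => /eqP; rewrite subr_eq0 => /eqP.
Qed.

Definition measurable_cfun f :=
  measurable_fun setT (fun x => complex.Re (f x)) /\
  measurable_fun setT (fun x => complex.Im (f x)).

Lemma measurable_rep_Mop f Psi : measurable_cfun f -> measurable_rep rel Psi ->
  measurable_rep rel (Mop f Psi).
Proof.
move=> [f1 f2] [P1 P2].
have c (u : X -> R) : measurable_fun setT u -> measurable_fun rel (fun p => u p.1).
  by move=> mu_; apply: measurable_funTS; exact: measurableT_comp.
have c1 := c _ f1; have c2 := c _ f2; split.
  rewrite (_ : (fun p => _) = fun p => complex.Re (f p.1) * complex.Re (Psi p) -
     complex.Im (f p.1) * complex.Im (Psi p)).
    by apply: measurable_funB; apply: measurable_funM.
  by apply/funext => p; rewrite /Mop; case: (f _) (Psi p) => ? ? [? ?].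
rewrite (_ : (fun p => _) = fun p => complex.Re (f p.1) * complex.Im (Psi p) +
   complex.Im (f p.1) * complex.Re (Psi p)).
  by apply: measurable_funD; apply: measurable_funM.
by apply/funext => p; rewrite /Mop; case: (f _) (Psi p) => ? ? [? ?].
Qed.

Lemma fiber_norm_Mop f Psi x :
  fiber_norm (Mop f Psi) x = ((Normc.normc (f x) ^+ 2)%:E * fiber_norm Psi x)%E.
Proof.
rewrite -esumZl ?sqr_ge0//; last by move=> z; rewrite lee_fin sqr_ge0.
by apply: eq_esum => z _; rewrite /Mop Normc.normcM exprMn EFinM.
Qed.

Lemma normL2_sqr_Mop f Psi M : measurable_cfun f -> 0 <= M ->
  (\forall x \ae mu, Normc.normc (f x) <= M) -> memL2 Psi ->
  (normL2_sqr mu rel (Mop f Psi) <= (M ^+ 2)%:E * normL2_sqr mu rel Psi)%E.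
Proof.
move=> mf M0 fM PsiL; have mP := memL2_rep PsiL.
rewrite -ge0_integralZl//; last 3 first.
- exact: (measurable_fiber_norm relsum mP).
- by move=> x _; exact: (fiber_norm_ge0 rel Psi).
- by rewrite lee_fin sqr_ge0.
apply: ae_ge0_le_integral => //.
- by move=> x _; exact: (fiber_norm_ge0 rel (Mop f Psi)).
- by apply: (measurable_fiber_norm relsum); exact: measurable_rep_Mop.
- by move=> x _; rewrite mule_ge0 ?lee_fin ?sqr_ge0//; exact: (fiber_norm_ge0 rel Psi).
- by apply: measurable_funeM; exact: (measurable_fiber_norm relsum mP).
apply: filterS fM => x fxM _; rewrite -/(fiber_norm (Mop f Psi) x) fiber_norm_Mop.
rewrite lee_wpmul2r ?fiber_norm_ge0// lee_fin ler_pXn2r ?nnegrE//.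
by case: (f x) => a b; exact: sqrtr_ge0.
Qed.

Lemma memL2_Mop f Psi : Linfty mu f -> memL2 Psi -> memL2 (Mop f Psi).
Proof.
move=> [f1 f2 [M fM]] PsiL; have [_ _ fP] := PsiL.
have [m1 m2] : measurable_rep rel (Mop f Psi).
  exact: measurable_rep_Mop (conj f1 f2) (memL2_rep PsiL).
split => //.
apply: (@le_lt_trans _ _ ((`|M| ^+ 2)%:E * normL2_sqr mu rel Psi)%E).
  apply: normL2_sqr_Mop => //.
  by apply: filterS fM => x /le_trans; apply; exact: ler_norm.
by rewrite lte_mul_pinfty// lee_fin sqr_ge0.
Qed.

Lemma rinner_Mop_le f Psi M : Linfty mu f -> 0 <= M ->
  (\forall x \ae mu, Normc.normc (f x) <= M) -> memL2 Psi ->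
  rinner (Mop f Psi) (Mop f Psi) <= M ^+ 2 * rinner Psi Psi.
Proof.
move=> fL M0 fM PsiL; have [f1 f2 _] := fL.
rewrite -lee_fin EFinM !rinner_diag//; last exact: memL2_Mop.
exact: normL2_sqr_Mop.
Qed.

Lemma rinner_Mop f Psi Phi :
  rinner (Mop f Psi) Phi = rinner Psi (Mop (fun x => (f x)^*%C) Phi).
Proof.
apply: eq_Rintegral => x _; apply: eq_rsum => z _; rewrite /Mop /dotR /=.
by case: (f x) (Psi _) (Phi _) => ? ? [? ?] [? ?] /=; ring.
Qed.

Lemma Linfty_conj f : Linfty mu f -> Linfty mu (fun x => (f x)^*%C).
Proof.
move=> [f1 f2 [M fM]]; split.
- by rewrite (_ : (fun x => _) = fun x => complex.Re (f x))//; apply/funext => x; case: (f x).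
- rewrite (_ : (fun x => _) = fun x => - complex.Im (f x)).
    exact: measurableT_comp.
  by apply/funext => x; case: (f x).
exists M; apply: filterS fM => x; apply: le_trans.
by case: (f x) => a b /=; rewrite sqrrN.
Qed.

Lemma Linfty_real (u : X -> R) M : measurable_fun setT u ->
  (forall x, `|u x| <= M) -> Linfty mu (fun x => (u x)%:C%C).
Proof.
move=> mu_ uM; split => //=.
exists M; apply: nearW => x /=.
by rewrite expr0n addr0 sqrtr_sqr.
Qed.

Definition ivec Psi : vec := fun p => 'i%C * Psi p.

Lemma rinner_ivec2 Psi Phi : rinner (ivec Psi) (ivec Phi) = rinner Psi Phi.
Proof.
apply: eq_Rintegral => x _; apply: eq_rsum => z _; rewrite /ivec /dotR /=.
by case: (Psi _) (Phi _) => ? ? [? ?] /=; ring.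
Qed.

Lemma inner_rinnerE Psi Phi : inner mu rel Psi Phi = Complex (rinner Psi Phi) (rinner Psi (ivec Phi)).
Proof. exact: innerE. Qed.

Lemma rinner0l Phi : rinner (fun=> 0) Phi = 0.
Proof.
rewrite /rinner /Rintegral integral0_eq// => z _; congr EFin.
by apply: rsum_eq0 => t _; rewrite /dotR /=; ring.
Qed.

Lemma memL2_0 : memL2 (fun=> 0).
Proof.
split; [exact: measurable_cst|exact: measurable_cst|].
rewrite /normL2_sqr integral0_eq// => x _.
by apply: esum1 => z _; rewrite Normc.normc0 expr0n.
Qed.

Lemma rinnerE Psi Phi : rinner Psi Phi = \int[mu]_x fiber_dot Psi Phi x.
Proof. by []. Qed.

(** This is the imaginary part of <u Psi, Psi> for a real multiplier u. *)
Lemma rinner_real_ivec (u : X -> R) Psi :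
  rinner (Mop (fun x => (u x)%:C%C) Psi) (ivec Psi) = 0.
Proof.
rewrite /rinner /Rintegral integral0_eq// => z _; congr EFin.
apply: rsum_eq0 => t _; rewrite /ivec /Mop /dotR.
by case: (Psi _) => ? ? /=; ring.
Qed.

Lemma normL2_sqr_fin Psi : memL2 Psi -> (\int[mu]_x fiber_norm Psi x < +oo)%E.
Proof. by case. Qed.

Hypothesis rel_refl : forall x, rel (x, x).
Hypothesis rel_sym : forall x y, rel (x, y) -> rel (y, x).
Hypothesis rel_trans : forall x y z, rel (x, y) -> rel (y, z) -> rel (x, z).

Lemma orbit_of_eq x y : rel (x, y) -> orbit_of rel x = orbit_of rel y.
Proof.
move=> xy; apply/seteqP; split => z; rewrite /orbit_of /=.
  exact/rel_trans/rel_sym.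
exact: rel_trans.
Qed.

Definition graph_in_rel (g : partial_iso mu) := forall x, pdom g x -> rel (x, pfun g x).

Lemma graph_in_rel_ppartinv g x : graph_in_rel g -> pcod g x -> rel (ppartinv g x, x).
Proof. by move=> gr Bx; have := gr _ (ppartinv_dom Bx); rewrite ppartinvK. Qed.

Lemma graph_in_rel_inv g : graph_in_rel g -> graph_in_rel (piso_inv g).
Proof. by move=> gr x Bx; apply: rel_sym; exact: graph_in_rel_ppartinv. Qed.

Lemma measurable_rep_Lop g Psi : graph_in_rel g -> measurable_rep rel Psi ->
  measurable_rep rel (Lop g Psi).
Proof.
move=> gr [P1 P2].
suff h (u : X * X -> R) : measurable_fun rel u ->
    measurable_fun rel (fun p => if p.1 \in pcod g then u (ppartinv g p.1, p.2) else 0).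
  split; [rewrite (_ : (fun p => _) = fun p => if p.1 \in pcod g then
      complex.Re (Psi (ppartinv g p.1, p.2)) else 0)|
    rewrite (_ : (fun p => _) = fun p => if p.1 \in pcod g then
      complex.Im (Psi (ppartinv g p.1, p.2)) else 0)].
  - exact: (h (fun p => complex.Re (Psi p))).
  - by apply/funext => p; rewrite /Lop; case: ifPn.
  - exact: (h (fun p => complex.Im (Psi p))).
  - by apply/funext => p; rewrite /Lop; case: ifPn.
move=> mu_; apply: measurable_fun_if => //.
  apply: measurable_funTS; apply: measurableT_comp => //.
  by apply: measurable_fun_mem; exact: pcod_measurable.
have mI : measurable (rel `&` (fun p : X * X => p.1 \in pcod g) @^-1` [set true]).
  have mm : measurable_fun rel (fun p : X * X => p.1 \in pcod g).
    apply: measurable_funTS; apply: measurableT_comp => //.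
    by apply: measurable_fun_mem; exact: pcod_measurable.
  exact: mm.
apply: (measurable_comp mrel _ mu_) => /=.
  move=> _ [[x z] /= [xz /set_mem Bx] <-].
  exact: rel_trans (graph_in_rel_ppartinv gr Bx) xz.
apply: measurable_fun_pair_in; last exact: measurable_funTS.
apply: (measurable_comp (pcod_measurable g) _ (ppartinv_measurable (p := g))).
  by move=> _ [p /= [_ /set_mem Bx] <-].
exact: measurable_funTS.
Qed.

(** The points x and g^-1 x have the same orbit, so L_g moves whole fibres. *)
Lemma fiber_norm_Lop g Psi x : graph_in_rel g ->
  fiber_norm (Lop g Psi) x = ((fun y => fiber_norm Psi (ppartinv g y)) \_ (pcod g)) x.
Proof.
move=> gr; rewrite patchE; case: ifPn => xB.
  rewrite /fiber_norm (orbit_of_eq (graph_in_rel_ppartinv gr (set_mem xB))).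
  by apply: eq_esum => z _; rewrite /Lop /= xB.
apply: esum1 => z _; rewrite /Lop /= (negbTE xB).
by rewrite Normc.normc0 expr0n.
Qed.

Lemma normL2_sqr_Lop g Psi : graph_in_rel g -> memL2 Psi ->
  (normL2_sqr mu rel (Lop g Psi) <= normL2_sqr mu rel Psi)%E.
Proof.
move=> gr PsiL; have mP := measurable_fiber_norm relsum (memL2_rep PsiL).
have -> : normL2_sqr mu rel (Lop g Psi) = (\int[mu]_(x in pdom g) fiber_norm Psi x)%E.
  rewrite -ge0_integral_ppartinv//; last by move=> x; exact: fiber_norm_ge0.
  rewrite integral_mkcond; apply: eq_integral => x _.
  exact: fiber_norm_Lop.
apply: ge0_subset_integral => //; first exact: pdom_measurable.
by move=> x _; exact: fiber_norm_ge0.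
Qed.

Lemma memL2_Lop g Psi : graph_in_rel g -> memL2 Psi -> memL2 (Lop g Psi).
Proof.
move=> gr PsiL; have [_ _ fP] := PsiL.
have [m1 m2] := measurable_rep_Lop gr (memL2_rep PsiL).
by split => //; apply: le_lt_trans fP; exact: normL2_sqr_Lop.
Qed.

Lemma rinner_Lop_le g Psi : graph_in_rel g -> memL2 Psi ->
  rinner (Lop g Psi) (Lop g Psi) <= rinner Psi Psi.
Proof.
move=> gr PsiL; rewrite -lee_fin !rinner_diag//; last exact: memL2_Lop.
exact: normL2_sqr_Lop.
Qed.

(** The right side is carried by the domain of g. The change of variables moves it to the codomain,
    where the fibres over x and g^-1 x run over the same orbit. *)
Lemma rinner_Lop g Psi Phi : graph_in_rel g -> memL2 Psi -> memL2 Phi ->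
  rinner (Lop g Psi) Phi = rinner Psi (Lop (piso_inv g) Phi).
Proof.
move=> gr PsiL PhiL; have PhiL' := memL2_Lop (graph_in_rel_inv gr) PhiL.
congr fine.
have e : (EFin \o fiber_dot Psi (Lop (piso_inv g) Phi)) =
    (EFin \o fiber_dot Psi (Lop (piso_inv g) Phi)) \_ (pdom g).
  apply/funext => x; rewrite patchE; case: ifPn => // xA /=; congr EFin.
  by apply: rsum_eq0 => z _; rewrite /Lop /= (negbTE xA) /dotR /=; ring.
rewrite [RHS](_ : _ = \int[mu]_(x in pdom g)
    (EFin \o fiber_dot Psi (Lop (piso_inv g) Phi)) x)%E; last first.
  rewrite [RHS]integral_mkcond; apply: eq_integral => x _.
  exact: (congr1 (fun h => h x) e).
rewrite -integral_ppartinv; last first.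
  apply/measurable_EFinP.
  exact: (measurable_fiber_dot relsum (memL2_rep PsiL) (memL2_rep PhiL')).
rewrite [RHS]integral_mkcond; apply: eq_integral => x _ /=.
rewrite patchE; case: ifPn => xB /=; congr EFin.
  have xB' := set_mem xB.
  rewrite /fiber_dot -(orbit_of_eq (graph_in_rel_ppartinv gr xB')).
  apply: eq_rsum => z _; rewrite /Lop /= xB (mem_set (ppartinv_dom xB')).
  by rewrite ppartinvK.
by apply: rsum_eq0 => z _; rewrite /Lop /= (negbTE xB) /dotR /=; ring.
Qed.

Hypothesis diagm : measurable [set p : X * X | p.1 = p.2].
Local Notation delta0 := (@delta0 R d X).

Lemma measurable_rep_delta0 : measurable_rep rel delta0.
Proof.
have e p : delta0 p = ((\1_[set q : X * X | q.1 = q.2] p : R)%:C)%C.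
  rewrite /delta0 indicE (_ : (p \in _) = (p.1 == p.2)); last first.
    by apply/idP/idP => [/set_mem/eqP|/eqP/mem_set].
  by rewrite rmorph_nat.
split; last first.
  by rewrite (_ : (fun p => _) = fun=> 0)//; apply/funext => p; rewrite e.
rewrite (_ : (fun p => _) = \1_[set q : X * X | q.1 = q.2]); last first.
  by apply/funext => p; rewrite e.
exact: measurable_funTS.
Qed.

Lemma esum_diag (u : X -> \bar R) x : (forall z, 0 <= u z)%E -> (forall z, z != x -> u z = 0%E) ->
  (\esum_(z in orbit_of rel x) u z = u x)%E.
Proof.
move=> u0 ux; rewrite (esumID [set x])//.
rewrite (_ : _ `&` [set x] = [set x]); last first.
  by apply/seteqP; split => [z []//|_ ->]; split => //; exact: rel_refl.
rewrite esum_set1// [X in (_ + X)%E]esum1 ?adde0// => z [_ /= zx].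
by rewrite ux//; apply/eqP.
Qed.

Lemma fiber_norm_delta0 x : fiber_norm delta0 x = 1%E.
Proof.
rewrite /fiber_norm esum_diag /delta0 /=.
- by rewrite eqxx Normc.normc1 expr1n.
- by move=> z; rewrite lee_fin sqr_ge0.
- by move=> z zx; rewrite eq_sym (negbTE zx) Normc.normc0 expr0n.
Qed.

Lemma memL2_delta0 : memL2 delta0.
Proof.
have [m1 m2] := measurable_rep_delta0; split => //.
rewrite /normL2_sqr; under eq_integral do rewrite -/(fiber_norm _ _) fiber_norm_delta0.
rewrite integral_cst// mul1e.
exact: le_lt_trans (probability_le1 mu measurableT) (ltry 1).
Qed.

(** Only the diagonal point of a fibre contributes; integrated over x this computes the real part of
    the trace of M_f. *)
Lemma fiber_dot_delta0 f x : fiber_dot (Mop f delta0) delta0 x = complex.Re (f x).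
Proof.
have dz z : z != x -> dotR (Mop f delta0 (x, z)) (delta0 (x, z)) = 0.
  by move=> zx; rewrite /delta0 /= eq_sym (negbTE zx) /dotR /=; ring.
have dx : dotR (Mop f delta0 (x, x)) (delta0 (x, x)) = complex.Re (f x).
  rewrite /Mop /delta0 /= eqxx (_ : true%:R = Complex 1 0 :> C)//.
  by case: (f x) => a b; rewrite /dotR /=; ring.
rewrite /fiber_dot /rsum !esum_diag/=.
- rewrite dx; rewrite /Num.max; do !case: ifPn; rewrite -?leNgt; lra.
- by move=> z; rewrite lee_fin le_max lexx orbT.
- by move=> z /dz ->; rewrite oppr0 maxxx.
- by move=> z; rewrite lee_fin le_max lexx orbT.
- by move=> z /dz ->; rewrite maxxx.
Qed.

End L2_operators.

Arguments memL2_0 {R d X mu rel}.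

Opaque rinner memL2.

Definition Mreal (R : realType) d (X : measurableType d) (u : X -> R) :=
  Mop (fun x => (u x)%:C%C).

(** * Square roots of multiplication operators *)

Section L2_form.
Context (R : realType) d (X : measurableType d) (mu : probability X R).
Context (rel : set (X * X)).
Hypothesis relsum : measurable_orbit_sums R rel.
Local Notation C := R[i].
Local Notation vec := (X * X -> R[i]).
Local Notation op := ((X * X -> R[i]) -> X * X -> R[i]).
Local Notation memL2 := (memL2 mu rel).
Local Notation eqL2 := (eqL2 mu rel).
Local Notation rinner := (rinner mu rel).
Implicit Types (Psi Phi : vec) (f : X -> C) (u v : X -> R) (P T : op).

(** The abstract results are applied to representatives, without identifying those that agree almost
    everywhere; only pairings are compared. *)
Let V := {Psi | memL2 Psi}.
Let lcV (a : R) (x y : V) : V :=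
  exist _ _ (memL2_lin relsum (a%:C)%C (proj2_sig x) (proj2_sig y)).
Let rV (x y : V) : R := rinner (sval x) (sval y).
Let liftV T (TL : forall Psi, memL2 Psi -> memL2 (T Psi)) (x : V) : V :=
  exist _ _ (TL _ (proj2_sig x)).

Let rV_lc a x y z : rV (lcV a x y) z = a * rV x z + rV y z.
Proof. by case: x y z => [x xL] [y yL] [z zL]; exact: rinner_lin. Qed.

Let rV_sym x y : rV x y = rV y x. Proof. exact: rinnerC. Qed.

Let rV_ge0 x : 0 <= rV x x.
Proof. by apply: (rinner_ge0 relsum); exact: proj2_sig. Qed.

Lemma rinner_cauchy_schwarz Psi Phi : memL2 Psi -> memL2 Phi ->
  rinner Psi Phi ^+ 2 <= rinner Psi Psi * rinner Phi Phi.
Proof.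
move=> PsiL PhiL.
exact: (form_cauchy_schwarz rV_lc rV_sym rV_ge0 (exist _ _ PsiL) (exist _ _ PhiL)).
Qed.

Lemma rinner_linr (a : R) Psi Phi Theta :
  memL2 Psi -> memL2 Phi -> memL2 Theta ->
  rinner Theta (fun p => a%:C%C * Psi p + Phi p) =
  a * rinner Theta Psi + rinner Theta Phi.
Proof.
by move=> PsiL PhiL ThetaL; rewrite rinnerC rinner_lin// !(rinnerC _ _ _ Theta).
Qed.

Lemma memL2_Mreal u M Psi : measurable_fun setT u -> (forall x, `|u x| <= M) ->
  memL2 Psi -> memL2 (Mreal u Psi).
Proof. by move=> mu_ uM; apply: memL2_Mop => //; exact: Linfty_real mu_ uM. Qed.

Lemma rinner_Mreal u Psi Phi : rinner (Mreal u Psi) Phi = rinner Psi (Mreal u Phi).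
Proof.
have e : (fun x => ((u x)%:C)^*)%C = (fun x => (u x)%:C%C).
  by apply/funext => x; rewrite /= oppr0.
by rewrite /Mreal rinner_Mop e.
Qed.


Lemma MrealD (a : R) u v Psi :
  Mreal (fun x => a * u x + v x) Psi = fun p => a%:C%C * Mreal u Psi p + Mreal v Psi p.
Proof. by apply/funext => p; rewrite /Mreal /Mop rmorphD rmorphM mulrDl mulrA. Qed.

Lemma MrealM u v Psi : Mreal (fun x => u x * v x) Psi = Mreal u (Mreal v Psi).
Proof. by apply/funext => p; rewrite /Mreal /Mop rmorphM mulrA. Qed.

Lemma rinner_Mreal_lin (a : R) u v M N Psi Phi :
  measurable_fun setT u -> (forall x, `|u x| <= M) ->
  measurable_fun setT v -> (forall x, `|v x| <= N) ->
  memL2 Psi -> memL2 Phi ->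
  rinner (Mreal (fun x => a * u x + v x) Psi) Phi =
  a * rinner (Mreal u Psi) Phi + rinner (Mreal v Psi) Phi.
Proof.
move=> mu_ uM mv vN PsiL PhiL.
have uL := memL2_Mreal mu_ uM PsiL; have vL := memL2_Mreal mv vN PsiL.
by rewrite MrealD (rinner_lin relsum a uL vL PhiL).
Qed.

Lemma rinner_Mreal_le u M Psi : measurable_fun setT u -> 0 <= M ->
  (forall x, `|u x| <= M) -> memL2 Psi ->
  rinner (Mreal u Psi) (Mreal u Psi) <= M ^+ 2 * rinner Psi Psi.
Proof.
move=> mu_ M0 uM PsiL; apply: rinner_Mop_le => //; first exact: Linfty_real mu_ uM.
by apply: nearW => x; rewrite /= expr0n addr0 sqrtr_sqr.
Qed.

Definition L2_symmetric T := forall Psi Phi, memL2 Psi -> memL2 Phi ->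
  rinner (T Psi) Phi = rinner Psi (T Phi).

(* The iterates are the polynomials in the multiplier used by
   [positive_sqrt_unique]. *)
Fixpoint quad_iter (u : X -> R) (n : nat) : X -> R :=
  if n is m.+1 then fun x => (-1) * (quad_iter u m x * quad_iter u m x) + quad_iter u m x
  else u.

(** If q <= 1 / N then q - q^2 <= 1 / (N + 1): either q is already that small, or (N + 1) q > 1
    gives (N + 1) (q - q^2) < N q <= 1. *)
Lemma quad_iter_bound u : (forall x, 0 <= u x <= 1) ->
  forall n x, 0 <= quad_iter u n x <= n.+1%:R^-1.
Proof.
move=> u01; elim=> [|n IH] x /=; first by rewrite invr1.
have /andP[q0 q1] := IH x; set q := quad_iter u n x in q0 q1 *.
have n0 : 0 < n.+1%:R :> R by [].
have q1' : n.+1%:R * q <= 1 by rewrite -ler_pdivlMl// mulr1.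
have nE : n.+2%:R = n.+1%:R + 1 :> R by rewrite -natr1.
have q2 : q <= 1.
  by apply: le_trans q1 _; rewrite invf_le1// ler1n.
apply/andP; split; first nra.
rewrite -[leRHS]div1r ler_pdivlMr// nE.
move: {q1} (n.+1%:R) q1' n0 => N; move: q q0 q2 => q q0 q2 Nq N0.
have [Nq2|] := leP ((N + 1) * q) 1; nra.
Qed.

Lemma measurable_quad_iter u n : measurable_fun setT u ->
  measurable_fun setT (quad_iter u n).
Proof.
move=> mu_; elim: n => //= n IH; apply: measurable_funD => //.
by apply: measurable_funM => //; exact: measurable_funM.
Qed.

(** The K_j of the abstract lemma are multiplications by [quad_iter] of u / c. Dividing by c puts
    the multiplier into [0, 1], where these iterates decay like 1 / (j + 1). *)
Lemma sqrt_Mreal_unique P u c :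
  measurable_fun setT u -> 0 < c -> (forall x, 0 <= u x <= c) ->
  (forall Psi, memL2 Psi -> memL2 (P Psi)) -> L2_symmetric P ->
  (forall Psi, memL2 Psi -> 0 <= rinner (P Psi) Psi) ->
  (forall Psi Phi, memL2 Psi -> memL2 Phi ->
    rinner (P Psi) (P Phi) = rinner (Mreal u Psi) (Mreal u Phi)) ->
  forall Psi Phi, memL2 Psi -> memL2 Phi ->
    rinner (P Psi) Phi = rinner (Mreal u Psi) Phi.
Proof.
move=> mu_ c0 uc PL Psym Ppos PP Psi Phi PsiL PhiL.
have cn0 : c != 0 by rewrite gt_eqF.
pose k := quad_iter (fun x => c^-1 * u x).
have mk0 : measurable_fun setT (fun x => c^-1 * u x) by exact: measurable_funM.
have mk j : measurable_fun setT (k j) by exact: measurable_quad_iter.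
have k01 x : 0 <= c^-1 * u x <= 1.
  have /andP[u0 uc'] := uc x; rewrite mulr_ge0 ?invr_ge0 ?(ltW c0)//=.
  by rewrite ler_pdivrMl// mulr1.
have kb j x : `|k j x| <= j.+1%:R^-1.
  by have /andP[q0 q1] := quad_iter_bound k01 j x; rewrite ger0_norm.
have ub x : `|u x| <= c by have /andP[q0 q1] := uc x; rewrite ger0_norm.
have KL j Theta : memL2 Theta -> memL2 (Mreal (k j) Theta) by exact: memL2_Mreal (mk j) (kb j).
have QL Theta : memL2 Theta -> memL2 (Mreal u Theta) by exact: memL2_Mreal mu_ ub.
apply: (positive_sqrt_unique rV_lc rV_sym rV_ge0 (P := liftV PL)
  (Q := liftV QL) (K := fun j => liftV (KL j)) (c := c) _ _ _ c0 _ _ _ _ _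
  (exist _ _ PsiL) (exist _ _ PhiL)).
- by move=> [x xL] [y yL]; exact: Psym.
- by move=> [x xL]; exact: Ppos.
- by move=> [x xL] [y yL]; exact: rinner_Mreal.
- by move=> [x xL] [y yL]; exact: PP.
- by move=> j [x xL] [y yL]; exact: rinner_Mreal.
- move=> [x xL] [y yL]; rewrite /rV /= /k /=.
  have m0 : measurable_fun setT (fun _ : X => 0 : R) by [].
  have b0 (z : X) : `|0 : R| <= 0 by rewrite normr0.
  have -> : Mreal u x = Mreal (fun z => c * (c^-1 * u z) + 0) x.
    by congr (Mreal _ x); apply/funext => z; rewrite addr0 mulrA divff// mul1r.
  rewrite (rinner_Mreal_lin c mk0 (kb 0%N) m0 b0 xL yL).
  rewrite (_ : Mreal (fun=> 0) x = fun=> 0) ?rinner0l ?addr0//.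
  by apply/funext => z; rewrite /Mreal /Mop mul0r.
- move=> j [x xL] [y yL]; rewrite /rV /=.
  have mkk : measurable_fun setT (fun z => k j z * k j z) by exact: measurable_funM.
  have bkk z : `|k j z * k j z| <= j.+1%:R^-1 * j.+1%:R^-1.
    by rewrite normrM ler_pM.
  rewrite (rinner_Mreal_lin (-1) mkk bkk (mk j) (kb j) xL yL) MrealM.
  by rewrite (rinner_Mreal (k j) (Mreal _ _)) mulN1r addrC.
- move=> j [x xL]; rewrite /rV /=; apply: rinner_Mreal_le => //.
Qed.

(** The last three hypotheses say that u is block diagonal for the projection E, nonpositive on its
    range and nonnegative on the complement; flipping the sign on the range therefore gives a
    positive root of u^2. *)
Lemma signed_projection_abs E u M :
  measurable_fun setT u -> 0 < M -> (forall x, `|u x| <= M) ->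
  (forall Psi, memL2 Psi -> memL2 (E Psi)) -> L2_symmetric E ->
  (forall Psi Phi, memL2 Psi -> memL2 Phi ->
    rinner (E Psi) (E Phi) = rinner (E Psi) Phi) ->
  (forall Psi Phi, memL2 Psi -> memL2 Phi ->
    rinner (Mreal u (E Psi)) (fun p => (-1)%:C%C * E Phi p + Phi p) = 0) ->
  (forall Psi, memL2 Psi -> rinner (Mreal u (E Psi)) (E Psi) <= 0) ->
  (forall Psi, memL2 Psi -> 0 <= rinner
    (Mreal u (fun p => (-1)%:C%C * E Psi p + Psi p))
    (fun p => (-1)%:C%C * E Psi p + Psi p)) ->
  forall Psi Phi, memL2 Psi -> memL2 Phi ->
    rinner (Mreal u (fun p => (-2)%:C%C * E Psi p + Psi p)) Phi =
    rinner (Mreal (fun x => `|u x|) Psi) Phi.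
Proof.
move=> mu_ M0 uM EL Es EE AE0 AE AE'.
have AL Psi : memL2 Psi -> memL2 (Mreal u Psi) by exact: memL2_Mreal mu_ uM.
have [] := signed_op_positive rV_lc rV_sym (A := liftV AL) (E := liftV EL).
- by move=> [x xL] [y yL]; exact: rinner_Mreal.
- by move=> [x xL] [y yL]; exact: Es.
- by move=> [x xL] [y yL]; exact: EE.
- by move=> [x xL] [y yL]; exact: AE0.
- by move=> [x xL]; exact: AE.
- by move=> [x xL]; exact: AE'.
move=> Ws Wp WW.
have WL Psi : memL2 Psi -> memL2 (Mreal u (fun p => (-2)%:C%C * E Psi p + Psi p)).
  by move=> PsiL; apply: (AL _); apply: (memL2_lin relsum _ (EL _ PsiL) PsiL).
have m_abs : measurable_fun setT (fun x => `|u x|) by exact: measurableT_comp.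
apply: (sqrt_Mreal_unique m_abs M0 _ WL).
- by move=> x; rewrite normr_ge0 uM.
- by move=> x y xL yL; exact: (Ws (exist _ _ xL) (exist _ _ yL)).
- by move=> x xL; exact: (Wp (exist _ _ xL)).
move=> x y xL yL; rewrite -[RHS]rinner_Mreal -MrealM.
transitivity (rinner (Mreal u x) (Mreal u y)).
  exact: (WW (exist _ _ xL) (exist _ _ yL)).
rewrite -rinner_Mreal -MrealM (_ : (fun x => `|u x| * _) = fun x => u x * u x)//.
by apply/funext => z; rewrite -normrM ger0_norm// -expr2 sqr_ge0.
Qed.

End L2_form.

(** * Bounded operators *)

Section bounded_operators.
Context (R : realType) d (X : measurableType d) (mu : probability X R).
Context (rel : set (X * X)).
Hypothesis relsum : measurable_orbit_sums R rel.
Local Notation C := R[i].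
Local Notation vec := (X * X -> R[i]).
Local Notation op := ((X * X -> R[i]) -> X * X -> R[i]).
Local Notation memL2 := (memL2 mu rel).
Local Notation eqL2 := (eqL2 mu rel).
Local Notation rinner := (rinner mu rel).
Local Notation bounded_op := (bounded_op mu rel).
Implicit Types (Psi Phi Theta : vec) (f : X -> C) (P S T : op).

Lemma memL2_ivec Psi : memL2 Psi -> memL2 (ivec Psi).
Proof.
move=> PsiL; apply: (memL2_Mop relsum (f := fun=> 'i%C)) => //.
by split => //; exists 1; apply: nearW => x /=; rewrite expr0n expr1n add0r sqrtr1.
Qed.


Lemma eqL2_refl Psi : eqL2 Psi Psi. Proof. exact: nearW. Qed.

Lemma eqL2_trans Psi Phi Theta : eqL2 Psi Phi -> eqL2 Phi Theta -> eqL2 Psi Theta.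
Proof. by apply: filterS2 => x h1 h2 z xz; rewrite h1// h2. Qed.

Lemma bounded_op_mem P Psi : bounded_op P -> memL2 Psi -> memL2 (P Psi).
Proof. by case=> h _ _ _; exact: h. Qed.

Lemma bounded_op_lin P (a : R) Psi Phi Theta : bounded_op P ->
  memL2 Psi -> memL2 Phi -> memL2 Theta ->
  rinner (P (fun p => a%:C%C * Psi p + Phi p)) Theta =
  a * rinner (P Psi) Theta + rinner (P Phi) Theta.
Proof.
move=> bP PsiL PhiL ThetaL; have [_ _ h _] := bP.
have L := memL2_lin relsum (a%:C)%C PsiL PhiL.
have L1 := bounded_op_mem bP PsiL; have L2 := bounded_op_mem bP PhiL.
rewrite (eqL2_rinner relsum (bounded_op_mem bP L)
  (memL2_lin relsum (a%:C)%C L1 L2) ThetaL (h _ _ _ PsiL PhiL)).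
exact: rinner_lin.
Qed.

(** Linearity with scalar 1 and two zero vectors reads P 0 = P 0 + P 0. *)
Lemma bounded_op0 P : bounded_op P -> eqL2 (P (fun=> 0)) (fun=> 0).
Proof.
move=> bP; have [_ _ h _] := bP.
have := h 1 _ _ memL2_0 memL2_0.
rewrite (_ : (fun _ => 1 * 0 + 0) = fun=> 0); last first.
  by apply/funext => p; rewrite mul1r addr0.
apply: filterS => x hx z /hx /eqP.
by rewrite mul1r eq_sym -subr_eq0 addrK => /eqP.
Qed.

Lemma bounded_op_ivec P Psi Theta : bounded_op P -> memL2 Psi -> memL2 Theta ->
  rinner (P (ivec Psi)) Theta = rinner (ivec (P Psi)) Theta.
Proof.
move=> bP PsiL ThetaL; have [_ _ h _] := bP.
have e := h 'i%C Psi _ PsiL memL2_0.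
rewrite (_ : (fun p => _ + 0) = ivec Psi) in e; last first.
  by apply/funext => p; rewrite addr0.
have iL := memL2_ivec PsiL.
apply: (eqL2_rinner relsum) => //.
- exact: bounded_op_mem.
- by apply: memL2_ivec; exact: bounded_op_mem.
apply: filterS2 e (bounded_op0 bP) => x e1 e2 z xz.
by rewrite e1// e2// addr0.
Qed.

(** A complex form that is real on the diagonal is Hermitian: its imaginary part at u + v gives
    [cross], and v = i Phi turns that into symmetry of the real form. *)
Lemma positive_op_symmetric P : bounded_op P -> positive_op mu rel P ->
  L2_symmetric mu rel P /\ forall Psi, memL2 Psi -> 0 <= rinner (P Psi) Psi.
Proof.
move=> bP pP.
have re Psi : memL2 Psi -> 0 <= rinner (P Psi) Psi /\ rinner (P Psi) (ivec Psi) = 0.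
  by move=> /pP; rewrite inner_rinnerE lecE/= => /andP[/eqP -> ->].
split; last by move=> Psi /re[].
move=> Psi Phi PsiL PhiL.
have cross u v : memL2 u -> memL2 v -> rinner (P u) (ivec v) + rinner (P v) (ivec u) = 0.
  move=> uL vL; have L := memL2_lin relsum (1%:C)%C uL vL.
  have [_] := re _ L.
  have uL' := bounded_op_mem bP uL; have vL' := bounded_op_mem bP vL.
  have iu := memL2_ivec uL; have iv := memL2_ivec vL.
  rewrite (bounded_op_lin 1 bP uL vL (memL2_ivec L)).
  rewrite (_ : ivec _ = fun p => (1%:C)%C * ivec u p + ivec v p); last first.
    by apply/funext => p; rewrite /ivec mulrDr mulrCA.
  rewrite !(rinner_linr relsum 1 iu iv)//.
  have [_ ->] := re _ uL; have [_ ->] := re _ vL; lra.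
have iPhi := memL2_ivec PhiL.
have := cross _ _ PsiL iPhi.
rewrite (bounded_op_ivec bP PhiL (memL2_ivec PsiL)) rinner_ivec2.
rewrite (_ : rinner (P Psi) (ivec (ivec Phi)) = - rinner (P Psi) Phi).
  by rewrite (rinnerC _ _ Psi) => /eqP; rewrite addrC subr_eq0 => /eqP ->.
have PL := bounded_op_mem bP PsiL.
have := rinner_linr relsum (-1) PhiL memL2_0 PL.
rewrite (rinnerC _ _ _ (fun=> 0)) rinner0l addr0 mulN1r => <-.
rewrite (_ : (fun p => _ + _) = ivec (ivec Phi))//; apply/funext => p.
by rewrite /ivec mulrA -expr2 sqr_i addr0 rmorphN1.
Qed.

(** K bounds the square of the operator norm, which keeps square roots out of the estimates. *)
Definition form_bounded T (K : R) :=
  forall Psi, memL2 Psi -> rinner (T Psi) (T Psi) <= K * rinner Psi Psi.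

Lemma bounded_opP T :
  (forall Psi, memL2 Psi -> memL2 (T Psi)) ->
  (forall Psi Phi, memL2 Psi -> memL2 Phi -> eqL2 Psi Phi -> eqL2 (T Psi) (T Phi)) ->
  (forall (a : C) Psi Phi, memL2 Psi -> memL2 Phi ->
     eqL2 (T (fun p => a * Psi p + Phi p)) (fun p => a * T Psi p + T Phi p)) ->
  (exists2 K, 0 <= K & form_bounded T K) -> bounded_op T.
Proof.
move=> TL Te Tlin [K K0 TK]; split => //; exists (Num.sqrt K) => Psi PsiL.
rewrite !(normL2_rinner relsum)//; last exact: TL.
by rewrite -sqrtrM// ler_wsqrtr// TK.
Qed.

Lemma bounded_op_form T : bounded_op T -> exists2 K, 0 <= K & form_bounded T K.
Proof.
move=> [TL _ _ [M TM]]; exists (M ^+ 2); first exact: sqr_ge0.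
move=> Psi PsiL; have := TM _ PsiL.
have TPL := TL _ PsiL.
rewrite !(normL2_rinner relsum)// => h.
have g1 := rinner_ge0 relsum TPL; have g2 := rinner_ge0 relsum PsiL.
rewrite -(sqr_sqrtr g1) -(sqr_sqrtr g2) -exprMn ler_pXn2r ?nnegrE ?sqrtr_ge0//.
exact: le_trans (sqrtr_ge0 _) h.
Qed.

Lemma bounded_op_comp S T : bounded_op S -> bounded_op T -> bounded_op (S \o T).
Proof.
move=> bS bT; have [SL Se Sl _] := bS; have [TL Te Tl _] := bT.
have [K K0 SK] := bounded_op_form bS; have [K' K0' TK] := bounded_op_form bT.
apply: bounded_opP.
- by move=> Psi PsiL; apply: SL; exact: TL.
- by move=> Psi Phi PsiL PhiL e; apply: Se; [exact: TL|exact: TL|exact: Te].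
- move=> a Psi Phi PsiL PhiL /=.
  apply: eqL2_trans (Sl a _ _ (TL _ PsiL) (TL _ PhiL)).
  apply: Se; [|apply: memL2_lin => //; exact: TL|exact: Tl].
  by apply: TL; exact: memL2_lin.
exists (K * K'); first exact: mulr_ge0.
move=> Psi PsiL /=; apply: le_trans (SK _ (TL _ PsiL)) _.
by rewrite -mulrA ler_wpM2l// TK.
Qed.

Lemma rinner_addl Psi Phi Theta : memL2 Psi -> memL2 Phi -> memL2 Theta ->
  rinner (fun p => Psi p + Phi p) Theta = rinner Psi Theta + rinner Phi Theta.
Proof.
move=> PsiL PhiL ThetaL; have := rinner_lin relsum 1 PsiL PhiL ThetaL.
rewrite mul1r (_ : (fun p => _ + _) = fun p => Psi p + Phi p)//.
by apply/funext => p; rewrite rmorph1 mul1r.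
Qed.

Lemma memL2_add Psi Phi : memL2 Psi -> memL2 Phi -> memL2 (fun p => Psi p + Phi p).
Proof.
move=> PsiL PhiL; rewrite (_ : (fun p => _) = fun p => 1 * Psi p + Phi p).
  exact: memL2_lin.
by apply/funext => p; rewrite mul1r.
Qed.

Lemma bounded_op_add S T : bounded_op S -> bounded_op T ->
  bounded_op (fun Psi p => S Psi p + T Psi p).
Proof.
move=> bS bT; have [SL Se Sl _] := bS; have [TL Te Tl _] := bT.
have [K K0 SK] := bounded_op_form bS; have [K' K0' TK] := bounded_op_form bT.
apply: bounded_opP.
- by move=> Psi PsiL; apply: memL2_add; [exact: SL|exact: TL].
- move=> Psi Phi PsiL PhiL e.
  apply: filterS2 (Se _ _ PsiL PhiL e) (Te _ _ PsiL PhiL e) => x e1 e2 z xz.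
  by rewrite e1// e2.
- move=> a Psi Phi PsiL PhiL /=.
  apply: filterS2 (Sl a _ _ PsiL PhiL) (Tl a _ _ PsiL PhiL) => x e1 e2 z xz.
  by rewrite e1// e2// mulrDr addrACA.
(* Expanding ||S Psi - T Psi||^2 >= 0 yields ||S Psi + T Psi||^2 <= 2 ||S Psi||^2 + 2 ||T
   Psi||^2. *)
exists (2 * K + 2 * K'); first by rewrite addr_ge0// mulr_ge0.
move=> Psi PsiL; have SP := SL _ PsiL; have TP := TL _ PsiL.
have ST := memL2_add SP TP.
rewrite rinner_addl// !(rinnerC _ _ _ (fun p => _ + _)) !rinner_addl//.
have := SK _ PsiL; have := TK _ PsiL.
have := rinner_ge0 relsum (memL2_lin relsum ((-1)%:C)%C SP TP).
have D := memL2_lin relsum ((-1)%:C)%C SP TP.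
rewrite (rinner_lin relsum (-1) SP TP D) !(rinner_linr relsum (-1) SP TP)//.
rewrite (rinnerC _ _ (T Psi) (S Psi)).
move: (rinner (S Psi) (S Psi)) (rinner (S Psi) (T Psi)) (rinner (T Psi) (T Psi))
  (rinner Psi Psi) => a b c e; lra.
Qed.

Lemma bounded_op_zero : bounded_op (fun _ _ => 0).
Proof.
apply: bounded_opP.
- by move=> *; exact: memL2_0.
- by move=> *; exact: eqL2_refl.
- by move=> a Psi Phi _ _; apply: nearW => x z _; rewrite mulr0 addr0.
by exists 0 => // Psi _; rewrite rinner0l mul0r.
Qed.

Lemma bounded_op_sum n (T : 'I_n -> op) : (forall i, bounded_op (T i)) ->
  bounded_op (fun Psi p => \sum_(i < n) T i Psi p).
Proof.
elim: n T => [|n IH] T bT.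
  rewrite (_ : (fun Psi p => _) = fun _ _ => 0); first exact: bounded_op_zero.
  by apply/funext => Psi; apply/funext => p; rewrite big_ord0.
rewrite (_ : (fun Psi p => _) = fun Psi p =>
    (fun Psi p => \sum_(i < n) T (widen_ord (leqnSn n) i) Psi p) Psi p + T ord_max Psi p).
  by apply: bounded_op_add => //; exact: IH.
by apply/funext => Psi; apply/funext => p; rewrite big_ord_recr.
Qed.

Lemma memL2_sum n (u : 'I_n -> vec) : (forall i, memL2 (u i)) ->
  memL2 (fun p => \sum_(i < n) u i p).
Proof.
elim: n u => [|n IH] u uL.
  by under eq_fun do rewrite big_ord0; exact: memL2_0.
under eq_fun do rewrite big_ord_recr /=.
by apply: memL2_add => //; exact: IH.
Qed.

Lemma rinner_sum n (u : 'I_n -> vec) Theta : (forall i, memL2 (u i)) -> memL2 Theta ->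
  rinner (fun p => \sum_(i < n) u i p) Theta = \sum_(i < n) rinner (u i) Theta.
Proof.
move=> + ThetaL; elim: n u => [|n IH] u uL.
  by under eq_fun do rewrite big_ord0; rewrite big_ord0 rinner0l.
under eq_fun do rewrite big_ord_recr /=.
by rewrite rinner_addl ?big_ord_recr/= ?IH//; exact: memL2_sum.
Qed.

Lemma bounded_op_Mop f : Linfty mu f -> bounded_op (Mop f).
Proof.
move=> fL; have [_ _ [M fM]] := fL; apply: bounded_opP.
- by move=> Psi; exact: memL2_Mop.
- by move=> Psi Phi _ _; apply: filterS => x e z xz; rewrite /Mop e.
- move=> a Psi Phi _ _; apply: nearW => x z _.
  by rewrite /Mop mulrDr mulrCA.
exists (`|M| ^+ 2); first exact: sqr_ge0.
move=> Psi PsiL; apply: rinner_Mop_le => //.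
by apply: filterS fM => x /le_trans; apply; exact: ler_norm.
Qed.

Lemma bounded_op_Mreal (u : X -> R) M : measurable_fun setT u -> (forall x, `|u x| <= M) ->
  bounded_op (Mreal u).
Proof. by move=> mu_ uM; apply: bounded_op_Mop; exact: Linfty_real mu_ uM. Qed.

(** Complex linearity of S, used for the scalar i, recovers the imaginary part of the adjoint
    relation from the real one. *)
Lemma rinner_is_adjoint T S : bounded_op T -> bounded_op S ->
  (forall Psi Phi, memL2 Psi -> memL2 Phi -> rinner (T Psi) Phi = rinner Psi (S Phi)) ->
  is_adjoint mu rel T S.
Proof.
move=> bT bS TS; split; first exact: bS.
move=> Psi Phi PsiL PhiL.
rewrite !inner_rinnerE (TS _ _ PsiL PhiL); congr Complex.
have iL := memL2_ivec PhiL.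
rewrite (TS _ _ PsiL iL) rinnerC (bounded_op_ivec bS PhiL PsiL).
by rewrite rinnerC.
Qed.

Hypothesis mrel : measurable rel.
Hypothesis rel_sym : forall x y, rel (x, y) -> rel (y, x).
Hypothesis rel_trans : forall x y z, rel (x, y) -> rel (y, z) -> rel (x, z).

(** The exceptional set N moves to its image under g, which is null because g preserves mu. *)
Lemma Lop_eqL2 (g : partial_iso mu) Psi Phi : graph_in_rel rel g ->
  eqL2 Psi Phi -> eqL2 (Lop g Psi) (Lop g Phi).
Proof.
move=> gr [N [mN N0 eN]].
exists (pcod g `&` ppartinv g @^-1` N); split.
- by apply: ppartinv_measurable => //; exact: pcod_measurable.
- have mNA : measurable (N `&` pdom g).
    by apply: measurableI => //; exact: pdom_measurable.
  rewrite (_ : _ `&` _ = pcod g `&` ppartinv g @^-1` (N `&` pdom g)).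
    rewrite preimage_ppartinv_preserves//.
    by apply/eqP; rewrite -measure_le0 -N0 le_measure ?inE//.
  apply/seteqP; split => x [Bx Nx]; split => //; last by case: Nx.
  by split => //; exact: ppartinv_dom.
move=> x /= nx; apply: contrapT => nx'; apply: nx => z xz; rewrite /Lop /=.
case: ifPn => // /set_mem Bx.
have : ~ N (ppartinv g x) by move=> h; apply: nx'.
move=> /(contra_notP (eN (ppartinv g x))) /(_ z); apply.
exact: rel_trans (graph_in_rel_ppartinv gr Bx) xz.
Qed.

Lemma bounded_op_Lop (g : partial_iso mu) : graph_in_rel rel g -> bounded_op (Lop g).
Proof.
move=> gr; apply: bounded_opP.
- by move=> Psi; exact: memL2_Lop.
- by move=> Psi Phi _ _; exact: Lop_eqL2.
- move=> a Psi Phi _ _; apply: nearW => x z _; rewrite /Lop /=.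
  by case: ifPn => //; rewrite mulr0 addr0.
by exists 1 => // Psi PsiL; rewrite mul1r; exact: rinner_Lop_le.
Qed.

End bounded_operators.

(** * Spectral measures *)

Section real_measure_moment.
Context (R : realType) (m : {measure set R -> \bar R}) (a : R).
Hypothesis mfin : (m setT < +oo)%E.
Hypothesis mint : m.-integrable setT (fun t : R => t%:E).
Local Open Scope ereal_scope.

Let mcst (c : R) : m.-integrable setT (fun _ : R => c%:E).
Proof.
apply/integrableP; split; first exact: measurable_cst.
by rewrite integral_cst//= lte_mul_pinfty// ?lee_fin.
Qed.

Let msub : m.-integrable setT (fun t : R => (t - a)%:E).
Proof. exact: (integrableB measurableT mint (mcst a)). Qed.

Lemma integral_subr : \int[m]_t (t - a)%:E = \int[m]_t t%:E - a%:E * m setT.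
Proof.
rewrite (integralB_EFin measurableT mint (mcst a)).
by rewrite integral_cst.
Qed.

Lemma moment_le : m `]a, +oo[%classic = 0 -> \int[m]_t (t - a)%:E <= 0.
Proof.
move=> m0; rewrite (negligible_integral _ _ _ m0)//.
rewrite integralE [X in X - _]integral0_eq ?sub0e ?oppe_le0.
  by apply: integral_ge0 => t _; exact: funeneg_ge0.
move=> t [_] /=; rewrite in_itv/= andbT => /negP; rewrite -leNgt => ta.
by rewrite funeposE max_r// lee_fin subr_le0.
Qed.

Lemma moment_ge : m `]-oo, a]%classic = 0 -> 0 <= \int[m]_t (t - a)%:E.
Proof.
move=> m0; rewrite (negligible_integral _ _ _ m0)//.
apply: integral_ge0 => t [_] /=; rewrite in_itv/= => /negP.
by rewrite -ltNge lee_fin subr_ge0 => /ltW.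
Qed.

(** All mass lies where t - a is strictly positive, so a vanishing integral leaves none. Having the
    endpoint a in the null half-line is what later settles the level set u = a. *)
Lemma moment_eq0 : m `]-oo, a]%classic = 0 -> \int[m]_t (t - a)%:E = 0 -> m setT = 0.
Proof.
move=> m0; rewrite (negligible_integral _ _ _ m0)//.
have -> : setT `\` `]-oo, a]%classic = `]a, +oo[%classic :> set R.
  by apply/seteqP; split => t /=; rewrite !in_itv/= andbT ltNge; [case=> _ /negP|move/negP].
move=> i0.
have mi : measurable (`]a, +oo[%classic : set R) by exact: measurable_itv.
have ms : measurable_fun `]a, +oo[%classic (fun t : R => (t - a)%:E).
  by apply: measurable_funTS; apply/measurable_EFinP; exact: measurable_funB.
have : \int[m]_(t in `]a, +oo[%classic) `|(t - a)%:E| = 0.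
  rewrite -[RHS]i0; apply: eq_integral => t.
  by rewrite inE /= in_itv/= andbT => at_; rewrite ger0_norm// subr_ge0 ltW.
move=> /(ae_eq_integral_abs m mi ms)[N [mN N0 hN]].
apply/eqP; rewrite -measure_le0.
apply: (@le_trans _ _ (m (N `|` `]-oo, a]%classic))).
  apply: le_measure; rewrite ?inE//; first exact: measurableU.
  move=> t _; have [ta|at_] := leP t a; [right|left] => //.
  apply: hN => /=; rewrite in_itv/= at_ => /(_ isT) [] /eqP.
  by rewrite subr_eq0 gt_eqF.
apply: le_trans (measureU2 m _ _) _ => //.
by rewrite -[leRHS]adde0; apply: leeD; [rewrite -[leRHS]N0|rewrite -[leRHS]m0].
Qed.

End real_measure_moment.

Section spectral.
Context (R : realType) d (X : measurableType d) (mu : probability X R).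
Context (rel : set (X * X)).
Hypothesis relsum : measurable_orbit_sums R rel.
Local Notation C := R[i].
Local Notation vec := (X * X -> R[i]).
Local Notation op := ((X * X -> R[i]) -> X * X -> R[i]).
Local Notation memL2 := (memL2 mu rel).
Local Notation eqL2 := (eqL2 mu rel).
Local Notation rinner := (rinner mu rel).
Local Notation bounded_op := (bounded_op mu rel).
Implicit Types (Psi Phi Theta : vec) (E : set R -> op).

Lemma scalar_measureE E Psi B :
  scalar_measure mu rel E Psi B = (rinner (E B Psi) Psi)%:E.
Proof. by rewrite /scalar_measure inner_rinnerE. Qed.

Section pvm.
Variable E : set R -> op.
Hypothesis hE : projection_valued_measure mu rel E.

Lemma pvm_mem B Psi : measurable B -> memL2 Psi -> memL2 (E B Psi).
Proof. by case: hE => h _ _ _ /h[bE _]; exact: bounded_op_mem. Qed.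

Lemma pvm_symmetric B : measurable B -> L2_symmetric mu rel (E B).
Proof.
case: hE => h _ _ _ /h[_ sE] Psi Phi PsiL PhiL.
by have := congr1 (@complex.Re R) (sE _ _ PsiL PhiL); rewrite !inner_rinnerE.
Qed.

Lemma pvm_setI A B Psi Phi : measurable A -> measurable B -> memL2 Psi -> memL2 Phi ->
  rinner (E (A `&` B) Psi) Phi = rinner (E B Psi) (E A Phi).
Proof.
case: hE => _ h _ _ mA mB PsiL PhiL.
have BL := pvm_mem mB PsiL.
rewrite -(pvm_symmetric mA BL PhiL).
apply: (eqL2_rinner relsum (pvm_mem (measurableI _ _ mA mB) PsiL) (pvm_mem mA BL) PhiL).
exact: h.
Qed.

Lemma pvm_idem B Psi Phi : measurable B -> memL2 Psi -> memL2 Phi ->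
  rinner (E B Psi) (E B Phi) = rinner (E B Psi) Phi.
Proof. by move=> mB PsiL PhiL; rewrite -pvm_setI// setIid. Qed.

Lemma pvm_setT Psi Phi : memL2 Psi -> memL2 Phi -> rinner (E setT Psi) Phi = rinner Psi Phi.
Proof.
case: hE => _ _ h _ PsiL PhiL.
exact: (eqL2_rinner relsum (pvm_mem measurableT PsiL) PsiL PhiL (h _ PsiL)).
Qed.

Lemma pvm_ge0 B Psi : measurable B -> memL2 Psi -> 0 <= rinner (E B Psi) Psi.
Proof.
by move=> mB PsiL; rewrite -pvm_idem//; apply: (rinner_ge0 relsum); exact: pvm_mem.
Qed.

(** Cauchy-Schwarz turns the norm convergence in the definition into convergence of the quadratic
    forms. *)
Lemma pvm_cvg (F : nat -> set R) Psi : (forall k, measurable (F k)) ->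
  trivIset setT F -> memL2 Psi ->
  (\sum_(k < N) rinner (E (F k) Psi) Psi) @[N --> \oo] -->
  rinner (E (\bigcup_k F k) Psi) Psi.
Proof.
case: hE => _ _ _ h mF tF PsiL; have {h} h := h F mF tF _ PsiL.
have mU : measurable (\bigcup_k F k) by exact: bigcupT_measurable.
pose S N := \sum_(k < N) rinner (E (F k) Psi) Psi.
rewrite -/S; set l := rinner (E (\bigcup_k F k) Psi) Psi.
have FL k := pvm_mem (mF k) PsiL.
have UL := pvm_mem mU PsiL.
pose D N p := \sum_(k < N) E (F k) Psi p - E (\bigcup_k F k) Psi p.
have DE N : D N = fun p => (-1)%:C%C * E (\bigcup_k F k) Psi p + \sum_(k < N) E (F k) Psi p.
  by apply/funext => p; rewrite /D rmorphN1 mulN1r addrC.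
have SL N : memL2 (fun p => \sum_(k < N) E (F k) Psi p) by exact: memL2_sum.
have DL N : memL2 (D N) by rewrite DE; exact: memL2_lin.
have DS N : rinner (D N) Psi = S N - l.
  rewrite DE (rinner_lin relsum (-1) UL (SL N) PsiL) rinner_sum//.
  by rewrite mulN1r addrC.
have bnd N : `|S N - l| <= normL2 mu rel (D N) * Num.sqrt (rinner Psi Psi).
  rewrite -DS (normL2_rinner relsum (DL N)) -sqrtrM; last exact: (rinner_ge0 relsum (DL N)).
  rewrite -sqrtr_sqr ler_wsqrtr//.
  exact: rinner_cauchy_schwarz.
have bnd' : \forall N \near \oo, 0 <= `|S N - l| <=
    normL2 mu rel (D N) * Num.sqrt (rinner Psi Psi).
  by apply: nearW => N; rewrite normr_ge0 bnd.
have cvg0 : normL2 mu rel (D N) * Num.sqrt (rinner Psi Psi) @[N --> \oo] --> 0.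
  rewrite -(mul0r (Num.sqrt (rinner Psi Psi))).
  by apply: cvgMr_tmp; exact: h.
have H : `|S N - l| @[N --> \oo] --> (0 : R).
  exact: (squeeze_cvgr bnd' (cvg_cst 0) cvg0).
by apply/subr_cvg0; exact: norm_cvg0 H.
Qed.

End pvm.
End spectral.

Section spectral_measure.
Context (R : realType) d (X : measurableType d) (mu : probability X R).
Context (rel : set (X * X)).
Hypothesis relsum : measurable_orbit_sums R rel.
Local Notation C := R[i].
Local Notation vec := (X * X -> R[i]).
Local Notation op := ((X * X -> R[i]) -> X * X -> R[i]).
Local Notation memL2 := (memL2 mu rel).
Local Notation eqL2 := (eqL2 mu rel).
Local Notation rinner := (rinner mu rel).
Local Notation bounded_op := (bounded_op mu rel).
Implicit Types (Psi Phi Theta : vec) (E : set R -> op).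

Section pvm_measure.
Variables (E : set R -> op) (Psi : vec).
Hypothesis hE : projection_valued_measure mu rel E.
Hypothesis PsiL : memL2 Psi.

(* The value [0] replaces the arbitrary value of [E] off the measurable sets. *)
Definition pvm_scalar (B : set R) : \bar R :=
  if `[< measurable B >] then (rinner (E B Psi) Psi)%:E else 0%E.

Lemma pvm_scalarE B : measurable B -> pvm_scalar B = (rinner (E B Psi) Psi)%:E.
Proof. by move=> mB; rewrite /pvm_scalar asboolT. Qed.

Let pvm_scalar_ge0 B : (0 <= pvm_scalar B)%E.
Proof.
by rewrite /pvm_scalar; case: asboolP => // mB; rewrite lee_fin (pvm_ge0 relsum hE).
Qed.

(** Additivity for the constant sequence of empty sets: successive partial sums share a limit and
    differ by this value, which is therefore 0. *)
Let pvm_set0 : rinner (E set0 Psi) Psi = 0.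
Proof.
pose F (_ : nat) : set R := set0.
have mF k : measurable (F k) by exact: measurable0.
have tF : trivIset setT F by apply/trivIsetP => i j _ _ _; rewrite setI0.
have h := pvm_cvg relsum hE mF tF PsiL.
have h' := h; rewrite -cvg_shiftS in h'.
set c := rinner (E set0 Psi) Psi.
have hc : (fun _ : nat => c) @ \oo --> (0 : R).
  rewrite -[X in _ --> X](subrr (rinner (E (\bigcup_k F k) Psi) Psi)).
  rewrite (_ : (fun=> c) = (fun N => \sum_(k < N.+1) rinner (E (F k) Psi) Psi -
      \sum_(k < N) rinner (E (F k) Psi) Psi)); first exact: cvgB h' h.
  by apply/funext => N; rewrite big_ord_recr /= [RHS]addrAC subrr add0r.
by have /cvg_lim <- // := hc; rewrite lim_cst.
Qed.

Lemma pvm_measure : exists m : {measure set R -> \bar R},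
  forall B, measurable B -> m B = (rinner (E B Psi) Psi)%:E.
Proof.
have m0 : pvm_scalar set0 = 0%E by rewrite pvm_scalarE// pvm_set0.
have sa : semi_sigma_additive pvm_scalar.
  move=> F mF tF mU; rewrite pvm_scalarE//.
  have h := pvm_cvg relsum hE mF tF PsiL.
  rewrite (_ : (fun n => _) = EFin \o (fun N => \sum_(k < N) rinner (E (F k) Psi) Psi)).
    by apply: cvg_EFin => //; apply: nearW.
  apply/funext => N /=; rewrite big_mkord -sumEFin; apply: eq_bigr => k _.
  by rewrite pvm_scalarE.
pose M := isMeasure.Build _ _ _ pvm_scalar m0 pvm_scalar_ge0 sa.
pose m : {measure set R -> \bar R} := HB.pack pvm_scalar M.
by exists m; exact: pvm_scalarE.
Qed.

End pvm_measure.

(** m is the spectral distribution of Psi. Its mean is expressed by the multiplier u, so that the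
    uniqueness argument can forget the operator whose spectral measure E is. *)
Definition spectral_data (u : X -> R) (E : set R -> op) Psi
    (m : {measure set R -> \bar R}) :=
  [/\ forall B, measurable B -> m B = (rinner (E B Psi) Psi)%:E,
      m.-integrable setT (fun t : R => t%:E)
    & (\int[m]_t t%:E)%E = (rinner (Mreal u Psi) Psi)%:E].

Lemma spectral_dataP P E u Psi : is_spectral_measure mu rel P E -> memL2 Psi ->
  rinner (P Psi) Psi = rinner (Mreal u Psi) Psi ->
  exists m, spectral_data u E Psi m.
Proof.
move=> [hE hP] PsiL PuE; have [m mE] := pvm_measure hE PsiL.
have eqm (f : R -> \bar R) : (\int[m]_t f t = \int[scalar_measure mu rel E Psi]_t f t)%E.
  by apply: eq_setfun_integral => B mB _; rewrite mE// scalar_measureE.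
have [intP PE] := hP _ PsiL.
have mi : m.-integrable setT (fun t : R => t%:E).
  apply/integrableP; move/integrableP : intP => [mf fi]; split => //.
  by rewrite eqm.
exists m; split => //.
have := congr1 (@complex.Re R) PE; rewrite inner_rinnerE /= PuE => ->.
rewrite fineK; first exact: (eqm (fun t => t%:E)).
by rewrite -(eqm (fun t => t%:E)); exact: integrable_fin_num.
Qed.

End spectral_measure.

(** * Uniqueness of the spectral projections of half-lines *)

Section spectral_uniqueness.
Context (R : realType) d (X : measurableType d) (mu : probability X R).
Context (rel : set (X * X)).
Hypothesis relsum : measurable_orbit_sums R rel.
Local Notation C := R[i].
Local Notation vec := (X * X -> R[i]).
Local Notation memL2 := (memL2 mu rel).
Local Notation eqL2 := (eqL2 mu rel).
Local Notation rinner := (rinner mu rel).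
Context (E : set R -> vec -> vec) (u : X -> R) (M : R).
Hypothesis hE : projection_valued_measure mu rel E.
Hypothesis mu_ : measurable_fun setT u.
Hypothesis uM : forall x, `|u x| <= M.
Hypothesis uE : forall Psi, memL2 Psi -> exists m, spectral_data mu rel u E Psi m.
Implicit Types (Psi Phi Theta x y z : vec) (B : set R).

Let MuL Psi : memL2 Psi -> memL2 (Mreal u Psi).
Proof. exact: memL2_Mreal mu_ uM. Qed.

Let bE B : measurable B -> bounded_op mu rel (E B).
Proof. by case: hE => h _ _ _ /h[]. Qed.

Let EL B Psi : measurable B -> memL2 Psi -> memL2 (E B Psi).
Proof. exact: (pvm_mem hE). Qed.

Variable a : R.
Let I : set R := `]-oo, a]%classic.
Let mI : measurable I. Proof. exact: measurable_itv. Qed.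

(** Range and kernel of the projection E(I), expressed by pairings since vectors are
    representatives. *)
Let ran x := memL2 x /\ forall z, memL2 z -> rinner (E I x) z = rinner x z.
Let ker x := memL2 x /\ forall z, memL2 z -> rinner (E I x) z = 0.

Let cpl Psi : vec := fun p => (-1)%:C%C * E I Psi p + Psi p.

Let ranE Psi : memL2 Psi -> ran (E I Psi).
Proof.
move=> PsiL; have L := EL mI PsiL; split => // z zL.
by rewrite (pvm_symmetric hE mI L zL) (pvm_idem relsum hE).
Qed.

Let cplL Psi : memL2 Psi -> memL2 (cpl Psi).
Proof. by move=> PsiL; exact: (memL2_lin relsum _ (EL mI PsiL) PsiL). Qed.

Let ker_cpl Psi : memL2 Psi -> ker (cpl Psi).
Proof.
move=> PsiL; have L := EL mI PsiL; have cL := cplL PsiL; split => // z zL.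
have zL' := EL mI zL.
rewrite (pvm_symmetric hE mI cL zL) (rinner_lin relsum (-1) L PsiL zL').
rewrite (pvm_idem relsum hE mI PsiL zL) -(pvm_symmetric hE mI PsiL zL).
by rewrite mulN1r addNr.
Qed.

Let ran_ker x y : ran x -> ker y -> rinner x y = 0.
Proof.
move=> [xL rx] [yL ky]; rewrite -rx// (pvm_symmetric hE mI xL yL) rinnerC.
exact: ky.
Qed.

(** E(B) commutes with E(I), both products being the projection of the intersection, so it respects
    the two summands. *)
Let ran_ker_E B x y : measurable B -> ran x -> ker y -> rinner (E B x) y = 0.
Proof.
move=> mB [xL rx] [yL ky].
have xBL := EL mB xL; have yBL := EL mB yL.
rewrite (pvm_symmetric hE mB xL yL) -(rx _ yBL) -(pvm_setI relsum hE mB mI xL yL).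
rewrite setIC (pvm_setI relsum hE mI mB xL yL) rinnerC.
exact: ky.
Qed.

(* The scalar measures of orthogonal parts add up, hence so do their first
   moments; polarization then shows that [u] has no off-diagonal part. *)
Let ran_ker_M x y : ran x -> ker y -> rinner (Mreal u x) y = 0.
Proof.
move=> rx ky; have [xL _] := rx; have [yL _] := ky.
pose s : vec := fun p => (1%:C)%C * x p + y p.
have sL : memL2 s by exact: (memL2_lin relsum _ xL yL).
have [mx [mxE mxi mxI]] := uE xL.
have [my [myE myi myI]] := uE yL.
have [ms [msE msi msI]] := uE sL.
have add B : measurable B -> ms B = measure_add mx my B.
  move=> mB; rewrite measure_addE (msE _ mB) (mxE _ mB) (myE _ mB) -EFinD; congr EFin.
  rewrite /s (bounded_op_lin relsum 1 (bE mB) xL yL sL).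
  have xBL := EL mB xL; have yBL := EL mB yL.
  rewrite !(rinner_linr relsum 1 xL yL)//.
  rewrite (pvm_symmetric hE mB yL xL) (rinnerC _ _ y) !(ran_ker_E mB rx ky).
  by rewrite !mul1r addr0 add0r.
have : (\int[ms]_t t%:E = \int[mx]_t t%:E + \int[my]_t t%:E)%E.
  rewrite -(integral_measure_add measurableT mxi myi).
  by apply: eq_setfun_integral => B mB _; exact: add.
rewrite msI mxI myI -EFinD => /(congr1 (@fine R)) /=.
have -> : Mreal u s = fun p => (1%:C)%C * Mreal u x p + Mreal u y p.
  by apply/funext => p; rewrite /Mreal /Mop /s mulrDr mulrCA.
have MxL := MuL xL; have MyL := MuL yL.
rewrite (rinner_lin relsum 1 MxL MyL sL) !(rinner_linr relsum 1 xL yL)//.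
rewrite (rinner_Mreal _ _ _ y x) (rinnerC _ _ y) !mul1r.
move: (rinner (Mreal u x) x) (rinner (Mreal u x) y) (rinner (Mreal u y) y).
by move=> p q r; lra.
Qed.

Let ua t := u t - a.

Let mua : measurable_fun setT ua. Proof. exact: measurable_funB. Qed.

(** The summand 1 makes the bound positive, as the uniqueness of square roots rescales by its
    inverse. *)
Let N : R := `|M| + `|a| + 1.

Let uaN t : `|ua t| <= N.
Proof.
rewrite /ua /N; apply: le_trans (ler_normB _ _) _.
by have := uM t; have := ler_norm M; lra.
Qed.

Let N0 : 0 < N. Proof. by rewrite ltr_pwDr// addr_ge0. Qed.

Let MuaL Psi : memL2 Psi -> memL2 (Mreal ua Psi).
Proof. exact: memL2_Mreal mua uaN. Qed.

Let MuaE x : Mreal ua x = fun p => (- a)%:C%C * x p + Mreal u x p.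
Proof.
by apply/funext => p; rewrite /Mreal /Mop /ua rmorphB rmorphN mulrBl mulNr addrC.
Qed.

Let rMua x y : memL2 x -> memL2 y ->
  rinner (Mreal ua x) y = rinner (Mreal u x) y - a * rinner x y.
Proof.
move=> xL yL; rewrite MuaE (rinner_lin relsum (- a) xL (MuL xL) yL).
by rewrite mulNr addrC.
Qed.

Let mT_fin Psi m : memL2 Psi -> spectral_data mu rel u E Psi m -> (m setT < +oo)%E.
Proof. by move=> PsiL [mE _ _]; rewrite mE// ltry. Qed.

Let moment Psi m : memL2 Psi -> spectral_data mu rel u E Psi m ->
  (\int[m]_t (t - a)%:E)%E = (rinner (Mreal ua Psi) Psi)%:E.
Proof.
move=> PsiL sd; have [mE mi mI'] := sd.
rewrite (integral_subr _ (mT_fin PsiL sd) mi) mI' (mE _ measurableT).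
by rewrite (pvm_setT relsum hE PsiL PsiL) -EFinM -EFinB rMua.
Qed.

(** The spectral distribution of a vector in the range of E(I) is carried by I, where t - a <= 0. *)
Let ran_le x : ran x -> rinner (Mreal ua x) x <= 0.
Proof.
move=> [xL rx]; have [m sd] := uE xL; have [mE mi mI'] := sd.
rewrite -lee_fin -(moment xL sd); apply: moment_le => //; first exact: mT_fin sd.
have mi' : measurable (`]a, +oo[%classic : set R) by exact: measurable_itv.
have e : (m setT = m I + m `]a, +oo[%classic)%E.
  rewrite -(measureU m mI mi'); last first.
    apply/seteqP; split => t //=; rewrite /I /= !in_itv/= andbT => -[].
    by rewrite leNgt => /negP.
  congr (m _); apply/seteqP; split => t //= _; rewrite /I /= !in_itv/= andbT.
  by have [|] := leP t a; [left|right].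
move: e; rewrite (mE _ measurableT) (mE _ mI) rx// (pvm_setT relsum hE xL xL).
rewrite (mE _ mi') -EFinD => /(congr1 (@fine R)) /= h; congr EFin; lra.
Qed.

Let ker_ge y : ker y -> 0 <= rinner (Mreal ua y) y.
Proof.
move=> [yL ky]; have [m sd] := uE yL; have [mE mi mI'] := sd.
rewrite -lee_fin -(moment yL sd); apply: moment_ge => //.
  exact: mT_fin sd.
by apply: etrans (mE _ mI) _; rewrite ky.
Qed.

Let ker_eq0 y : ker y -> rinner (Mreal ua y) y = 0 -> rinner y y = 0.
Proof.
move=> [yL ky] y0; have [m sd] := uE yL; have [mE mi mI'] := sd.
have : m setT = 0%E.
  apply: (moment_eq0 (a := a) (mT_fin yL sd) mi); first by apply: etrans (mE _ mI) _; rewrite ky.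
  by rewrite (moment yL sd) y0.
by rewrite (mE _ measurableT) (pvm_setT relsum hE yL yL) => /(congr1 (@fine R)).
Qed.

Let abs_eqL2 Psi : memL2 Psi ->
  eqL2 (Mreal ua (fun p => (-2)%:C%C * E I Psi p + Psi p))
       (Mreal (fun t => `|ua t|) Psi).
Proof.
move=> PsiL; have L := EL mI PsiL.
have m_abs : measurable_fun setT (fun t => `|ua t|) by exact: measurableT_comp.
have absN t : `| `|ua t| | <= N by rewrite normr_id.
apply: (eqL2_weak relsum).
- by apply: MuaL; exact: (memL2_lin relsum _ L PsiL).
- exact: memL2_Mreal m_abs absN PsiL.
move=> Theta ThetaL.
apply: (signed_projection_abs relsum mua N0 uaN _ _ _ _ _ _ PsiL ThetaL).
- by move=> x; exact: EL.
- exact: (pvm_symmetric hE mI).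
- by move=> x y xL yL; exact: (pvm_idem relsum hE).
- move=> x y xL yL; have kx := ker_cpl yL; have rx := ranE xL.
  rewrite (rMua rx.1 kx.1) (ran_ker_M rx kx) (ran_ker rx kx); lra.
- by move=> x xL; exact: (ran_le (ranE xL)).
- by move=> x xL; exact: (ker_ge (ker_cpl xL)).
Qed.

(** Cancel u - a in (u - a) (1 - 2 E(I)) Psi = |u - a| Psi; where u = a the equation is empty. *)
Let proj_pointwise Psi : memL2 Psi ->
  \forall t \ae mu, forall z : X, rel (t, z) ->
    (u t < a -> E I Psi (t, z) = Psi (t, z)) /\ (a < u t -> E I Psi (t, z) = 0).
Proof.
move=> PsiL; apply: filterS (abs_eqL2 PsiL) => t h z /h {h}.
rewrite /Mreal /Mop /=; set e := E I Psi (t, z); set s := Psi (t, z) => h.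
have c2 : (-2)%:C%C != 0 :> C by rewrite fmorph_eq0 oppr_eq0 pnatr_eq0.
split => ut.
  have un0 : (ua t)%:C%C != 0 :> C by rewrite fmorph_eq0 /ua subr_eq0 lt_eqF.
  rewrite ltr0_norm ?subr_lt0// in h.
  have h' : (ua t)%:C%C * ((-2)%:C%C * e + s + s) = 0.
    by rewrite mulrDr h -mulrDl -rmorphD addNr mul0r.
  have {h h'} := mulfI un0 (etrans h' (esym (mulr0 _))).
  case: e s => [e1 e2] [s1 s2] /eqP; rewrite eq_complex /= => /andP[/eqP h1 /eqP h2].
  by congr Complex; lra.
have un0 : (ua t)%:C%C != 0 :> C by rewrite fmorph_eq0 /ua subr_eq0 gt_eqF.
move: h; rewrite gtr0_norm ?subr_gt0// => /(mulfI un0)/eqP.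
by rewrite -subr_eq0 addrK mulf_eq0 (negbTE c2) => /eqP.
Qed.

Theorem spectral_projection_Iic Psi : memL2 Psi ->
  rinner (E I Psi) Psi = rinner (Mreal (\1_(u @^-1` I)) Psi) Psi.
Proof.
move=> PsiL.
pose D0 : set X := u @^-1` [set a]; pose D1 : set X := u @^-1` `]-oo, a[%classic.
have mD0 : measurable D0 by rewrite -[D0]setTI; exact: mu_.
have mD1 : measurable D1 by rewrite -[D1]setTI; apply: mu_ => //; exact: measurable_itv.
have ind (D : set X) t : `|\1_D t : R| <= 1.
  by rewrite indicE; case: (_ \in _); rewrite ?normr1 ?normr0.
have iL (D : set X) x : measurable D -> memL2 x -> memL2 (Mreal \1_D x).
  by move=> mD; apply: memL2_Mreal (ind D) => //; exact: measurable_indic.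
have L := EL mI PsiL.
set v0 := Mreal \1_D0 Psi; have v0L : memL2 v0 := iL _ _ mD0 PsiL.
have v0E t (z : X) : u t != a -> v0 (t, z) = 0.
  move=> ta; rewrite /v0 /Mreal /Mop /= indicE memNset ?mul0r//.
  exact/eqP.
(* The defect v0 - E(I) v0 lies in the kernel of E(I) and is carried by the level set u = a, where u
   - a kills it. Its moment is thus 0, and strict positivity makes it null. *)
have y0 : rinner (cpl v0) (cpl v0) = 0.
  apply: ker_eq0; first exact: ker_cpl.
  have cL := cplL v0L.
  rewrite (eqL2_rinner relsum (MuaL cL) memL2_0 cL); first exact: rinner0l.
  apply: filterS (proj_pointwise v0L) => t h z /h[h1 h2].
  rewrite /Mreal /Mop /cpl /ua /=.
  have [ut|ut|->] := ltgtP (u t) a.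
  - by rewrite h1// rmorphN1 mulN1r addNr mulr0.
  - by rewrite h2// v0E ?gt_eqF// !mulr0 addr0 mulr0.
  - by rewrite subrr mul0r.
have v0fix z : memL2 z -> rinner (E I v0) z = rinner v0 z.
  move=> zL; have cL := cplL v0L.
  have := eqL2_rinner relsum cL memL2_0 zL (rinner_eq0 relsum cL y0).
  rewrite rinner0l /cpl (rinner_lin relsum (-1) (EL mI v0L) v0L zL) mulN1r.
  by move=> /eqP; rewrite addrC subr_eq0 => /eqP.
pose D' := ~` D0.
have mD' : measurable D' by exact: measurableC.
have split1 x : x = (fun p => Mreal \1_D' x p + Mreal \1_D0 x p).
  apply/funext => -[t z]; rewrite /Mreal /Mop /= !indicE /D' in_setC.
  by case: (_ \in _); rewrite /= ?mul0r ?mul1r ?addr0 ?add0r.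
(* Off the level set E(I) is multiplication by the indicator of u < a; [v0fix] covers the level set,
   and the two contributions are added below. *)
have pw : eqL2 (Mreal \1_D' (E I Psi)) (Mreal \1_D1 Psi).
  apply: filterS (proj_pointwise PsiL) => t h z /h[h1 h2].
  rewrite /Mreal /Mop /= !indicE.
  have [ut|ut|ut] := ltgtP (u t) a.
  - by rewrite !mem_set ?h1//=; rewrite /D1 /D' /D0 /= ?in_itv//=; apply/eqP; rewrite lt_eqF.
  - rewrite h2// mulr0 memNset ?mul0r// /D1 /= in_itv/=.
    by rewrite ltNge ltW.
  - rewrite !memNset ?mul0r//; rewrite /D1 /D' /D0 /= ?in_itv/= ?ut ?ltxx//.
have e1 : rinner (E I Psi) (Mreal \1_D' Psi) = rinner (Mreal \1_D1 Psi) Psi.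
  rewrite -rinner_Mreal.
  exact: (eqL2_rinner relsum (iL _ _ mD' L) (iL _ _ mD1 PsiL) PsiL pw).
have e2 : rinner (E I Psi) v0 = rinner v0 Psi.
  rewrite (pvm_symmetric hE mI PsiL v0L) (rinnerC _ _ Psi (E I v0)).
  exact: v0fix PsiL.
have e3 : (fun p => Mreal \1_D1 Psi p + v0 p) = Mreal \1_(u @^-1` I) Psi.
  apply/funext => -[t z]; rewrite /v0 /Mreal /Mop /= -mulrDl -rmorphD !indicE.
  congr (_%:C%C * _); rewrite /D1 /D0 /I.
  have [ut|ut|ut] := ltgtP (u t) a.
  - rewrite mem_set/= ?in_itv// memNset/= ?mem_set/= ?in_itv/= ?ltW// ?addr0//.
    by apply/eqP; rewrite lt_eqF.
  - rewrite !memNset/= ?in_itv/= ?addr0//; first by apply/negP; rewrite -ltNge.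
      by apply/eqP; rewrite gt_eqF.
    by apply/negP; rewrite -leNgt ltW.
  - by rewrite memNset/= ?in_itv/= ?ut ?ltxx// !mem_set/= ?in_itv/= ?ut// add0r.
rewrite -e3 (rinner_addl relsum (iL _ _ mD1 PsiL) v0L PsiL) -e1 -e2.
rewrite (rinnerC _ _ _ v0) (rinnerC _ _ _ (Mreal _ _)).
rewrite -(rinner_addl relsum (iL _ _ mD' PsiL) v0L L) -split1.
exact: rinnerC.
Qed.

End spectral_uniqueness.

(** * The spectral measure of a multiplication operator *)

Section density.
Context (R : realType) d (X : measurableType d) (mu : probability X R).
Local Open Scope ereal_scope.

(** The Radon-Nikodym derivative of the induced measure is w almost everywhere, which yields the
    formula for integrals. *)
Lemma density_measure (w : X -> \bar R) :
  measurable_fun setT w -> (forall x, 0 <= w x) -> \int[mu]_x w x < +oo ->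
  exists2 k : {measure set X -> \bar R},
    (forall A, measurable A -> k A = \int[mu]_(x in A) w x) &
    (forall v : X -> \bar R, measurable_fun setT v -> (forall x, 0 <= v x) ->
      \int[k]_x v x = \int[mu]_x (v x * w x)).
Proof.
move=> mw w0 wfin.
have wi : mu.-integrable setT w.
  apply/integrableP; split => //.
  by under eq_integral do rewrite gee0_abs//.
pose k0 A := \int[mu]_(x in A) w x.
have k00 : k0 set0 = 0 by rewrite /k0 integral_set0.
have k0_ge0 A : 0 <= k0 A by apply: integral_ge0.
have k0s : semi_sigma_additive k0 by exact: semi_sigma_additive_nng_induced.
have k0f : fin_num_fun k0.
  move=> A mA; rewrite ge0_fin_numE//; apply: le_lt_trans wfin.
  by apply: ge0_subset_integral.
pose Mm := isMeasure.Build _ _ _ k0 k00 k0_ge0 k0s.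
pose km : {measure set X -> \bar R} := HB.pack k0 Mm.
pose Mf := Measure_isFinite.Build d X R (Measure.sort km) k0f.
pose k : {finite_measure set X -> \bar R} := HB.pack (Measure.sort km) Mf.
exists k => // v mv v0.
have dom : k `<< mu.
  apply/null_content_dominatesP => A mA muA.
  by rewrite /k /= /k0; apply: null_set_integral => //; exact: measurable_funTS.
rewrite -(Radon_Nikodym_SigmaFinite.change_of_variables dom)//.
have gi := Radon_Nikodym_SigmaFinite.f_integrable dom.
have mg := measurable_int _ gi.
apply: ae_eq_integral => //; [exact: emeasurable_funM|exact: emeasurable_funM|].
apply: ae_eqe_mul2l; apply: integral_ae_eq => // A _ mA.
by rewrite -(Radon_Nikodym_SigmaFinite.f_integral dom mA).
Qed.

End density.

Section multiplication_spectral_measure.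
Context (R : realType) d (X : measurableType d) (mu : probability X R).
Context (rel : set (X * X)).
Hypothesis relsum : measurable_orbit_sums R rel.
Local Notation C := R[i].
Local Notation vec := (X * X -> R[i]).
Local Notation memL2 := (memL2 mu rel).
Local Notation eqL2 := (eqL2 mu rel).
Local Notation rinner := (rinner mu rel).
Local Notation fiber_norm := (fiber_norm rel).
Context (h : X -> R) (M : R).
Hypothesis mh : measurable_fun setT h.
Hypothesis h0M : forall x, 0 <= h x <= M.
Implicit Types (Psi Phi : vec).

(** The form of a multiplier sees Psi only through [fiber_norm], the density of a finite measure
    with respect to mu. *)
Lemma rinner_Mreal_integral (v : X -> R) N Psi : measurable_fun setT v ->
  (forall x, 0 <= v x <= N) -> memL2 Psi ->
  (rinner (Mreal v Psi) Psi)%:E = (\int[mu]_x ((v x)%:E * fiber_norm Psi x))%E.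
Proof.
move=> mv v0N PsiL.
have vN x : `|v x| <= N by have /andP[v0 vN] := v0N x; rewrite ger0_norm.
have mP := memL2_rep PsiL.
have e x : fiber_dot rel (Mreal v Psi) Psi x = v x * fine (fiber_norm Psi x).
  rewrite -fiber_dot_diag /fiber_dot -rsumZ; apply: eq_rsum => z _.
  by rewrite /Mreal /Mop /dotR; case: (Psi _) => p q /=; ring.
have L := memL2_Mreal relsum mv vN PsiL.
have mW := measurable_fiber_norm relsum mP.
rewrite rinnerE /Rintegral fineK; last first.
  apply: integrable_fin_num => //.
  exact: (integrable_fiber_dot relsum L PsiL).
apply: ae_eq_integral => //.
- by apply/measurable_EFinP; exact: (measurable_fiber_dot relsum (memL2_rep L) mP).
- by apply: emeasurable_funM => //; exact/measurable_EFinP.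
apply: filterS (fiber_norm_fin relsum PsiL) => x xfin _.
by rewrite /= e EFinM fineK// ge0_fin_numE ?fiber_norm_ge0.
Qed.

Let E (B : set R) : vec -> vec := Mreal \1_(h @^-1` B).

Let mhB B : measurable B -> measurable (h @^-1` B).
Proof. by move=> mB; rewrite -[h @^-1` B]setTI; exact: mh. Qed.

Let ind01 (D : set X) t : 0 <= (\1_D t : R) <= 1.
Proof. by rewrite indicE; case: (_ \in _); rewrite ?lexx ?ler01. Qed.

Let indN (D : set X) t : `|\1_D t : R| <= 1.
Proof. by have /andP[i0 i1] := ind01 D t; rewrite ger0_norm. Qed.

Let EL B Psi : measurable B -> memL2 Psi -> memL2 (E B Psi).
Proof.
move=> mB; apply: (memL2_Mreal relsum _ (indN _)).
exact: measurable_indic (mhB mB).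
Qed.

Lemma rinner_indic_measure Psi : memL2 Psi ->
  exists2 k : {measure set X -> \bar R},
    (forall D, measurable D -> k D = (rinner (Mreal \1_D Psi) Psi)%:E) &
    (forall (v : X -> R) N, measurable_fun setT v -> (forall x, 0 <= v x <= N) ->
      (\int[k]_x (v x)%:E = (rinner (Mreal v Psi) Psi)%:E)%E).
Proof.
move=> PsiL; have mW := measurable_fiber_norm relsum (memL2_rep PsiL).
have W0 := fiber_norm_ge0 rel Psi.
have [k kE kI] := density_measure mW W0 (normL2_sqr_fin PsiL).
exists k.
  move=> D mD; rewrite kE// (rinner_Mreal_integral (measurable_indic mD) (ind01 D) PsiL).
  rewrite integral_mkcond; apply: eq_integral => x _.
  by rewrite patchE indicE; case: (_ \in _); rewrite ?mul1e ?mul0e.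
move=> v N mv v0N; rewrite kI.
- by rewrite (rinner_Mreal_integral mv v0N PsiL).
- exact/measurable_EFinP.
- by move=> x; rewrite lee_fin; have /andP[] := v0N x.
Qed.

Let inner_sym B Psi Phi : inner mu rel (E B Psi) Phi = inner mu rel Psi (E B Phi).
Proof.
rewrite !inner_rinnerE /E rinner_Mreal; congr Complex.
rewrite rinner_Mreal (_ : Mreal _ (ivec Phi) = ivec (Mreal \1_(h @^-1` B) Phi))//.
by apply/funext => p; rewrite /Mreal /Mop /ivec mulrCA.
Qed.

(** The squared norm of the remainder is the mass of h^-1 (G N), G N being the tail, for the measure
    of density [fiber_norm]; it tends to 0 by countable additivity. *)
Let E_sigma_additive (F : nat -> set R) : (forall k, measurable (F k)) ->
  trivIset setT F -> forall Psi, memL2 Psi ->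
  normL2 mu rel (fun p => \sum_(k < N) E (F k) Psi p - E (\bigcup_k F k) Psi p)
    @[N --> \oo] --> (0 : R).
Proof.
move=> mF tF Psi PsiL; have [k kE _] := rinner_indic_measure PsiL.
have mU : measurable (\bigcup_k F k) by exact: bigcupT_measurable.
pose G N : set R := \bigcup_k F k `\` \big[setU/set0]_(k < N) F k.
have mbig N : measurable (\big[setU/set0]_(k < N) F k) by exact: bigsetU_measurable.
have mG N : measurable (G N) by exact: measurableD.
have sumE N x : \sum_(k < N) (\1_(h @^-1` F k) x : R) =
    \1_(h @^-1` (\big[setU/set0]_(k < N) F k)) x.
  elim: N => [|N IH]; first by rewrite !big_ord0 preimage_set0 indic0.
  rewrite !big_ord_recr /= IH preimage_setU !indicE in_setU.
  case: (boolP (x \in h @^-1` F N)) => xN; last by rewrite orbF addr0.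
  rewrite orbT (_ : x \in _ = false) ?add0r//.
  apply/negbTE/negP => /set_mem /=; rewrite -bigcup_mkord => -[j /= jN Fj].
  have /trivIsetP/(_ j N I I) := tF.
  rewrite ltn_eqF// => /(_ isT) /seteqP[+ _] => /(_ (h x)); apply; split => //.
  exact: set_mem xN.
have DE N : (fun p => \sum_(k < N) E (F k) Psi p - E (\bigcup_k F k) Psi p) =
    Mreal (fun x => - \1_(h @^-1` G N) x) Psi.
  apply/funext => p; rewrite /E /Mreal /Mop -mulr_suml -rmorph_sum /= sumE -mulrBl.
  rewrite -rmorphB; congr (_%:C%C * _).
  have sub : \big[setU/set0]_(k < N) F k `<=` \bigcup_k F k.
    by rewrite -bigcup_mkord => t [j _ Fj]; exists j.
  rewrite !indicE /G.
  have [pN|pN] := boolP (p.1 \in h @^-1` \big[setU/set0]_(k < N) F k).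
    rewrite mem_set; last by apply: sub; exact: set_mem pN.
    rewrite memNset ?subrr ?oppr0// => -[_]; apply; exact: set_mem pN.
  rewrite sub0r; congr (- _).
  have [pU|pU] := boolP (p.1 \in h @^-1` \bigcup_k F k).
    rewrite mem_set//; split; first exact: set_mem pU.
    by move/negP : pN => h' h''; apply: h'; exact: mem_set.
  by rewrite memNset// => -[pU' _]; move/negP : pU; apply; exact: mem_set.
have nE N : normL2 mu rel (Mreal (fun x => - \1_(h @^-1` G N) x) Psi) =
    Num.sqrt (rinner (Mreal \1_(h @^-1` G N) Psi) Psi).
  have mi := measurable_indic (mhB (mG N)).
  have mi' : measurable_fun setT (fun x => - \1_(h @^-1` G N) x : R).
    by apply: measurableT_comp => //; exact: mi.
  have iN x : `|- \1_(h @^-1` G N) x : R| <= 1 by rewrite normrN; exact: indN.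
  rewrite (normL2_rinner relsum (memL2_Mreal relsum mi' iN PsiL)); congr Num.sqrt.
  rewrite -rinner_Mreal -MrealM (_ : (fun x => _ * _) = \1_(h @^-1` G N))//.
  by apply/funext => x; rewrite mulrNN indicE; case: (_ \in _); rewrite ?mulr1 ?mulr0.
under eq_fun do rewrite DE nE.
rewrite -(sqrtr0 R); apply: continuous_cvg; first exact: sqrt_continuous.
pose e B := rinner (Mreal \1_(h @^-1` B) Psi) Psi.
have ke B : measurable B -> k (h @^-1` B) = (e B)%:E by move=> mB; rewrite kE//; exact: mhB.
have tF' : trivIset setT (fun i => h @^-1` F i).
  apply/trivIsetP => i j _ _ ij; rewrite -preimage_setI.
  by move/trivIsetP : tF => /(_ _ _ I I ij) ->; rewrite preimage_set0.
have kcv : (\sum_(i < N) e (F i))%R @[N --> \oo] --> e (\bigcup_k F k).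
  have := measure_semi_sigma_additive (s := k) (fun i => h @^-1` F i)
    (fun i => mhB (mF i)) tF'.
  rewrite -preimage_bigcup => /(_ (mhB mU)).
  rewrite ke// (_ : (fun n => _) = EFin \o (fun N => \sum_(i < N) e (F i))).
    exact: fine_cvg.
  apply/funext => N /=; rewrite big_mkord -sumEFin; apply: eq_bigr => i _.
  by rewrite -ke.
have eG N : e (G N) = e (\bigcup_k F k) - \sum_(i < N) e (F i).
  have FL k' : memL2 (E (F k') Psi) by exact: EL.
  have UL : memL2 (E (\bigcup_k F k) Psi) by exact: EL.
  have SL : memL2 (fun p => \sum_(k < N) E (F k) Psi p) by exact: memL2_sum.
  have := rinner_lin relsum (-1) UL SL PsiL.
  rewrite (_ : (fun p => _ + _) = Mreal (fun x => - \1_(h @^-1` G N) x) Psi); last first.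
    by rewrite -DE; apply/funext => p; rewrite rmorphN1 mulN1r addrC.
  rewrite (rinner_sum relsum FL PsiL) mulN1r.
  rewrite (_ : Mreal _ Psi = fun p => (-1)%:C%C * Mreal \1_(h @^-1` G N) Psi p + 0); last first.
    by apply/funext => p; rewrite /Mreal /Mop rmorphN rmorphN1 mulN1r addr0 mulNr.
  rewrite (rinner_lin relsum (-1) (EL (mG N) PsiL) memL2_0 PsiL) rinner0l addr0 mulN1r.
  by rewrite -/(e (G N)) -/(e (\bigcup_k F k)) => /eqP; rewrite eqr_oppLR opprD opprK => /eqP.
rewrite (_ : (fun N => _) = (fun N => e (\bigcup_k F k) - \sum_(i < N) e (F i))).
  have h0 := cvgB (cvg_cst (e (\bigcup_k F k))) kcv; rewrite subrr in h0.
  exact: h0.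
by apply/funext => N; exact: eG.
Qed.

(** Stated for every P with the quadratic form of h, because the chosen |T| need not be literally
    multiplication by h. *)
Lemma Mreal_spectral_measure P :
  (forall Psi, memL2 Psi -> inner mu rel (P Psi) Psi = inner mu rel (Mreal h Psi) Psi) ->
  is_spectral_measure mu rel P E.
Proof.
move=> PE; split.
  split.
  - move=> B mB; split; last by move=> *; exact: inner_sym.
    apply: (bounded_op_Mreal mu relsum (u := \1_(h @^-1` B)) (M := 1)); last exact: indN.
    exact: measurable_indic (mhB mB).
  - move=> A B mA mB Psi _; apply: nearW => x z _.
    rewrite /E /Mreal /Mop /= mulrA -rmorphM; congr (_%:C%C * _).
    by rewrite preimage_setI indicI.
  - move=> Psi _; apply: nearW => x z _.
    by rewrite /E /Mreal /Mop /= preimage_setT indicT mul1r.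
  - exact: E_sigma_additive.
move=> Psi PsiL; have [k kE kI] := rinner_indic_measure PsiL.
have eqk (f : R -> \bar R) :
    (\int[scalar_measure mu rel E Psi]_t f t = \int[pushforward k h]_t f t)%E.
  by apply: eq_setfun_integral => B mB _; rewrite scalar_measureE /pushforward kE//; exact: mhB.
have hk : k.-integrable setT (fun x => (h x)%:E).
  apply/integrableP; split; first exact/measurable_EFinP.
  rewrite (_ : (\int[k]_x _)%E = (\int[k]_x (h x)%:E)%E); first by rewrite (kI _ M)// ltry.
  by apply: eq_integral => x _; rewrite /= ger0_norm//; have /andP[] := h0M x.
have ipush : (\int[pushforward k h]_t t%:E)%E = (rinner (Mreal h Psi) Psi)%:E.
  by rewrite (integral_pushforward mh)// preimage_setT (kI _ M).
have mE : measurable_fun setT (fun t : R => t%:E).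
  by apply/measurable_EFinP; exact: measurable_id.
split.
  apply/integrableP; split => //.
  rewrite eqk (ge0_integral_pushforward mh)//; last exact: measurableT_comp.
  rewrite preimage_setT; by move/integrableP : hk => [_].
rewrite PE// eqk ipush /= inner_rinnerE; congr Complex.
exact: rinner_real_ivec.
Qed.

End multiplication_spectral_measure.

(** * The determinant *)

Section null_partitions.
Context (R : realType) d (X : measurableType d) (mu : probability X R).
Local Open Scope ereal_scope.

Lemma integral_eq_null (D D' : set X) (G : X -> \bar R) :
  measurable D -> measurable D' -> measurable_fun setT G ->
  mu (D `\` D') = 0 -> mu (D' `\` D) = 0 ->
  \int[mu]_(x in D) G x = \int[mu]_(x in D') G x.
Proof.
move=> mD mD' mG N N'; rewrite integral_mkcond [RHS]integral_mkcond.
apply: ae_eq_integral => //.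
- by apply/(measurable_restrictT _ _).1 => //; exact: measurable_funTS.
- by apply/(measurable_restrictT _ _).1 => //; exact: measurable_funTS.
exists ((D `\` D') `|` (D' `\` D)); split.
- by apply: measurableU; exact: measurableD.
- apply/eqP; rewrite -measure_le0; apply: le_trans (measureU2 mu _ _) _.
  + exact: measurableD.
  + exact: measurableD.
  + by rewrite -[leRHS]adde0; apply: leeD; [rewrite -[leRHS]N|rewrite -[leRHS]N'].
move=> x /= nx; apply: contrapT => h; apply: nx => _; rewrite !patchE.
have [xD|xD] := pselect (D x); have [xD'|xD'] := pselect (D' x).
- by rewrite !mem_set.
- by exfalso; apply: h; left.
- by exfalso; apply: h; right.
- by rewrite !memNset.
Qed.

Lemma bigcup_ord n (A : 'I_n -> set X) :
  \bigcup_i A i = \big[setU/set0]_(i < n) A i.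
Proof.
rewrite -bigcup_seq; congr bigcup.
by apply/seteqP; split => i //= _; rewrite mem_index_enum.
Qed.

Lemma measure_bigsetU_ord_le n (A : 'I_n -> set X) : (forall i, measurable (A i)) ->
  mu (\big[setU/set0]_(i < n) A i) <= \sum_(i < n) mu (A i).
Proof.
elim: n A => [|n IH] A mA; first by rewrite !big_ord0 measure0.
rewrite !big_ord_recr /=; apply: le_trans (measureU2 mu _ _) _ => //.
  exact: bigsetU_measurable.
by apply: leeD => //; exact: IH.
Qed.

Lemma integral_null_partition n (A : 'I_n -> set X) (G : X -> \bar R) :
  (forall i, measurable (A i)) -> measurable_fun setT G ->
  (forall i j, i != j -> mu (A i `&` A j) = 0) ->
  \int[mu]_(x in \bigcup_i A i) G x = \sum_(i < n) \int[mu]_(x in A i) G x.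
Proof.
move=> + mG; rewrite bigcup_ord; elim: n A => [|n IH] A mA nA.
  by rewrite !big_ord0 integral_set0.
rewrite !big_ord_recr /=.
set U := \big[setU/set0]_(i < n) _.
have mU : measurable U by apply: bigsetU_measurable.
have UA : mu (U `&` A ord_max) = 0.
  apply/eqP; rewrite -measure_le0 /U big_distrl/=.
  apply: le_trans (measure_bigsetU_ord_le _) _.
    by move=> i; exact: measurableI.
  rewrite big1// => i _; apply: nA; apply/negP => /eqP/(congr1 val) /= e.
  by have := ltn_ord i; rewrite e ltnn.
rewrite -IH//; last by move=> i j ij; apply: nA; apply: contra ij => /eqP/(congr1 val)/= ij; apply/eqP/val_inj.
have -> : U `|` A ord_max = U `|` (A ord_max `\` U).
  apply/seteqP; split => x [Ux|Ax]; [by left| |by left|by right; case: Ax].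
  by have [Ux|Ux] := pselect (U x); [left|right].
rewrite integral_setU//; last 3 first.
- exact: measurableD.
- exact: measurable_funTS.
- by rewrite disj_set2E setDIK.
congr (_ + _); apply: integral_eq_null => //; first exact: measurableD.
- by rewrite setDDl setUC -setDDl setDv set0D measure0.
- by rewrite setDDr setDv set0U setIC.
Qed.

(** Replacing A_j by A_j minus A_i keeps the union and lowers the sum of the measures by that of the
    overlap. By subadditivity the new sum still dominates the measure of the union, hence the old
    sum, so the overlap is null. *)
Lemma null_overlaps n (A : 'I_n -> set X) : (forall i, measurable (A i)) ->
  \sum_(i < n) mu (A i) <= mu (\bigcup_i A i) ->
  forall i j, i != j -> mu (A i `&` A j) = 0.
Proof.
move=> mA sA i j ij.
pose A' k := if k == j then A j `\` A i else A k.
have mA' k : measurable (A' k) by rewrite /A'; case: ifPn => // _; exact: measurableD.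
have UE : \bigcup_k A k `<=` \bigcup_k A' k.
  move=> x [k _ Akx]; have [kj|kj] := eqVneq k j; last first.
    by exists k => //; rewrite /A' (negbTE kj).
  have [Aix|Aix] := pselect (A i x).
    by exists i => //; rewrite /A' (negbTE ij).
  by exists j => //; rewrite /A' eqxx; rewrite kj in Akx.
have fA k : mu (A k) \is a fin_num by exact: fin_num_measure.
have mIj : measurable (A i `&` A j) by exact: measurableI.
have jE : mu (A j) = mu (A j `\` A i) + mu (A i `&` A j).
  have mD : measurable (A j `\` A i) by exact: measurableD.
  rewrite -(measureU mu mD mIj); last first.
    by apply/seteqP; split => // x [[_ h] [h' _]].
  congr (mu _); apply/seteqP; split => [x Ajx|x [[]|[]]]//.
  by have [Aix|Aix] := pselect (A i x); [right|left].
have : \sum_(k < n) mu (A k) <= \sum_(k < n) mu (A' k).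
  apply: le_trans sA _; apply: (@le_trans _ _ (mu (\bigcup_k A' k))).
    by apply: le_measure; rewrite ?inE//; rewrite bigcup_ord; apply: bigsetU_measurable.
  by rewrite bigcup_ord; exact: measure_bigsetU_ord_le.
rewrite (bigD1 j)//= [leRHS](bigD1 j)//=.
rewrite (eq_bigr (fun k => mu (A' k))); last by move=> k kj; rewrite /A' (negbTE kj).
rewrite leeD2rE; last by apply/sum_fin_numP => k _ _; exact: fin_num_measure.
rewrite /A' eqxx jE => h.
apply/eqP; rewrite -measure_le0 -(leeD2lE (x := mu (A j `\` A i))) ?adde0//.
by apply: fin_num_measure; exact: measurableD.
Qed.

End null_partitions.

Section measurability.
Context (R : realType) d (X : measurableType d).

Lemma measurable_sqrt (u : X -> R) : measurable_fun setT u ->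
  measurable_fun setT (fun x => Num.sqrt (u x)).
Proof.
move=> mu_; apply: (measurableT_comp (f := @Num.sqrt R)) => //.
by apply: continuous_measurable_fun; exact: sqrt_continuous.
Qed.

Lemma measurable_normc (f : X -> R[i]) : measurable_cfun f ->
  measurable_fun setT (fun x => Normc.normc (f x)).
Proof.
move=> [f1 f2].
rewrite (_ : (fun x => _) = fun x => Num.sqrt (complex.Re (f x) ^+ 2 + complex.Im (f x) ^+ 2)).
  by apply: measurable_sqrt; apply: measurable_funD; exact: measurable_funX.
by apply/funext => x; case: (f x).
Qed.

Lemma measurable_lne (u : X -> R) : measurable_fun setT u ->
  measurable_fun setT (fun x => lne (u x)%:E).
Proof.
move=> mu_; rewrite /=.
apply: (measurable_fun_if (g := fun=> -oo%E) (h := fun x => (ln (u x))%:E)) => //.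
- by apply: measurable_fun_ler.
- apply: measurable_funTS; apply/measurable_EFinP; exact: measurableT_comp.
Qed.

End measurability.

(** * The weighted sum and its modulus *)

Section weighted_sum.
Context (R : realType) d (X : measurableType d) (mu : probability X R).
Context (rel : set (X * X)).
Hypothesis relsum : measurable_orbit_sums R rel.
Hypothesis mrel : measurable rel.
Hypothesis rel_sym : forall x y, rel (x, y) -> rel (y, x).
Hypothesis rel_trans : forall x y z, rel (x, y) -> rel (y, z) -> rel (x, z).
Local Notation C := R[i].
Local Notation vec := (X * X -> R[i]).
Local Notation memL2 := (memL2 mu rel).
Local Notation eqL2 := (eqL2 mu rel).
Local Notation rinner := (rinner mu rel).
Context (n : nat) (f : 'I_n -> X -> C) (g : 'I_n -> partial_iso mu).
Hypothesis hf : forall i, Linfty mu (f i).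
Hypothesis gr : forall i, graph_in_rel rel (g i).
Hypothesis hB : forall i j, i != j -> mu (pcod (g i) `&` pcod (g j)) = 0%E.
Implicit Types (Psi Phi : vec).

Definition weighted_sum : vec -> vec :=
  fun Psi p => \sum_(i < n) Mop (f i) (Lop (g i) Psi) p.

Let weighted_adj : vec -> vec := fun Psi p =>
  \sum_(i < n) Lop (piso_inv (g i)) (Mop (fun x => (f i x)^*%C) Psi) p.

Let bfg i : bounded_op mu rel (Mop (f i) \o Lop (g i)).
Proof.
by apply: bounded_op_comp => //; [exact: bounded_op_Mop|exact: bounded_op_Lop].
Qed.

Let bgf i : bounded_op mu rel (Lop (piso_inv (g i)) \o Mop (fun x => (f i x)^*%C)).
Proof.
apply: bounded_op_comp => //; last by apply: bounded_op_Mop => //; exact: Linfty_conj.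
by apply: bounded_op_Lop => //; exact: graph_in_rel_inv.
Qed.

Lemma bounded_weighted_sum : bounded_op mu rel weighted_sum.
Proof. exact: (bounded_op_sum relsum bfg). Qed.

Let termL i Psi : memL2 Psi -> memL2 (Mop (f i) (Lop (g i) Psi)).
Proof. exact: (bounded_op_mem (bfg i)). Qed.

Lemma adjoint_weighted_sum : exists S, is_adjoint mu rel weighted_sum S.
Proof.
exists weighted_adj; apply: (rinner_is_adjoint relsum bounded_weighted_sum).
  exact: (bounded_op_sum relsum bgf).
move=> Psi Phi PsiL PhiL.
rewrite /weighted_sum (rinner_sum relsum (fun i => termL i PsiL) PhiL).
have aL i : memL2 (Lop (piso_inv (g i)) (Mop (fun x => (f i x)^*%C) Phi)).
  exact: (bounded_op_mem (bgf i) PhiL).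
rewrite /weighted_adj rinnerC (rinner_sum relsum aL PsiL).
apply: eq_bigr => i _; rewrite rinner_Mop [RHS]rinnerC.
apply: (rinner_Lop relsum) => //.
by apply: (memL2_Mop relsum) => //; exact: Linfty_conj.
Qed.

(** The multiplier contributed by the index i to T^* T. *)
Definition weight i x : R :=
  if x \in pdom (g i) then Normc.normc (f i (pfun (g i) x)) ^+ 2 else 0.

Let weight_ge0 i x : 0 <= weight i x.
Proof. by rewrite /weight; case: ifPn => // _; exact: sqr_ge0. Qed.

Let mfi i : measurable_cfun (f i). Proof. by have [f1 f2 _] := hf i. Qed.

Let mweight i : measurable_fun setT (weight i).
Proof.
apply: measurable_fun_if => //.
  by apply: measurable_fun_mem; exact: pdom_measurable.
rewrite setTI (_ : _ @^-1` _ = pdom (g i)); last first.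
  by apply/seteqP; split => x /=; [move=> /set_mem|move=> /mem_set].
apply: measurable_funX.
apply: (measurable_comp measurableT _ (measurable_normc (mfi i))) => //.
exact: pfun_measurable.
Qed.

Let ae_pfun i (Q : X -> Prop) : (\forall x \ae mu, Q x) ->
  \forall x \ae mu, pdom (g i) x -> Q (pfun (g i) x).
Proof.
move=> [N [mN N0 QN]].
exists (pdom (g i) `&` pfun (g i) @^-1` N); split.
- by apply: pfun_measurable => //; exact: pdom_measurable.
- have mNB : measurable (N `&` pcod (g i)).
    by apply: measurableI => //; exact: pcod_measurable.
  rewrite (_ : _ `&` _ = pcod (piso_inv (g i)) `&`
      ppartinv (piso_inv (g i)) @^-1` (N `&` pcod (g i))).
    rewrite preimage_ppartinv_preserves//.
    by apply/eqP; rewrite -measure_le0 -N0 le_measure ?inE//.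
  apply/seteqP; split => x [Ax Nx]; split => //; last by case: Nx.
  by split => //; exact: pfun_cod.
move=> x /= nx; apply: contrapT => nx'; apply: nx => Ax.
apply: contrapT => h; apply: nx'; split => //; exact: QN.
Qed.

Lemma weight_bound : exists2 c, 0 < c &
  \forall x \ae mu, \sum_(i < n) weight i x <= c ^+ 2.
Proof.
pose M i : R := xget 0 [set M | \forall x \ae mu, Normc.normc (f i x) <= M].
have fM i : \forall x \ae mu, Normc.normc (f i x) <= M i.
  have [_ _ [K fK]] := hf i.
  exact: (@xgetPex _ 0 [set M | \forall x \ae mu, Normc.normc (f i x) <= M] (ex_intro _ K fK)).
pose s := \sum_(i < n) M i ^+ 2.
have s0 : 0 <= s by apply: sumr_ge0 => i _; exact: sqr_ge0.
(* The summand 1 keeps the constant positive when every chosen bound is 0. *)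
exists (Num.sqrt s + 1); first by rewrite ltr_wpDl// sqrtr_ge0.
have wM : \forall x \ae mu, forall i : 'I_n, weight i x <= M i ^+ 2.
  apply: filter_forall => i; apply: filterS (ae_pfun i (fM i)) => x h.
  rewrite /weight; case: ifPn => [/set_mem/h fx|_]; last exact: sqr_ge0.
  have n0 : 0 <= Normc.normc (f i (pfun (g i) x)).
    by case: (f i _) => p q; exact: sqrtr_ge0.
  by rewrite ler_pXn2r ?nnegrE// (le_trans n0).
apply: filterS wM => x h; apply: (@le_trans _ _ s).
  by apply: ler_sum => i _; exact: h.
rewrite -{1}(sqr_sqrtr s0) ler_pXn2r ?nnegrE ?sqrtr_ge0 ?addr_ge0 ?sqrtr_ge0//.
by rewrite lerDl.
Qed.

(** The f_i are only essentially bounded. For c as in [weight_bound] the truncation changes the root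
    on a null set and makes it bounded everywhere, as the results on real multipliers require. *)
Definition modulus c x : R := Num.min (Num.sqrt (\sum_(i < n) weight i x)) c.

Lemma measurable_modulus c : measurable_fun setT (modulus c).
Proof.
apply: measurable_minr => //; apply: measurable_sqrt.
exact: measurable_sum.
Qed.

Lemma modulus_bound c x : 0 < c -> 0 <= modulus c x <= c.
Proof.
by move=> c0; rewrite /modulus le_min sqrtr_ge0 (ltW c0) ge_min lexx orbT.
Qed.

Lemma modulusE c x : 0 < c -> \sum_(i < n) weight i x <= c ^+ 2 ->
  modulus c x = Num.sqrt (\sum_(i < n) weight i x).
Proof.
move=> c0 h; rewrite /modulus min_l//.
by rewrite -(ger0_norm (ltW c0)) -sqrtr_sqr ler_wsqrtr.
Qed.

(** Cross terms are carried by the overlaps of the codomains, which are null. A diagonal term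
    conjugates multiplication by |f_i|^2 with L_{g_i}, which gives multiplication by the weight. *)
Lemma rinner_weighted_sum c Psi Phi : 0 < c ->
  (\forall x \ae mu, \sum_(i < n) weight i x <= c ^+ 2) ->
  memL2 Psi -> memL2 Phi ->
  rinner (weighted_sum Psi) (weighted_sum Phi) =
  rinner (Mreal (modulus c) Psi) (Mreal (modulus c) Phi).
Proof.
move=> c0 wc PsiL PhiL.
have mm := measurable_modulus c.
have mc x : `|modulus c x| <= c.
  by have /andP[h0 hc] := modulus_bound x c0; rewrite ger0_norm.
have TPhiL := bounded_op_mem bounded_weighted_sum PhiL.
pose z i := Lop (piso_inv (g i)) (Mop (fun x => (f i x)^*%C) (Mop (f i) (Lop (g i) Psi))).
have zL i : memL2 (z i) by exact: (bounded_op_mem (bgf i) (termL i PsiL)).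
have zE i p : z i p = (weight i p.1)%:C%C * Psi p.
  case: p => x y; rewrite /z /Lop /Mop /weight /=.
  case: ifPn => [xA|_]; last by rewrite mul0r.
  have Ax := set_mem xA.
  rewrite (mem_set (pfun_cod Ax)) (pfunK Ax) mulrA; congr (_ * _).
  rewrite normc_sqr; case: (f i _) => p q /=.
  by apply/eqP; rewrite eq_complex /=; apply/andP; split; apply/eqP; ring.
rewrite {1}/weighted_sum (rinner_sum relsum (fun i => termL i PsiL) TPhiL).
transitivity (\sum_(i < n) rinner (z i) Phi).
  apply: eq_bigr => i _; rewrite rinnerC /weighted_sum.
  rewrite (rinner_sum relsum (fun i => termL i PhiL) (termL i PsiL)) (bigD1 i)//=.
  rewrite big1 ?addr0; last first.
    move=> j ji; rewrite -[RHS](rinner0l mu rel (fun=> 0)).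
    apply: (ae_eq_rinner relsum (termL j PhiL) (termL i PsiL) memL2_0 memL2_0).
    have mBB : measurable (pcod (g j) `&` pcod (g i)).
      by apply: measurableI; exact: pcod_measurable.
    exists (pcod (g j) `&` pcod (g i)); split => //; first exact: hB.
    move=> x /= h; apply: contrapT => nB; apply: h.
    rewrite /fiber_dot [RHS]rsum_eq0; last by move=> t _; rewrite /dotR /=; ring.
    apply: rsum_eq0 => t _; rewrite /Mop /Lop /=.
    case: ifPn => [/set_mem xj|_]; last by rewrite mulr0 /dotR /=; ring.
    case: ifPn => [/set_mem xi|_]; last by rewrite mulr0 /dotR /=; ring.
    by exfalso; apply: nB.
  rewrite rinner_Mop.
  rewrite (rinner_Lop relsum mrel rel_sym rel_trans (@gr i) PhiL); first exact: rinnerC.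
  by apply: (memL2_Mop relsum); [exact: Linfty_conj|exact: termL].
rewrite -(rinner_sum relsum zL PhiL) -[RHS]rinner_Mreal -MrealM.
have m2 : measurable_fun setT (fun x => modulus c x * modulus c x) by exact: measurable_funM.
have b2 x : `|modulus c x * modulus c x| <= c * c by rewrite normrM ler_pM.
apply: (eqL2_rinner relsum (memL2_sum relsum zL) (memL2_Mreal relsum m2 b2 PsiL) PhiL).
apply: filterS wc => x hx y _; rewrite /Mreal /Mop /=.
under eq_bigr do rewrite zE.
rewrite -mulr_suml -rmorph_sum /=; congr (_%:C%C * _).
by rewrite modulusE// -expr2 sqr_sqrtr// sumr_ge0.
Qed.

End weighted_sum.

(** * The spectral distribution of the modulus and the determinant *)

Section determinant.
Context (R : realType) d (X : measurableType d) (mu : probability X R).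
Context (rel : set (X * X)).
Hypothesis relsum : measurable_orbit_sums R rel.
Hypothesis rel_refl : forall x, rel (x, x).
Hypothesis diagm : measurable [set p : X * X | p.1 = p.2].
Local Notation vec := (X * X -> R[i]).
Local Notation memL2 := (memL2 mu rel).
Local Notation rinner := (rinner mu rel).
Local Notation delta0 := (@delta0 R d X).
Context (T : vec -> vec) (h : X -> R) (c : R).
Hypothesis mh : measurable_fun setT h.
Hypothesis c0 : 0 < c.
Hypothesis h0c : forall x, 0 <= h x <= c.
Hypothesis bT : bounded_op mu rel T.
Hypothesis adjT : exists S, is_adjoint mu rel T S.
Hypothesis TE : forall Psi Phi, memL2 Psi -> memL2 Phi ->
  rinner (T Psi) (T Phi) = rinner (Mreal h Psi) (Mreal h Phi).
Implicit Types (Psi Phi : vec).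

Let hN x : `|h x| <= c.
Proof. by have /andP[h0 hc] := h0c x; rewrite ger0_norm. Qed.

Let bMh : bounded_op mu rel (Mreal h).
Proof. exact: (bounded_op_Mreal mu relsum mh hN). Qed.

Let S := adjoint mu rel T.

(** [xget] falls back on a default value when nothing qualifies; existence excludes this, here and
    below for the square root and the spectral measure. *)
Let adjS : is_adjoint mu rel T S.
Proof. exact: (@xgetPex _ _ [set S | is_adjoint mu rel T S] adjT). Qed.

Let STE Psi Phi : memL2 Psi -> memL2 Phi ->
  rinner ((S \o T) Psi) Phi = rinner (Mreal h (Mreal h Psi)) Phi.
Proof.
move=> PsiL PhiL; have [bS TS] := adjS.
have TPsiL := bounded_op_mem bT PsiL.
have := congr1 (@complex.Re R) (TS _ _ PhiL TPsiL); rewrite !inner_rinnerE /= => e.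
by rewrite [LHS]rinnerC -e [LHS]rinnerC (TE PsiL PhiL) [RHS]rinner_Mreal.
Qed.

Let sqrt_exists : is_sqrt mu rel (S \o T) (Mreal h).
Proof.
have [bS _] := adjS; split => //.
- move=> Psi PsiL; rewrite inner_rinnerE rinner_real_ivec lecE /= eqxx /=.
  have [k _ kI] := rinner_indic_measure relsum PsiL.
  rewrite -lee_fin -(kI h c mh h0c); apply: integral_ge0 => x _.
  by rewrite lee_fin; have /andP[] := h0c x.
- move=> Psi PsiL; apply: (eqL2_weak relsum).
  + by do 2!apply: (bounded_op_mem bMh).
  + by apply: (bounded_op_mem bS); exact: (bounded_op_mem bT).
  by move=> Theta ThetaL; rewrite STE.
Qed.

Let P := abs_op mu rel T.

Let sqrtP : is_sqrt mu rel (S \o T) P.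
Proof.
exact: (@xgetPex _ _ [set P | is_sqrt mu rel (S \o T) P] (ex_intro _ _ sqrt_exists)).
Qed.

Let PE Psi Phi : memL2 Psi -> memL2 Phi -> rinner (P Psi) Phi = rinner (Mreal h Psi) Phi.
Proof.
have [bP pP PP] := sqrtP; have [bS _] := adjS.
have [sP p0] := positive_op_symmetric relsum bP pP.
apply: (sqrt_Mreal_unique relsum mh c0 h0c _ sP p0).
  by move=> ?; exact: bounded_op_mem.
move=> x y xL yL; have PxL := bounded_op_mem bP xL.
rewrite -(sP _ _ PxL yL).
have PPL : memL2 ((P \o P) x) := bounded_op_mem bP PxL.
have STL : memL2 ((S \o T) x) := bounded_op_mem bS (bounded_op_mem bT xL).
by rewrite (eqL2_rinner relsum PPL STL yL (PP _ xL)) (STE xL yL) rinner_Mreal.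
Qed.

Let PinE Psi : memL2 Psi -> inner mu rel (P Psi) Psi = inner mu rel (Mreal h Psi) Psi.
Proof.
by move=> PsiL; rewrite !inner_rinnerE !PE//; exact: memL2_ivec.
Qed.

Let E := spectral_measure mu rel P.

Let specE : is_spectral_measure mu rel P E.
Proof.
apply: (@xgetPex _ _ [set E | is_spectral_measure mu rel P E]).
exists (fun B => Mreal \1_(h @^-1` B)).
exact: (Mreal_spectral_measure relsum mh h0c PinE).
Qed.

Let delta0L : memL2 delta0. Proof. exact: memL2_delta0. Qed.

Let rinner_delta0 (D : set X) : measurable D ->
  (rinner (Mreal \1_D delta0) delta0)%:E = mu D.
Proof.
move=> mD; have ind x : `|\1_D x : R| <= 1.
  by rewrite indicE; case: (_ \in _); rewrite ?normr1 ?normr0.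
rewrite rinnerE /Rintegral.
under eq_integral do rewrite fiber_dot_delta0//.
rewrite /= integral_indic// setIT fineK//.
exact: fin_num_measure.
Qed.

(** The projections of half-lines give the distribution function at the trace vector. The
    complementary rays are a generating family stable under intersection, and both measures have
    mass 1. *)
Lemma abs_distributionE B : measurable B -> abs_distribution mu rel T B = mu (h @^-1` B).
Proof.
have [hE _] := specE.
have [m mE] := pvm_measure relsum hE delta0L.
have mhB C : measurable C -> measurable (h @^-1` C).
  by move=> mC; rewrite -[h @^-1` C]setTI; exact: mh.
have -> : abs_distribution mu rel T = fun B => (rinner (E B delta0) delta0)%:E.
  by apply/funext => C; rewrite /abs_distribution /trace inner_rinnerE.
have uE Psi : memL2 Psi -> exists m, spectral_data mu rel h E Psi m.
  by move=> PsiL; apply: (spectral_dataP relsum specE PsiL); exact: PE.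
have Iic a : m `]-oo, a]%classic = mu (h @^-1` `]-oo, a]).
  rewrite mE; last exact: measurable_itv.
  rewrite (spectral_projection_Iic relsum hE mh hN uE a delta0L) rinner_delta0//.
  by apply: mhB; exact: measurable_itv.
have mT : m setT = 1%E.
  rewrite mE// (pvm_setT relsum hE delta0L delta0L).
  transitivity (mu setT); last exact: probability_setT.
  rewrite -(rinner_delta0 measurableT) (_ : Mreal \1_setT delta0 = delta0)//.
  by apply/funext => p; rewrite /Mreal /Mop indicT mul1r.
pose pm' : {measure set R -> \bar R} := pushforward mu h.
pose pm := pm' mh.
move=> mB; rewrite -mE//.
have -> : mu (h @^-1` B) = pm B by [].
pose G := [set A : set R | exists x, A = `]x, +oo[%classic].
apply: (measure_unique G (fun k => `](- k%:R), +oo[%classic)) => //.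
- exact: RGenOInfty.measurableE.
- move=> _ _ [x ->] [y ->]; exists (Num.max x y).
  by apply/seteqP; split => t /=; rewrite !in_itv/= !andbT gt_max => /andP.
- by move=> k; exists (- k%:R).
- apply/seteqP; split => // t _; exists (Num.bound `|t|) => //=.
  rewrite in_itv/= andbT.
  by have := archi_boundP (normr_ge0 t); have := ler_norm (- t); rewrite normrN; lra.
- move=> _ [a ->].
  have -> : `]a, +oo[%classic = setT `\` `]-oo, a]%classic :> set R.
    by apply/seteqP; split => t /=; rewrite !in_itv/= andbT ltNge; [move/negP|case=> _ /negP].
  have mI : measurable (`]-oo, a]%classic : set R) by exact: measurable_itv.
  have pT : pm setT = 1%E by exact: (probability_setT mu).
  have compl (q : {measure set R -> \bar R}) : q setT = 1%E ->
      q (setT `\` `]-oo, a]%classic) = (1 - q `]-oo, a]%classic)%E.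
    move=> qT; have qfin : (q setT < +oo)%E by rewrite qT ltry.
    by rewrite measureD// setTI; congr (_ - _)%E.
  rewrite (compl _ mT) (compl _ pT); congr (_ - _)%E.
  exact: Iic.
- by move=> k; rewrite mE ?ltry//; exact: measurable_itv.
Qed.

(** As h is nonnegative, the domain [0, +oo[ pulls back to all of X. Both parts of the logarithm are
    transported separately because the integral may be -oo. *)
Lemma lne_FK_det : lne (FK_det mu rel T) = (\int[mu]_x lne (h x)%:E)%E.
Proof.
rewrite /FK_det expeRK.
rewrite (_ : (\int[_]_(t in _) _)%E =
   (\int[pushforward mu h]_(t in `[0%R, +oo[%classic) lne t%:E)%E); last first.
  by apply: eq_setfun_integral => B mB _; exact: abs_distributionE.
have pre : h @^-1` `[0%R, +oo[%classic = setT.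
  apply/seteqP; split => // x _ /=; rewrite in_itv/= andbT.
  by have /andP[] := h0c x.
have mI : measurable (`[0%R, +oo[%classic : set R) by exact: measurable_itv.
have mlne : measurable_fun setT (fun t : R => lne t%:E).
  by apply: (@measurable_lne _ _ _ id); exact: measurable_id.
rewrite integralE [RHS]integralE; congr (_ - _)%E.
- rewrite (ge0_integral_pushforward mh)//; last first.
    by apply: measurable_funTS; exact: measurable_funepos.
  by rewrite pre; apply: eq_integral => x _; rewrite /= !funeposE.
- rewrite (ge0_integral_pushforward mh)//; last first.
    by apply: measurable_funTS; exact: measurable_funeneg.
  by rewrite pre; apply: eq_integral => x _; rewrite /= !funenegE.
Qed.

End determinant.

Theorem theorem2p5 (R : realType) (d : measure_display) (X : measurableType d)
    (mu : probability X R)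
    (hX : standard_borel R X) (hmu : atomless mu)
    (n : nat) (f : 'I_n -> X -> R[i]) (g : 'I_n -> partial_iso mu)
    (hf : forall i, Linfty mu (f i))
    (rel : set (X * X)) (hrel : SP1 mu rel)
    (I : countType) (Lam : I -> partial_iso mu)
    (hLam : rel = generated_rel Lam)
    (hg : forall i, exists k, Lam k = g i)
    (hA : mu (\bigcup_i pdom (g i)) = 1%E)
    (hB : forall i j, i != j -> mu (pcod (g i) `&` pcod (g j)) = 0%E) :
  let T := fun (Psi : X * X -> R[i]) (p : X * X) =>
    \sum_(i < n) Mop (f i) (Lop (g i) Psi) p in
  FM_algebra rel Lam T /\
  lne (FK_det mu rel T) =
    (\sum_(i < n) \int[mu]_(x in pcod (g i)) lne (Normc.normc (f i x))%:E)%E.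
Proof.
move=> T.
have [[rr rs rt] _ mrel _] := hrel.
have diagm := standard_borel_diag hX.
have relsum : measurable_orbit_sums R rel.
  move=> u mu_ u0; rewrite hLam; rewrite hLam in mu_ mrel.
  exact: measurable_orbit_esum.
have gr i : graph_in_rel rel (g i).
  (* A generator is a word with one letter. *)
  have [k kg] := hg i; move=> x Ax; rewrite hLam; right; exists [:: (k, true)].
  by exists x => //=; rewrite /letter /= kg.
have bT : bounded_op mu rel T by exact: bounded_weighted_sum.
have inSpan : FM_span Lam T.
  exists n, (fun=> 1), (fun i => [:: Mop (f i); Lop (g i)]); split.
    move=> j L; rewrite !inE => /orP[/eqP ->|/eqP ->]; last first.
      by have [k <-] := hg j; apply: Or31; exists k.
    by apply: Or33; exists (f j).
  apply/funext => Psi; apply/funext => p; apply: eq_bigr => i _ /=.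
  by rewrite mul1r.
split.
  (* T belongs to the span and is its own approximant. *)
  split => // m Psi Phi e e0 _; exists T => // j.
  by rewrite subrr Normc.normc0.
have [c c0 wc] := weight_bound g hf.
have mh : measurable_fun setT (modulus f g c) by exact: measurable_modulus.
have h0c x : 0 <= modulus f g c x <= c by exact: modulus_bound.
rewrite (lne_FK_det relsum rr diagm mh c0 h0c bT); last 2 first.
- exact: (adjoint_weighted_sum relsum mrel rs rt hf gr).
- move=> Psi Phi PsiL PhiL.
  exact: (rinner_weighted_sum relsum mrel rs rt hf gr hB c0 wc PsiL PhiL).
have mA i : measurable (pdom (g i)) by exact: pdom_measurable.
have mB i : measurable (pcod (g i)) by exact: pcod_measurable.
have mU : measurable (\bigcup_i pdom (g i)).
  by rewrite bigcup_ord; exact: bigsetU_measurable.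
have mUB : measurable (\bigcup_i pcod (g i)).
  by rewrite bigcup_ord; exact: bigsetU_measurable.
have AB i : mu (pdom (g i)) = mu (pcod (g i)).
  rewrite -(pfun_preserves (p := g i))//; congr (mu _).
  apply/seteqP; split => [_ [x Ax <-]|y By]; first exact: pfun_cod.
  by exists (ppartinv (g i) y); [exact: ppartinv_dom|exact: ppartinvK].
have sumB : (\sum_(i < n) mu (pcod (g i)) = mu (\bigcup_i pcod (g i)))%E.
  have := integral_null_partition mB (@measurable_cst _ _ _ _ setT 1%E) hB.
  rewrite integral_cst// mul1e => ->; apply: eq_bigr => i _.
  by rewrite integral_cst// mul1e.
(* The measures of the A_i add up to the measure of the union of the B_i, at most 1, whereas the
   union of the A_i has measure 1. *)
have nA : forall i j, i != j -> mu (pdom (g i) `&` pdom (g j)) = 0%E.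
  apply: null_overlaps => //.
  rewrite (eq_bigr (fun i => mu (pcod (g i)))); last by move=> i _; exact: AB.
  by rewrite sumB [leRHS]hA; exact: probability_le1.
have mG := measurable_lne mh.
transitivity (\int[mu]_(x in \bigcup_i pdom (g i)) lne (modulus f g c x)%:E)%E.
  apply: integral_eq_null => //.
  - rewrite setTD; have := probability_setC mu mU; rewrite hA subee//.
  - by rewrite setDT measure0.
rewrite (integral_null_partition mA mG nA); apply: eq_bigr => i _.
pose u x := lne (Normc.normc (f i x))%:E.
have mu_ : measurable_fun setT u.
  by apply: measurable_lne; apply: measurable_normc; have [f1 f2 _] := hf i.
(* For the inverse of g_i the roles are exchanged: its [ppartinv] is g_i and its [pcod] is A_i, so
   the integral over B_i becomes one over A_i. *)
rewrite -[RHS](integral_ppartinv (piso_inv (g i)) mu_).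
rewrite integral_mkcond [RHS]integral_mkcond.
apply: ae_eq_integral => //.
- by apply/(measurable_restrictT _ _).1 => //; exact: measurable_funTS.
- apply/(measurable_restrictT _ _).1 => //.
    exact: mA.
  exact: (measurableT_comp mu_ (pfun_measurable (p := g i))).
(* Almost every point of A_i lies in no other A_j, so a single weight survives in the modulus. *)
have hov : \forall x \ae mu, forall j, j != i -> ~ (pdom (g i) x /\ pdom (g j) x).
  apply: filter_forall => j.
  have [->|ji] := eqVneq j i; first by apply: nearW.
  exists (pdom (g j) `&` pdom (g i)); split; [exact: measurableI|exact: nA|].
  by move=> x /= h; apply: contrapT => h'; apply: h => _ [xi xj]; apply: h'.
apply: filterS2 wc hov => x wx ov _ /=.
rewrite !patchE; case: ifPn => // /set_mem Ax; rewrite /u; congr (lne _%:E).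
rewrite modulusE// (bigD1 i)//= big1 ?addr0.
  by rewrite /weight mem_set// sqrtr_sqr ger0_norm//; case: (f i _) => p q; exact: sqrtr_ge0.
move=> j ji; rewrite /weight memNset// => Aj.
by apply: (ov j ji).
Qed.
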